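(* Let $\alpha\in(0,1)$, $1<\gamma<1+\alpha$, and let $K$ satisfy $0\le K(v,v')=K(v',v)\le K_0(v^\gamma+v'^\gamma)$ and $K(v-v',v')\le K(v,v')$ for $0\le v'\le\frac v2$. Let $b\ge\max\{\overline b(\gamma,\alpha),2\gamma+1\}$, $m>\max\{\frac{2(\gamma+1)}\alpha,\frac b\alpha+1\}$, and assume in addition that $b>\gamma+3$. Let $A\ge1$, let $T>0$ and $\overline\epsilon\in(0,1)$, and for $\epsilon\in(0,\overline\epsilon]$ let $H_{\epsilon,\mathrm{in}}\in C^1(\mathbb R\times(0,\infty))$ be non-negative with $(1+v^b)H_{\epsilon,\mathrm{in}}(y,v)\le\frac A{1+|y-v^\alpha|^m}$, and let $H_\epsilon\in C([0,T];L^\infty(\mathbb R\times(0,\infty)))$ be a mass-conserving mild solution, with initial datum $H_{\epsilon,\mathrm{in}}$, of $$\partial_tH_\epsilon+\frac1\epsilon\partial_y[(v^\alpha-y)H_\epsilon]=\frac12\int_0^vK(v-w,w)H_\epsilon(y,v-w,t)H_\epsilon(y,w,t)\,dw-\int_0^\infty K(v,w)H_\epsilon(y,v,t)H_\epsilon(y,w,t)\,dw,$$ satisfying the bounds (B) of the context on $[0,T]$. Let $\sigma\in(0,T]$. Then there exist a subsequence (not relabelled) and $H\in C([\sigma,T];\mathscr M_+(\mathbb R\times(0,\infty)))$ such that $$\int_{\mathbb R}\int_{(0,\infty)}H_\epsilon(y,v,t)\varphi(y,v)\,dv\,dy\to\int_{\mathbb R}\int_{(0,\infty)}H(y,v,t)\varphi(y,v)\,dv\,dy\qquad\text{as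 }\epsilon\to0,$$ for every $t\in[\sigma,T]$ and every $\varphi\in C_0(\mathbb R\times(0,\infty))$. Moreover, for every $t\in[\sigma,T]$, $H(y,v,t)=\overline H(v,t)\delta(y-v^\alpha)$ in the sense of measures; more precisely, there exists $\overline H\in C([\sigma,T];\mathscr M_+((0,\infty)))$ such that $$\int_{\mathbb R}\int_{(0,\infty)}H(y,v,t)\varphi(y,v)\,dv\,dy=\int_{\mathbb R}\int_{(0,\infty)}\overline H(v,t)\delta(y-v^\alpha)\varphi(y,v)\,dv\,dy$$ for every $t\in[\sigma,T]$ and $\varphi\in C_0(\mathbb R\times(0,\infty))$.
   Context: $\mathscr M_+(X)$ denotes non-negative Radon measures on $X$ (with the weak-$*$ topology, in duality with $C_0$); $C_0(X)$ denotes continuous functions on $X$ vanishing at infinity. $K_0>0$ is a fixed constant; $K$ is a measurable function on $(0,\infty)^2$. Integrals against $H(\cdot,\cdot,t)$ and $\overline H(\cdot,t)$ are integrals against measures; the right-hand side of the last formula is $\int_{(0,\infty)}\varphi(v^\alpha,v)\,\overline H(dv,t)$. $\overline d:=2\big\lceil\frac12\big(\frac{\alpha}{\alpha+1-\gamma}-1\big)\big\rceil$, $\overline b(\gamma,\alpha):=\alpha\overline d+2$. Bounds (B): there are constants $M_1,M_2$ depending only on $\alpha,\gamma,b,m$ such that, with $C_0^{m-1}=M_1A$, for all $t\in[0,T]$, $y\in\mathbb R$, $v>0$, $\epsilon\in(0,\overline\epsilon]$: if $e^{t/\epsilon}v^\alpha[1-3^{-\alpha}]\ge C_0^{-1}\epsilon^{-\frac1{m-1}}$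 then $0\le H_\epsilon\le T_1+T_2+T_3$; otherwise $0\le(1+v^b)H_\epsilon\le2Ae^{t/\epsilon}\psi(e^{t/\epsilon}(y-v^\alpha))$. Here $\psi(z)=\frac1{1+|z|^m}$, $$T_1=\frac{2A}{1+v^b}e^{t/\epsilon}\psi(e^{t/\epsilon}(y-v^\alpha))\chi_1,\quad T_2=\frac{2M_1A^3\epsilon}{(1+v^b)|y-v^\alpha|}\chi_2,\quad T_3=\frac{M_2A}{1+v^b}e^{t/\epsilon}\psi(e^{t/\epsilon}(y-v^\alpha))\chi_3,$$ where $\chi_1,\chi_2,\chi_3$ are the indicators of $\{y\ge v^\alpha-C_0^{-1}\epsilon^{-\frac1{m-1}}e^{-t/\epsilon}\}$, $\{(\frac v3)^\alpha\le y\le v^\alpha-C_0^{-1}\epsilon^{-\frac1{m-1}}e^{-t/\epsilon}\}$, $\{y\le(\frac v3)^\alpha\}$. (The paper's existence theorem provides, for suitable $M_1,M_2$, every $A\ge1$ and suitable small $T,\overline\epsilon$, solutions satisfying (B).) Mild solution on $[0,T]$: non-negative $H_\epsilon\in C([0,T];L^\infty)$ with, for all $t\in[0,T]$, $v>0$, $y\in\mathbb R$, $$H_\epsilon(y,v,t)-S_\epsilon(t)[H_\epsilon(y,v,0)]D[H_\epsilon](y,v,0,t)=\frac12\int_0^t\int_{(0,v)}D[H_\epsilon](y,v,s,t)S_\epsilon(t-s)\big[K(v-v',v')H_\epsilon(y,v-v',s)H_\epsilon(y,v',s)\big]dv'\,ds,$$ where $S_\epsilon(s)F(y,v):=e^{s/\epsilon}F(e^{s/\epsilon}(y-v^\alpha)+v^\alpha,v)$,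 $D[H_\epsilon](y,v,s,t):=\exp\big(-\int_s^ta[H_\epsilon](e^{\frac{t-\tau}\epsilon}(y-v^\alpha)+v^\alpha,v,\tau)d\tau\big)$, $a[H_\epsilon](y,v,t):=\int_{(0,\infty)}K(v,v')H_\epsilon(y,v',t)dv'$. Mass-conserving: $\int_{\mathbb R}\int_{(0,\infty)}vH_\epsilon(y,v,t)\,dv\,dy$ is constant in $t\in[0,T]$. *)

(* Defs.v *)
From HB Require Import structures.
From mathcomp Require Import all_boot all_order all_algebra.
From mathcomp Require Import all_classical all_reals all_analysis.
Set Implicit Arguments.
Unset Strict Implicit.
Unset Printing Implicit Defensive.
Import Order.TTheory GRing.Theory Num.Theory.
Import numFieldNormedType.Exports.
Local Open Scope classical_set_scope.
Local Open Scope ring_scope.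

(* Points of R x (0, oo) are pairs (y, v); functions and measures on
   R x (0, oo) (resp. (0, oo)) are represented by functions and measures on
   R * R (resp. R), of which only the part on the open set [halfplane]
   (resp. [halfline]) matters. *)
Definition halfline {R : realType} : set R := `]0, +oo[.
Definition halfplane {R : realType} : set (R * R) := setT `*` halfline.

(* C_0(X) *)
Definition vanishing {R : realType} (T : topologicalType) (X : set T) :
    set (T -> R) :=
  [set phi | {within X, continuous phi} /\
    forall e : R, 0 < e -> exists C : set T,
      [/\ compact C, C `<=` X & forall x, X x -> ~ C x -> `|phi x| < e]].

(* [mu] is carried by [X] and its restriction to [X] is a finite Radon measure.
   The topology enters only through the class [cpt] of compact sets, because R
   and R * R do not share a library structure that is both topological and
   measurable; [cpt] is always [compact] below. *)
Definition finite_radon {R : realType} d (T : measurableType d)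
    (cpt : set T -> Prop) (X : set T) (mu : {measure set T -> \bar R}) : Prop :=
  [/\ mu (~` X) = 0%E, (mu X < +oo)%E &
    forall B : set T, measurable B -> B `<=` X ->
      mu B = ereal_sup [set mu C | C in [set C | cpt C /\ C `<=` B]]].

(* C(I; M_+(X)), where M_+(X) has the weak-* topology, i.e. the coarsest
   topology making the evaluations on the test functions continuous. *)
Definition weakstar_continuous {R : realType} d (T : measurableType d)
    (tests : set (T -> R)) (X : set T) (I : set R)
    (mu : R -> {measure set T -> \bar R}) : Prop :=
  forall phi : T -> R, tests phi ->
    {within I, continuous (fun t => \int[mu t]_(x in X) (phi x)%:E)%E}.

Definition C_Mplus_halfplane {R : realType} (I : set R)
    (mu : R -> {measure set (R * R) -> \bar R}) : Prop :=
  (forall t, I t -> finite_radon (@compact (R * R)%type) halfplane (mu t)) /\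
  weakstar_continuous (vanishing halfplane) halfplane I mu.

Definition C_Mplus_halfline {R : realType} (I : set R)
    (mu : R -> {measure set R -> \bar R}) : Prop :=
  (forall t, I t -> finite_radon (@compact R) halfline (mu t)) /\
  weakstar_continuous (vanishing halfline) halfline I mu.

Definition C1_on {R : realType} (X : set (R * R)) (f : R * R -> R) : Prop :=
  forall p, X p ->
    differentiable f p /\ forall u : R * R, {for p, continuous ('D_u f)}.

Definition Linf_norm {R : realType} (f : R * R -> R) : \bar R :=
  'N[(@lebesgue_measure R \x @lebesgue_measure R)%E]_+oo[
    ((EFin \o f) \_ halfplane) ]%E.

(* Solutions are functions [H y v t].  A curve in L^oo is given by a
   representative that is jointly (Borel) measurable, so that the integrals over
   the slices of [H] in the mild formulation make sense. *)
Definition C_Linf {R : realType} (T : R) (H : R -> R -> R -> R) : Prop :=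
  [/\ measurable_fun (halfplane `*` `[0, T])
        (fun q : R * R * R => H q.1.1 q.1.2 q.2),
      forall t, 0 <= t <= T -> (Linf_norm (fun p => H p.1 p.2 t) < +oo)%E &
      forall t, 0 <= t <= T ->
        Linf_norm (fun p => H p.1 p.2 s - H p.1 p.2 t)
          @[s --> within `[0, T] (nbhs t)] --> 0%E].

Section Mild.
Context {R : realType}.
Variables (alpha eps : R) (K : R -> R -> R).
Implicit Types (H : R -> R -> R -> R) (y v s t : R).

Definition semigroup s (F : R -> R -> R) y v : R :=
  expR (s / eps) * F (expR (s / eps) * (y - v `^ alpha) + v `^ alpha) v.

Definition loss_rate H y v t : \bar R :=
  (\int[lebesgue_measure]_(w in halfline) (K v w * H y w t)%:E)%E.

Definition damping H y v s t : \bar R :=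
  expeR (- \int[lebesgue_measure]_(tau in `[s, t])
    loss_rate H (expR ((t - tau) / eps) * (y - v `^ alpha) + v `^ alpha) v tau)%E.

(* The integrals are extended-real valued, so the identity includes the
   finiteness of the gain term. *)
Definition mild_solution (T : R) H : Prop :=
  [/\ C_Linf T H,
      forall y v t, 0 < v -> 0 <= t <= T -> 0 <= H y v t &
      forall t v y, 0 <= t <= T -> 0 < v ->
        ((H y v t)%:E
           - (semigroup t (fun y' v' => H y' v' 0) y v)%:E * damping H y v 0 t
         = (2^-1)%:E *
           \int[lebesgue_measure]_(s in `[0%R, t])
             \int[lebesgue_measure]_(w in `]0%R, v[)
               (damping H y v s t *
                (semigroup (t - s)
                  (fun y' v' => (K (v' - w) w * H y' (v' - w) s * H y' w s)%R)
                  y v)%:E))%E].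

End Mild.

Definition mass {R : realType} (H : R -> R -> R -> R) (t : R) : \bar R :=
  (\int[lebesgue_measure]_y \int[lebesgue_measure]_(v in halfline)
     (v * H y v t)%:E)%E.

Definition mass_conserving {R : realType} (T : R) (H : R -> R -> R -> R) : Prop :=
  forall t, 0 <= t <= T -> mass H t = mass H 0.

Definition coagulation_kernel {R : realType} (K0 gamma : R) (K : R -> R -> R) :
    Prop :=
  [/\ measurable_fun (halfline `*` halfline) (fun p : R * R => K p.1 p.2),
      forall v w, 0 < v -> 0 < w ->
        0 <= K v w /\ K v w = K w v /\
        K v w <= K0 * (v `^ gamma + w `^ gamma) &
      forall v w, 0 < v -> 0 <= w <= v / 2 -> K (v - w) w <= K v w].

Definition dbar {R : realType} (alpha gamma : R) : R :=
  2 * (Num.ceil (2^-1 * (alpha / (alpha + 1 - gamma) - 1)))%:~R.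

Definition bbar {R : realType} (gamma alpha : R) : R :=
  alpha * dbar alpha gamma + 2.

Section Bounds.
Context {R : realType}.
Variables (alpha b m M1 M2 A eps : R).
Implicit Types (y v t : R).

Definition psi (z : R) : R := (1 + `|z| `^ m)^-1.

(* The constant C_0 with C_0 ^ (m - 1) = M1 A, and the length
   C_0^-1 eps^(-1/(m-1)), which is compared with e^(t/eps) (v^alpha - y). *)
Definition C0 : R := (M1 * A) `^ (m - 1)^-1.
Definition threshold : R := C0^-1 * eps `^ (- (m - 1)^-1).

Definition profile y v t : R :=
  expR (t / eps) * psi (expR (t / eps) * (y - v `^ alpha)).

Definition cut v t : R := v `^ alpha - threshold * expR (- (t / eps)).

Definition T1 y v t : R :=
  2 * A / (1 + v `^ b) * profile y v t * \1_`[cut v t, +oo[ y.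

Definition T2 y v t : R :=
  2 * M1 * A ^+ 3 * eps / ((1 + v `^ b) * `|y - v `^ alpha|) *
  \1_`[(v / 3) `^ alpha, cut v t] y.

Definition T3 y v t : R :=
  M2 * A / (1 + v `^ b) * profile y v t * \1_`]-oo, (v / 3) `^ alpha] y.

Definition boundsB (T : R) (H : R -> R -> R -> R) : Prop :=
  forall t y v, 0 <= t <= T -> 0 < v ->
    if threshold <= expR (t / eps) * v `^ alpha * (1 - 3 `^ (- alpha))
    then 0 <= H y v t <= T1 y v t + T2 y v t + T3 y v t
    else 0 <= (1 + v `^ b) * H y v t <= 2 * A * profile y v t.

End Bounds.

(* Main.v *)
Require Import Defs.
From HB Require Import structures.
From mathcomp Require Import all_boot all_order all_algebra.
From mathcomp Require Import all_classical all_reals all_analysis.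
From mathcomp Require Import measurable_realfun ring lra.
Set Implicit Arguments.
Unset Strict Implicit.
Unset Printing Implicit Defensive.
Import Order.TTheory GRing.Theory Num.Theory.
Import numFieldNormedType.Exports.
Local Open Scope classical_set_scope.
Local Open Scope ring_scope.

(** Everything is read off the cumulative mass F_eps(x, t), the integral of
    H_eps(y, v, t) over all y and over 0 < v <= x.

    The bounds on H_eps amount to a domination by w(v) k(y - v^alpha), where
    w(v) = (1 + v^alpha) / (1 + v^b) and k is an approximate Dirac mass of width
    e^(-t/eps) plus a tail eps / ((delta + |z|) (1 + |z|)) with delta of the
    order of e^(-t/eps), up to a power of eps ([bounds_domination]).  The mass
    of k stays bounded, because eps ln(1 / delta) does ([log_bound]), whereas the
    integral of min(1, |z|) k(z) is of the order of e^(-t/eps) + eps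
    ([kern_moment]).  Hence the mass of H_eps is bounded, and for t >= sigma it
    concentrates on the curve y = v^alpha ([concentration]).

    F_eps is Lipschitz, uniformly in eps.  In x this is the boundedness of the
    mass of the slices.  In t, the stiff transport disappears upon integration
    in y ([integral_flow]), so only the coagulation moves F_eps.  The loss rate
    at (y, v) is an integral over the other size w at fixed y; the change of
    variables z = w^alpha turns it into an integral of k, which bounds it by
    C (1 + v^gamma) uniformly in y and eps ([loss_rate_le]).  The total gain is
    bounded by the total loss.  With the Duhamel formula restarted at
    an arbitrary time ([duhamel]), both together give
    [cumulative_time_lipschitz].

    Bounded, equi-Lipschitz functions have a sequence converging at every
    point, say to p ([lipschitz_extraction]).  Each p(., t) is non-decreasing and
    Lipschitz, hence the cumulative function of a measure Hbar(t) dominated by a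
    multiple of the Lebesgue measure ([stieltjes_measure]), which makes it Radon
    ([finite_radon_dominated]).  The limit H(t) is its image under
    v |-> (v^alpha, v).

    It remains to test.  A function phi of C_0 is uniformly continuous, so
    phi(y, v) is within d + C min(1, |y - v^alpha|) of phi(v^alpha, v)
    ([vanishing_modulus]), which is uniformly within d of a step function of v
    ([vanishing_step]).  The integral of a step function of v is a linear
    combination of values of the cumulative mass, which converges; the errors
    are d times the mass, plus C times a quantity that vanishes with eps
    ([solution_step_approximation]).  Comparing the limit measures with the same
    step functions shows that they depend continuously on t
    ([approximated_continuous]). *)

(** * Integrals of non-negative functions *)

(** The canonical measure carried by [pushforward], as a function of the measure
    and of a proof that the map is measurable. *)
Notation image_measure :=
  measure_function_pushforward__canonical__measure_function_Measure.

Section integration.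
Context {R : realType}.
Local Notation mu := (@lebesgue_measure R).
Local Open Scope ereal_scope.

Import HBNNSimple.

(** Both integrals are suprema over the simple functions below the integrands, so
    monotonicity holds for arbitrary non-negative functions; this spares many
    measurability proofs below. *)
Lemma le_int d (T : measurableType d) (m : {measure set T -> \bar R})
    (D : set T) (f g : T -> \bar R) :
  (forall x, D x -> 0 <= f x) -> (forall x, D x -> f x <= g x) ->
  \int[m]_(x in D) f x <= \int[m]_(x in D) g x.
Proof.
move=> f0 fg; rewrite [leLHS]integral_mkcond [leRHS]integral_mkcond.
have f0' x : 0 <= (f \_ D) x.
  by rewrite /patch; case: ifPn => // /set_mem; exact: f0.
have fg' x : (f \_ D) x <= (g \_ D) x.
  by rewrite /patch; case: ifPn => // /set_mem; exact: fg.
have g0' x : 0 <= (g \_ D) x by exact: le_trans (fg' x).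
rewrite !ge0_integralTE//; apply: ge_ereal_sup => _ [h hf <-].
by apply: ereal_sup_ubound; exists h => // x; exact: le_trans (fg' x).
Qed.

Lemma measurable_slice d (T : measurableType d) (D : set R) (f : T * R -> \bar R) :
  measurable D -> measurable_fun [set: T * R] f -> (forall p, 0 <= f p) ->
  measurable_fun [set: T] (fun x => \int[mu]_(w in D) f (x, w)).
Proof.
move=> mD mf f0.
pose g : T * measurableTypeR R -> \bar R := f \_ (snd @^-1` D).
have mg : measurable_fun setT g.
  apply/(measurable_restrict _ _ measurableT).
    by rewrite -[X in measurable X]setTI; exact: measurable_snd.
  by rewrite setTI; apply: measurable_funS mf.
under eq_fun do rewrite integral_mkcond.
have g0 p : 0 <= g p by rewrite /g /patch; case: ifP.
have := @measurable_fun_fubini_tonelli_F _ _ _ _ _ mu g mg g0.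
apply: eq_measurable_fun => x _; apply: eq_integral => w _.
by rewrite /g /patch; do 2 case: ifPn => //; rewrite ?inE ?notin_setE /=.
Qed.

Lemma tonelli (f : R * R -> \bar R) :
  measurable_fun setT f -> (forall p, 0 <= f p) ->
  \int[mu]_x \int[mu]_y f (x, y) = \int[mu]_y \int[mu]_x f (x, y).
Proof. by move=> mf f0; exact: (fubini_tonelli (m1 := mu) (m2 := mu) f). Qed.

Lemma measurable_affine (L q : R) : measurable_fun [set: R] (fun y : R => L * y + q)%R.
Proof. by apply: measurable_funD => //; exact: measurable_funM. Qed.

Lemma integral_affine (L q : R) (f : R -> \bar R) : (0 < L)%R ->
  measurable_fun [set: R] f -> (forall x, 0 <= f x) ->
  \int[mu]_y (L%:E * f (L * y + q)%R) = \int[mu]_y f y.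
Proof.
move=> L0 mf f0; pose phi : measurableTypeR R -> measurableTypeR R := fun y => (L * y + q)%R.
have mphi : measurable_fun setT phi by exact: measurable_affine.
have L0' : (0 <= L)%R by exact: ltW.
pose m := mscale (NngNum L0') (image_measure mu mphi).
have muE A : measurable A -> mu A = m A.
  apply: lebesgue_measure_unique => _ [[a b] _ <-] /=.
  rewrite /m /mscale /= /pushforward.
  have -> : phi @^-1` `]a, b] = `]((a - q) / L)%R, ((b - q) / L)%R]%classic.
    apply/seteqP; split => x /=; rewrite !in_itv /= ltr_pdivrMr// ler_pdivlMr// /phi;
      by rewrite ltrBlDr lerBrDr mulrC.
  rewrite !lebesgue_measure_itv /= !lte_fin ltr_pM2r ?invr_gt0// ltrD2r.
  case: ifPn => ab; last by rewrite mule0.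
  rewrite -!EFinB -EFinM; congr EFin.
  by rewrite -mulrBl opprB addrA subrK mulrC divfK// gt_eqF.
rewrite [RHS](_ : _ = \int[m]_y f y); last first.
  by apply: eq_measure_integral => A mA _; exact: muE.
rewrite ge0_integral_mscale//= ge0_integral_pushforward//=.
rewrite ge0_integralZl// ?preimage_setT ?lee_fin//.
exact: (measurableT_comp mf).
Qed.

Lemma integral_shift (q : R) (f : R -> \bar R) :
  measurable_fun [set: R] f -> (forall x, 0 <= f x) ->
  \int[mu]_y f (y + q)%R = \int[mu]_y f y.
Proof.
move=> mf f0; rewrite -[RHS](@integral_affine 1%R q)//.
by apply: eq_integral => x _; rewrite mul1e mul1r.
Qed.

Lemma integral_sub (q : R) (f : R -> \bar R) :
  measurable_fun [set: R] f -> (forall x, 0 <= f x) ->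
  \int[mu]_y f (y - q)%R = \int[mu]_y f y.
Proof. exact: integral_shift. Qed.

End integration.

(** * Regularity in time of the cumulative mass *)

(** Finiteness of [x] comes with the equation, both sides being extended reals. *)
Lemma half_eq {R : realType} (r : R) (x : \bar R) :
  (r%:E = (2^-1)%:E * x)%E -> x = (2 * r)%:E.
Proof.
by move=> rx; rewrite EFinM rx muleA -EFinM divff ?mul1e// pnatr_eq0.
Qed.

Section time_regularity.
Context {R : realType}.
Local Notation mu := (@lebesgue_measure R).
Variables (alpha eps T Ca CW : R) (K : R -> R -> R) (H : R -> R -> R -> R).
Variable W : R -> R.
Hypothesis eps0 : 0 < eps.
Hypothesis Ca0 : 0 <= Ca.
Hypothesis mK : measurable_fun [set: R * R] (fun p : R * R => K p.1 p.2).
Hypothesis K0 : forall v w, 0 <= K v w.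
Hypothesis Ksym : forall v w, K v w = K w v.
Hypothesis Kout : forall v w, v <= 0 -> K v w = 0.
Hypothesis mH :
  measurable_fun [set: R * R * R] (fun q : R * R * R => H q.1.1 q.1.2 q.2).
Hypothesis H0 : forall y v t, 0 <= H y v t.
Hypothesis mW : measurable_fun [set: R] W.
Hypothesis W0 : forall v, 0 <= W v.
Hypothesis aH : forall y v t, (loss_rate K H y v t <= (Ca * W v)%:E)%E.
Hypothesis momH : forall t,
  (\int[mu]_v ((W v)%:E * \int[mu]_y (H y v t)%:E) <= CW%:E)%E.
Hypothesis mild : forall t v y, 0 <= t <= T -> 0 < v ->
  ((H y v t)%:E
     - (semigroup alpha eps t (fun y' v' => H y' v' 0) y v)%:E
       * damping alpha eps K H y v 0 t
   = (2^-1)%:E *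
     \int[mu]_(s in `[0%R, t])
       \int[mu]_(w in `]0%R, v[)
         (damping alpha eps K H y v s t *
          (semigroup alpha eps (t - s)
            (fun y' v' => (K (v' - w) w * H y' (v' - w) s * H y' w s)%R)
            y v)%:E))%E.

Lemma measurable_compH d (X : measurableType d) (f g h : X -> R) :
  measurable_fun setT f -> measurable_fun setT g -> measurable_fun setT h ->
  measurable_fun setT (fun x => H (f x) (g x) (h x)).
Proof.
move=> mf mg mh; apply: (measurableT_comp (g := fun x => (f x, g x, h x)) mH).
by apply: measurable_fun_pair => //; exact: measurable_fun_pair.
Qed.

Lemma measurable_compK d (X : measurableType d) (f g : X -> R) :
  measurable_fun setT f -> measurable_fun setT g ->
  measurable_fun setT (fun x => K (f x) (g x)).
Proof.
move=> mf mg; apply: (measurableT_comp (g := fun x => (f x, g x)) mK).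
exact: measurable_fun_pair.
Qed.

(** Backward characteristic: the point from which the transport brings [y] after
    a time [s]. *)
Definition flow s y v : R := expR (s / eps) * (y - v `^ alpha) + v `^ alpha.

Lemma flowD s r y v : flow (s + r) y v = flow s (flow r y v) v.
Proof. by rewrite /flow addrK mulrDl expRD mulrA. Qed.

Lemma measurable_flow d (X : measurableType d) (f g h : X -> R) :
  measurable_fun setT f -> measurable_fun setT g -> measurable_fun setT h ->
  measurable_fun setT (fun x => flow (f x) (g x) (h x)).
Proof.
move=> mf mg mh; have mha : measurable_fun setT (fun x => h x `^ alpha).
  exact: (measurableT_comp (measurable_powR alpha)).
apply: measurable_funD => //; apply: measurable_funM.
  apply: (measurableT_comp (@measurable_expR R)); exact: measurable_funM.
exact: measurable_funB.
Qed.

Let A t y v (tau : R) : \bar R := loss_rate K H (flow (t - tau) y v) v tau.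

Let A0 t y v tau : (0 <= A t y v tau)%E.
Proof. by apply: integral_ge0 => w _; rewrite lee_fin mulr_ge0. Qed.

Let mA t y v : measurable_fun setT (A t y v).
Proof.
apply: (@measurable_slice R _ R halfline
  (fun p => (K v p.2 * H (flow (t - p.1) y v) p.2 p.1)%:E)).
- exact: measurable_itv.
- apply/measurable_EFinP; apply: measurable_funM.
    exact: measurable_compK.
  apply: measurable_compH => //.
  apply: measurable_flow => //; exact: measurable_funB.
- by move=> p; rewrite lee_fin mulr_ge0.
Qed.

Let Lam y v s t : \bar R := (\int[mu]_(tau in `[s, t]) A t y v tau)%E.

Let LamE y v s t : damping alpha eps K H y v s t = expeR (- Lam y v s t).
Proof. by []. Qed.

Let Lam0 y v s t : (0 <= Lam y v s t)%E.
Proof. by apply: integral_ge0. Qed.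

Let Lam_le y v s t : s <= t -> (Lam y v s t <= (Ca * W v * (t - s))%:E)%E.
Proof.
move=> st; apply: (@le_trans _ _ (\int[mu]_(tau in `[s, t]) (cst (Ca * W v)%:E) tau)%E).
  by apply: le_int => // tau _; exact: aH.
rewrite integral_cst//= lebesgue_measure_itv /= lte_fin.
case: ifPn => [_|]; first by rewrite -EFinB -EFinM.
by rewrite mule0 lee_fin !mulr_ge0// subr_ge0.
Qed.

Let Lam_fin y v s t : Lam y v s t \is a fin_num.
Proof.
have [st|st] := leP s t; last by rewrite /Lam set_itv_ge ?integral_set0// bnd_simp -ltNge.
rewrite ge0_fin_numE//; apply: le_lt_trans (Lam_le y v st) _.
by rewrite ltry.
Qed.

Let LamD y v s t1 t2 : s <= t1 -> t1 <= t2 ->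
  Lam y v s t2 = (Lam (flow (t2 - t1) y v) v s t1 + Lam y v t1 t2)%E.
Proof.
move=> st1 t12; rewrite /Lam.
have -> : `[s, t2]%classic = `[s, t1] `|` `]t1, t2] :> set R.
  apply/seteqP; split=> x /=; rewrite !in_itv/=.
    by case: (leP x t1) => h /andP[h1 h2]; [left|right]; apply/andP.
  move=> [/andP[h1 h2]|/andP[h1 h2]]; apply/andP; split=> //.
    exact: le_trans t12.
  by apply: ltW; exact: le_lt_trans h1.
rewrite ge0_integral_setU//=; first last.
- apply/disj_setPS => x [] /=; rewrite !in_itv/= => /andP[_ h] /andP[h' _].
  by have := le_lt_trans h h'; rewrite ltxx.
- exact: measurable_funS (mA _ _ _).
rewrite integral_itv_obnd_cbnd; last exact: measurable_funS (mA _ _ _).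
have -> : (\int[mu]_(tau in `[s, t1]) A t1 (flow (t2 - t1) y v) v tau =
    \int[mu]_(tau in `[s, t1]) A t2 y v tau)%E.
  apply: eq_integral => tau _; rewrite /A -flowD; congr (loss_rate K H (flow _ y v) v tau).
  by ring.
by [].
Qed.

Let damp_real y v s t :
  damping alpha eps K H y v s t = (expR (- fine (Lam y v s t)))%:E.
Proof. by rewrite LamE -[in LHS](fineK (Lam_fin y v s t)). Qed.

Let damp_ge0 y v s t : (0 <= damping alpha eps K H y v s t)%E.
Proof. exact: expeR_ge0. Qed.

Let damp_le1 y v s t : (damping alpha eps K H y v s t <= 1)%E.
Proof. by rewrite LamE -expeR0 lee_expeR -oppe0 leeN2. Qed.

Let mdamp y v t : measurable_fun setT (fun s => damping alpha eps K H y v s t).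
Proof.
have mL : measurable_fun setT (fun s => Lam y v s t).
  have E s : Lam y v s t = (\int[mu]_tau
      (A t y v tau * (((s <= tau) && (tau <= t))%R%:R)%:E))%E.
    rewrite /Lam integral_mkcond; apply: eq_integral => tau _.
    rewrite /patch; case: ifPn.
      by move=> /set_mem /=; rewrite in_itv/= => ->; rewrite mule1.
    rewrite notin_setE /= in_itv /= => /negP /negbTE ->.
    by rewrite mule0.
  under eq_fun do rewrite E.
  apply: (@measurable_slice R _ R setT (fun p => (A t y v p.2 *
     (((p.1 <= p.2) && (p.2 <= t))%R%:R)%:E)%E)) => //.
    apply: emeasurable_funM; first exact: measurableT_comp.
    apply/measurable_EFinP.
    apply: (measurableT_comp (f := fun b : bool => (b%:R : R))) => //.
    by apply: measurable_and; exact: measurable_fun_ler.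
  by move=> p; rewrite mule_ge0// lee_fin.
under eq_fun do rewrite damp_real.
apply/measurable_EFinP; apply: (measurableT_comp (@measurable_expR R)).
apply: measurableT_comp => //; apply: measurableT_comp mL.
exact: fine_measurable.
Qed.

Let gain y v t s w : R := K (v - w) w * H (flow (t - s) y v) (v - w) s
  * H (flow (t - s) y v) w s.

Let gain_ge0 y v t s w : 0 <= gain y v t s w.
Proof. by rewrite /gain !mulr_ge0. Qed.

Let Gint y v t s : \bar R := (\int[mu]_(w in `]0%R, v[)
  (damping alpha eps K H y v s t * (expR ((t - s) / eps) * gain y v t s w)%:E))%E.

Let mgain y v t : measurable_fun setT (fun p : R * R => gain y v t p.1 p.2).
Proof.
have mf : measurable_fun setT (fun p : R * R => flow (t - p.1) y v).
  by apply: measurable_flow => //; exact: measurable_funB.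
apply: measurable_funM; first apply: measurable_funM.
- by apply: measurable_compK => //; exact: measurable_funB.
- by apply: measurable_compH => //; exact: measurable_funB.
- exact: measurable_compH.
Qed.

Let mexp (t : R) : measurable_fun setT (fun s : R => expR ((t - s) / eps)).
Proof.
apply: (measurableT_comp (@measurable_expR R)); apply: measurable_funM => //.
exact: measurable_funB.
Qed.

Let Gint_ge0 y v t s : (0 <= Gint y v t s)%E.
Proof.
apply: integral_ge0 => w _; rewrite mule_ge0// lee_fin mulr_ge0 ?expR_ge0//.
Qed.

Let mGint y v t : measurable_fun setT (Gint y v t).
Proof.
apply: (@measurable_slice R _ R `]0%R, v[%classic (fun p => (damping alpha eps K H y v p.1 t *
  (expR ((t - p.1) / eps) * gain y v t p.1 p.2)%:E)%E)).
- exact: measurable_itv.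
- apply: emeasurable_funM.
    exact: (measurableT_comp (mdamp y v t)).
  apply/measurable_EFinP; apply: measurable_funM => //.
  exact: (measurableT_comp (mexp t)).
- by move=> p; rewrite mule_ge0// lee_fin mulr_ge0 ?expR_ge0.
Qed.

(** The formula from 0 to [t1], taken at the point of the characteristic through
    [y] at time [t1] and multiplied by the Jacobian and by the damping [d] over
    [[t1, t2]], is the part of the formula from 0 to [t2] that precedes [t1]. *)
Lemma duhamel (t1 t2 v y : R) : 0 <= t1 -> t1 <= t2 -> t2 <= T -> 0 < v ->
  exists d : R, [/\ 0 <= d <= 1, 1 - Ca * W v * (t2 - t1) <= d &
   ((H y v t2)%:E = (d * (expR ((t2 - t1) / eps) * H (flow (t2 - t1) y v) v t1))%R%:E
     + (2^-1)%:E * \int[mu]_(s in `]t1, t2]) Gint y v t2 s)%E].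
Proof.
move=> t10 t12 t2T v0.
pose L := expR ((t2 - t1) / eps); pose y1 := flow (t2 - t1) y v.
have L0 : 0 < L by exact: expR_gt0.
pose d := expR (- fine (Lam y v t1 t2)).
have fL0 : 0 <= fine (Lam y v t1 t2) by rewrite fine_ge0.
have d0 : 0 <= d by exact: expR_ge0.
exists d; split.
- by rewrite d0 -expR0 ler_expR oppr_le0.
- apply: le_trans (expR_ge1Dx _); rewrite lerD2l lerN2.
  by rewrite -lee_fin fineK// Lam_le.
have dampD s : s <= t1 -> damping alpha eps K H y v s t2 =
    (damping alpha eps K H y1 v s t1 * d%:E)%E.
  move=> st; rewrite !damp_real (LamD y v st t12) fineD// opprD expRD EFinM.
  by [].
have GE s : s \in `[0, t1] -> Gint y v t2 s = ((d * L)%:E * Gint y1 v t1 s)%E.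
  rewrite in_itv /= => /andP[_ st]; rewrite /Gint.
  rewrite -ge0_integralZl//; first last.
  - by rewrite lee_fin mulr_ge0// ltW.
  - by move=> w _; rewrite mule_ge0// lee_fin mulr_ge0 ?expR_ge0.
  - apply: emeasurable_funM => //; apply/measurable_EFinP.
    apply: measurable_funM => //.
    apply: measurable_funTS; exact: (measurable_fun_pair2 _ (mgain y1 v t1)).
  apply: eq_integral => w _; rewrite dampD// -[LHS]muleA -EFinM.
  rewrite muleCA -EFinM; congr (_ * _%:E)%E.
  have -> : t2 - s = (t1 - s) + (t2 - t1) by ring.
  rewrite mulrDl expRD /gain.
  have -> : t2 - s = (t1 - s) + (t2 - t1) by ring.
  by rewrite flowD -/y1 -/L; ring.
have itvE : `[0, t2]%classic = `[0, t1] `|` `]t1, t2] :> set R.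
  apply/seteqP; split=> x /=; rewrite !in_itv/=.
    by case: (leP x t1) => h /andP[h1 h2]; [left|right]; apply/andP.
  move=> [/andP[h1 h2]|/andP[h1 h2]]; apply/andP; split=> //.
    exact: le_trans t12.
  by apply: ltW; exact: le_lt_trans h1.
have mild' t z : 0 <= t <= T -> ((H z v t)%:E
     - (semigroup alpha eps t (fun y' v' => H y' v' 0) z v)%:E
       * damping alpha eps K H z v 0 t
   = (2^-1)%:E * \int[mu]_(s in `[0%R, t]) Gint z v t s)%E.
  by move=> tT; exact: mild.
have := mild' t2 y; rewrite t2T (le_trans t10 t12) => /(_ isT).
have := mild' t1 y1; rewrite t10 (le_trans t12 t2T) => /(_ isT).
rewrite dampD//.
have SE : semigroup alpha eps t2 (fun y' v' => H y' v' 0) y v =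
    L * semigroup alpha eps t1 (fun y' v' => H y' v' 0) y1 v.
  rewrite /semigroup -/(flow t2 y v) -/(flow t1 y1 v).
  have -> : t2 = t1 + (t2 - t1) by ring.
  by rewrite flowD -/y1 mulrDl expRD -/L; ring.
rewrite SE damp_real; move: (semigroup _ _ _ _ _ _) (expR _) => S1 d1.
rewrite -!EFinM => m1; have I1E := half_eq m1.
move=> m2; have := half_eq m2.
rewrite itvE ge0_integral_setU//=; first last.
- apply/disj_setPS => x [] /=; rewrite !in_itv/= => /andP[_ h] /andP[h' _].
  by have := le_lt_trans h h'; rewrite ltxx.
- exact: measurable_funS (mGint _ _ _).
have -> : (\int[mu]_(s in `[0%R, t1]) Gint y v t2 s)%E =
    ((d * L)%R%:E * (2 * (H y1 v t1 - S1 * d1))%R%:E)%E.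
  rewrite -I1E -ge0_integralZl//; first last.
  - by rewrite lee_fin mulr_ge0// ltW.
  - exact: measurable_funS (mGint _ _ _).
  by apply: eq_integral => s /set_mem /= hs; rewrite GE.
case: (\int[mu]_(s in `]t1, t2]) Gint y v t2 s)%E => [i||] //=.
rewrite -!EFinM -!EFinD => -[E]; congr EFin; rewrite -/L -/y1; lra.
Qed.

(** The exponential factor is the Jacobian of the flow in [y]: the transport
    preserves the mass of every slice, whatever the size of [eps]. *)
Lemma integral_flow (s v : R) (f : R -> \bar R) :
  measurable_fun setT f -> (forall x, 0 <= f x)%E ->
  (\int[mu]_y ((expR (s / eps))%:E * f (flow s y v)) = \int[mu]_y f y)%E.
Proof.
move=> mf f0; rewrite -[RHS](@integral_affine R (expR (s / eps))
  (v `^ alpha - expR (s / eps) * v `^ alpha)) ?expR_gt0//.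
apply: eq_integral => y _; congr (_ * f _)%E; rewrite /flow; ring.
Qed.

Let h v t : \bar R := (\int[mu]_y (H y v t)%:E)%E.

Let h0 v t : (0 <= h v t)%E.
Proof. by apply: integral_ge0 => y _; rewrite lee_fin. Qed.

Let mHy v t : measurable_fun setT (fun y => (H y v t)%:E).
Proof. by apply/measurable_EFinP; exact: measurable_compH. Qed.

Let mh t : measurable_fun setT (h ^~ t).
Proof.
apply: (@measurable_slice R _ R setT (fun p => (H p.2 p.1 t)%:E)) => //.
  by apply/measurable_EFinP; exact: measurable_compH.
by move=> p; rewrite lee_fin.
Qed.

Let Q y v w s := K (v - w) w * H y (v - w) s * H y w s.

Let Q0 y v w s : (0 <= (Q y v w s)%:E)%E.
Proof. by rewrite lee_fin !mulr_ge0. Qed.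

Let mQ d (X : measurableType d) (y v w s : X -> R) :
  measurable_fun setT y -> measurable_fun setT v -> measurable_fun setT w ->
  measurable_fun setT s ->
  measurable_fun setT (fun x => (Q (y x) (v x) (w x) (s x))%:E).
Proof.
move=> my mv mw ms; apply/measurable_EFinP; apply: measurable_funM.
  apply: measurable_funM; first by apply: measurable_compK => //; exact: measurable_funB.
  by apply: measurable_compH => //; exact: measurable_funB.
exact: measurable_compH.
Qed.

Let transport (t1 t2 v : R) :
  (\int[mu]_y (expR ((t2 - t1) / eps) * H (flow (t2 - t1) y v) v t1)%:E = h v t1)%E.
Proof.
by rewrite -[RHS](integral_flow (t2 - t1) v)// => x; rewrite lee_fin.
Qed.

(** Dropping the gain and bounding the damping below by its linear part. *)
Lemma slice_lower (t1 t2 v : R) : 0 <= t1 -> t1 <= t2 -> t2 <= T -> 0 < v ->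
  (h v t1 <= h v t2 + (Ca * W v * (t2 - t1))%:E * h v t1)%E.
Proof.
move=> t10 t12 t2T v0.
have c0 : 0 <= Ca * W v * (t2 - t1) by rewrite !mulr_ge0// subr_ge0.
have mL : measurable_fun setT
    (fun y => (expR ((t2 - t1) / eps) * H (flow (t2 - t1) y v) v t1)%:E).
  apply/measurable_EFinP; apply: measurable_funM => //; apply: measurable_compH => //.
  exact: measurable_flow.
have L0 y : (0 <= (expR ((t2 - t1) / eps) * H (flow (t2 - t1) y v) v t1)%:E)%E.
  by rewrite lee_fin mulr_ge0// expR_ge0.
rewrite -{1 2}(transport t1 t2) -ge0_integralZl// ?lee_fin//.
rewrite -ge0_integralD//; first last.
- by apply: emeasurable_funM.
- by move=> y _; rewrite mule_ge0// lee_fin.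
- exact: mHy.
- by move=> y _; rewrite lee_fin.
apply: le_int => [y _|y _]; first exact: L0.
have [d [/andP[d0 _] d1 E]] := duhamel y t10 t12 t2T v0.
rewrite -EFinM -EFinD lee_fin.
have : d * (expR ((t2 - t1) / eps) * H (flow (t2 - t1) y v) v t1) <= H y v t2.
  rewrite -lee_fin E leeDl// mule_ge0// ?lee_fin//.
  by apply: integral_ge0 => s _; exact: Gint_ge0.
have := L0 y; rewrite lee_fin; move: (expR _ * _) => X X0 dX.
have : (1 - Ca * W v * (t2 - t1)) * X <= d * X by rewrite ler_wpM2r.
by move: dX; rewrite mulrBl mul1r; lra.
Qed.

Lemma tonelli_dom (D : set R) (f : R -> R -> \bar R) : measurable D ->
  measurable_fun setT (fun p : R * R => f p.1 p.2) -> (forall x y, 0 <= f x y)%E ->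
  (\int[mu]_x \int[mu]_(y in D) f x y = \int[mu]_(y in D) \int[mu]_x f x y)%E.
Proof.
move=> mD mf f0.
pose g (p : R * R) : \bar R := (f p.1 p.2 * (\1_D p.2)%:E)%E.
have mg : measurable_fun setT g.
  apply: emeasurable_funM => //; apply/measurable_EFinP.
  have m1 : measurable_fun [set: R] (\1_D : R -> R) by exact: measurable_indic.
  exact: (measurableT_comp m1 measurable_snd).
have g0 p : (0 <= g p)%E by rewrite /g mule_ge0// lee_fin.
have gE (F : R -> \bar R) :
    (\int[mu]_(y in D) F y = \int[mu]_y (F y * (\1_D y)%:E))%E.
  rewrite integral_mkcond; apply: eq_integral => y _.
  by rewrite /patch indicE; case: ifPn => _; rewrite ?mule1 ?mule0.
under eq_integral do rewrite gE.
rewrite gE (tonelli mg g0); apply: eq_integral => y _.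
rewrite /g /= [LHS](_ : _ = \int[mu]_x ((\1_D y)%:E * f x y))%E; last first.
  by apply: eq_integral => x _; rewrite muleC.
rewrite ge0_integralZl ?lee_fin// 1?muleC//.
exact: (measurable_fun_pair1 _ mf).
Qed.

(** Bounding the damping by 1; in the gain, the transport is again removed by
    integration in [y]. *)
Lemma slice_upper (t1 t2 v : R) : 0 <= t1 -> t1 <= t2 -> t2 <= T -> 0 < v ->
  (h v t2 <= h v t1 +
    \int[mu]_(s in `]t1, t2]) \int[mu]_w \int[mu]_y (Q y v w s)%:E)%E.
Proof.
move=> t10 t12 t2T v0.
have mL : measurable_fun setT
    (fun y => (expR ((t2 - t1) / eps) * H (flow (t2 - t1) y v) v t1)%:E).
  apply/measurable_EFinP; apply: measurable_funM => //; apply: measurable_compH => //.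
  exact: measurable_flow.
have L0 y : (0 <= (expR ((t2 - t1) / eps) * H (flow (t2 - t1) y v) v t1)%:E)%E.
  by rewrite lee_fin mulr_ge0// expR_ge0.
pose J y s w : \bar R := ((expR ((t2 - s) / eps))%:E * (gain y v t2 s w)%:E)%E.
have J0 y s w : (0 <= J y s w)%E by rewrite mule_ge0// lee_fin ?expR_ge0.
have mJ d (X : measurableType d) (y s w : X -> R) :
    measurable_fun setT y -> measurable_fun setT s -> measurable_fun setT w ->
    measurable_fun setT (fun x => J (y x) (s x) (w x)).
  move=> my ms mw; apply: emeasurable_funM.
    by apply/measurable_EFinP; exact: (measurableT_comp (mexp t2)).
  apply: mQ => //; apply: measurable_flow => //; exact: measurable_funB.
have mJw : measurable_fun setT (fun p : R * R => \int[mu]_w J p.1 p.2 w)%E.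
  apply: (@measurable_slice R _ (R * R)%type setT (fun p => J p.1.1 p.1.2 p.2)) => //.
  by apply: mJ => //; exact: measurableT_comp.
have -> : (\int[mu]_(s in `]t1, t2]) \int[mu]_w \int[mu]_y (Q y v w s)%:E =
    \int[mu]_y \int[mu]_(s in `]t1, t2]) \int[mu]_w J y s w)%E.
  rewrite [RHS](@tonelli_dom `]t1, t2]%classic (fun y s => \int[mu]_w J y s w)%E); last first.
  - by move=> y s; exact: integral_ge0.
  - exact: mJw.
  - exact: measurable_itv.
  apply: eq_integral => s _.
  rewrite [RHS](@tonelli R (fun p => J p.1 s p.2)); last first.
  - by move=> p; exact: J0.
  - exact: mJ.
  apply: eq_integral => w _.
  rewrite -(integral_flow (t2 - s) v (f := fun y => (Q y v w s)%:E))//.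
  exact: mQ.
rewrite -(transport t1 t2) -ge0_integralD//; first last.
- apply: (@measurable_slice R _ R `]t1, t2]%classic (fun p => \int[mu]_w J p.1 p.2 w)%E) => //.
  by move=> p; exact: integral_ge0.
- by move=> y _; apply: integral_ge0 => s _; exact: integral_ge0.
apply: le_int => [y _|y _]; first by rewrite lee_fin; exact: H0.
have [d [/andP[d0 d1] _ ->]] := duhamel y t10 t12 t2T v0.
apply: leeD.
  by rewrite lee_fin ler_piMl// mulr_ge0// expR_ge0.
apply: (@le_trans _ _ (\int[mu]_(s in `]t1, t2]) Gint y v t2 s)%E).
  rewrite -[leRHS]mul1e; apply: lee_wpmul2r; last by rewrite lee_fin; lra.
  by apply: integral_ge0 => s _; exact: Gint_ge0.
apply: le_int => // s _.
apply: (@le_trans _ _ (\int[mu]_(w in `]0%R, v[) J y s w)%E).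
  apply: le_int => [w _|w _].
    by rewrite mule_ge0// lee_fin mulr_ge0// expR_ge0.
  rewrite EFinM -[leRHS]mul1e; apply: lee_wpmul2r; last exact: damp_le1.
  exact: J0.
apply: ge0_subset_integral => //; apply: mJ => //.
Qed.

Let Wh0 v t : (0 <= (W v)%:E * h v t)%E.
Proof. by apply: mule_ge0; [rewrite lee_fin|exact: h0]. Qed.

Let CW0 : 0 <= CW.
Proof.
rewrite -lee_fin; apply: le_trans (momH 0).
by apply: integral_ge0 => v _; exact: Wh0.
Qed.

Let mWh t : measurable_fun setT (fun v => (W v)%:E * h v t)%E.
Proof. by apply: emeasurable_funM => //; exact/measurable_EFinP. Qed.

(** Exchanging the integrals and translating [v] by [w] turns the total gain into
    the total loss. *)
Let total_gain s :
  (\int[mu]_v \int[mu]_w \int[mu]_y (Q y v w s)%:E <= (Ca * CW)%:E)%E.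
Proof.
have mQvw : measurable_fun setT (fun p : R * R => \int[mu]_y (Q y p.1 p.2 s)%:E)%E.
  apply: (@measurable_slice R _ (R * R)%type setT
    (fun p => (Q p.2 p.1.1 p.1.2 s)%:E)) => //.
  by apply: mQ => //; exact: measurableT_comp.
rewrite (@tonelli R (fun p => \int[mu]_y (Q y p.1 p.2 s)%:E)%E mQvw); last first.
  by move=> p; apply: integral_ge0 => y _; exact: Q0.
apply: (@le_trans _ _ (\int[mu]_w (Ca%:E * ((W w)%:E * h w s)))%E); last first.
  rewrite ge0_integralZl//; last by exact: mWh.
  by rewrite EFinM; apply: lee_wpmul2l; [rewrite lee_fin|exact: momH].
apply: le_int => [w _|w _].
  by apply: integral_ge0 => v _; apply: integral_ge0 => y _; exact: Q0.
rewrite (@tonelli R (fun p => (Q p.2 p.1 w s)%:E)); last 2 first.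
- exact: mQ.
- by move=> p; exact: Q0.
rewrite muleA -EFinM -ge0_integralZl//; last 3 first.
- exact: mHy.
- by move=> y _; rewrite lee_fin.
- by rewrite lee_fin mulr_ge0.
apply: le_int => [y _|y _]; first by apply: integral_ge0 => v _; exact: Q0.
pose f v := (K v w * H y v s * H y w s)%:E.
have -> : (\int[mu]_v (Q y v w s)%:E = \int[mu]_v f v)%E.
  rewrite -[RHS](@integral_sub R w).
  - by [].
  - apply/measurable_EFinP; apply: measurable_funM => //.
    by apply: measurable_funM; [exact: measurable_compK|exact: measurable_compH].
  - by move=> v; rewrite lee_fin !mulr_ge0.
rewrite muleC.
apply: (@le_trans _ _ ((H y w s)%:E * loss_rate K H y w s))%E; last first.
  by apply: lee_wpmul2l; [rewrite lee_fin|exact: aH].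
rewrite /loss_rate -ge0_integralZl//; last 4 first.
- exact: measurable_itv.
- apply/measurable_EFinP; apply: measurable_funTS; apply: measurable_funM.
    exact: measurable_compK.
  exact: measurable_compH.
- by move=> v _; rewrite lee_fin mulr_ge0.
- by rewrite lee_fin.
rewrite [leRHS]integral_mkcond; apply: le_int => v _.
  by rewrite lee_fin !mulr_ge0.
rewrite /patch; case: ifPn => [_|].
  by rewrite -EFinM lee_fin /= mulrC (Ksym v w).
rewrite notin_setE /halfline /= in_itv /= andbT => /negP; rewrite -leNgt => v0.
by rewrite /f Kout// !mul0r.
Qed.

Let total_gain_time (t1 t2 : R) : t1 <= t2 ->
  (\int[mu]_v \int[mu]_(s in `]t1, t2]) \int[mu]_w \int[mu]_y (Q y v w s)%:E
   <= (Ca * CW * (t2 - t1))%:E)%E.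
Proof.
move=> t12.
rewrite (@tonelli_dom _ (fun v s => \int[mu]_w \int[mu]_y (Q y v w s)%:E)%E)//; last 2 first.
- apply: (@measurable_slice R _ (R * R)%type setT
    (fun p => \int[mu]_y (Q y p.1.1 p.2 p.1.2)%:E)%E) => //.
    apply: (@measurable_slice R _ (R * R * R)%type setT
      (fun p => (Q p.2 p.1.1.1 p.1.2 p.1.1.2)%:E)%E) => //.
    apply: mQ => //; do ?exact: measurableT_comp.
      by apply: measurableT_comp => //; exact: measurableT_comp.
    by apply: measurableT_comp => //; exact: measurableT_comp.
  by move=> p; apply: integral_ge0 => y _; exact: Q0.
- by move=> v s; apply: integral_ge0 => w _; apply: integral_ge0 => y _; exact: Q0.
apply: (@le_trans _ _ (\int[mu]_(s in `]t1, t2]) (cst (Ca * CW)%:E) s)%E).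
  apply: le_int => s _; last exact: total_gain.
  by apply: integral_ge0 => v _; apply: integral_ge0 => w _;
    apply: integral_ge0 => y _; exact: Q0.
rewrite integral_cst//= lebesgue_measure_itv /= lte_fin.
case: ifPn => [_|]; first by rewrite -EFinB -EFinM.
by rewrite mule0 lee_fin !mulr_ge0// subr_ge0.
Qed.

(** The loss over a time step is controlled by the loss rate and the [W]-moment,
    the gain by the total gain, and neither depends on [eps]. *)
Lemma cumulative_time_lipschitz (t1 t2 x : R) : 0 <= t1 -> t1 <= t2 -> t2 <= T ->
  let F t := (\int[mu]_(v in `]0%R, x]) \int[mu]_y (H y v t)%:E)%E in
  (F t1 <= F t2 + (Ca * CW * (t2 - t1))%:E)%E /\
  (F t2 <= F t1 + (Ca * CW * (t2 - t1))%:E)%E.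
Proof.
move=> t10 t12 t2T F.
have vpos v : `]0%R, x]%classic v -> 0 < v by rewrite /= in_itv/= => /andP[].
have mhD t : measurable_fun `]0%R, x]%classic (h ^~ t) by exact: measurable_funTS.
have dt : 0 <= t2 - t1 by rewrite subr_ge0.
split.
- apply: (@le_trans _ _ (\int[mu]_(v in `]0%R, x])
     (h v t2 + (Ca * (t2 - t1))%:E * ((W v)%:E * h v t1)))%E).
    apply: le_int => v /vpos v0; first exact: h0.
    rewrite muleA -EFinM mulrAC; exact: slice_lower.
  rewrite ge0_integralD//; last 3 first.
  + exact: mhD.
  + by move=> v _; apply: mule_ge0; [rewrite lee_fin mulr_ge0|exact: Wh0].
  + by apply: emeasurable_funM => //; exact: measurable_funTS (mWh t1).
  apply: leeD => //; rewrite ge0_integralZl//; last 2 first.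
  + exact: measurable_funTS (mWh t1).
  + by rewrite lee_fin mulr_ge0.
  rewrite mulrAC [leRHS]EFinM; apply: lee_wpmul2l; first by rewrite lee_fin mulr_ge0.
  apply: le_trans (momH t1); apply: ge0_subset_integral => //.
  exact: mWh.
- have G0 v : (0 <= \int[mu]_(s in `]t1, t2]) \int[mu]_w \int[mu]_y (Q y v w s)%:E)%E.
    by apply: integral_ge0 => s _; apply: integral_ge0 => w _;
      apply: integral_ge0 => y _; exact: Q0.
  have mG : measurable_fun setT
      (fun v => \int[mu]_(s in `]t1, t2]) \int[mu]_w \int[mu]_y (Q y v w s)%:E)%E.
    apply: (@measurable_slice R _ R `]t1, t2]%classic
      (fun p => \int[mu]_w \int[mu]_y (Q y p.1 w p.2)%:E)%E) => //.
      apply: (@measurable_slice R _ (R * R)%type setT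
        (fun p => \int[mu]_y (Q y p.1.1 p.2 p.1.2)%:E)%E) => //.
        apply: (@measurable_slice R _ (R * R * R)%type setT
          (fun p => (Q p.2 p.1.1.1 p.1.2 p.1.1.2)%:E)%E) => //.
        apply: mQ => //; do ?exact: measurableT_comp.
          by apply: measurableT_comp => //; exact: measurableT_comp.
        by apply: measurableT_comp => //; exact: measurableT_comp.
      by move=> p; apply: integral_ge0 => y _; exact: Q0.
    by move=> p; apply: integral_ge0 => w _; apply: integral_ge0 => y _; exact: Q0.
  apply: (@le_trans _ _ (\int[mu]_(v in `]0%R, x]) (h v t1 +
     \int[mu]_(s in `]t1, t2]) \int[mu]_w \int[mu]_y (Q y v w s)%:E))%E).
    apply: le_int => v /vpos v0; first exact: h0.
    exact: slice_upper.
  rewrite ge0_integralD//; last 2 first.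
  + exact: mhD.
  + exact: measurable_funTS mG.
  apply: leeD => //; apply: le_trans (total_gain_time t12).
  exact: ge0_subset_integral.
Qed.

End time_regularity.

(** * Weights in the size variable and the dominating kernel *)

Section weights.
Context {R : realType}.
Implicit Types v a b c : R.

Lemma powR_le1D v a : 0 < v -> 0 <= a -> v <= 1 -> v `^ a <= 1.
Proof. by move=> v0 a0 v1; rewrite -[leRHS](powRr0 v) ger_powR// v0. Qed.

Lemma gt0_powRD v a c : 0 < v -> v `^ (a + c) = v `^ a * v `^ c.
Proof. by move=> v0; rewrite powRD// (gt_eqF v0) implybT. Qed.

(** For [v <= 1] every power is at most 1; for [v >= 1] all the powers combine
    into one whose exponent is at most that of [v `^ b].  This makes the
    [gamma]-moment of the slices integrable. *)
Lemma weight_moment v alpha gamma b : 0 < v -> 0 <= alpha <= 1 -> 0 <= gamma ->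
  gamma + 3 <= b ->
  (1 + v `^ gamma) * ((1 + v `^ alpha) / (1 + v `^ b)) <= 8 / (1 + v ^+ 2).
Proof.
move=> v0 /andP[a0 a1] g0 gb; have b0 : 0 <= b by lra.
have pb : 0 < 1 + v `^ b by rewrite ltr_pwDl// powR_ge0.
have p2 : 0 < 1 + v ^+ 2 by rewrite ltr_pwDl// exprn_ge0// ltW.
rewrite mulrA ler_pdivrMr// mulrAC ler_pdivlMr//.
have gp := powR_ge0 v gamma; have ap := powR_ge0 v alpha; have bp := powR_ge0 v b.
have [v1|v1] := leP v 1.
  have g1 := powR_le1D v0 g0 v1; have al1 := powR_le1D v0 a0 v1.
  have v2 : v ^+ 2 <= 1 by rewrite expr_le1// ltW.
  have v20 : 0 <= v ^+ 2 by rewrite exprn_ge0// ltW.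
  apply: (@le_trans _ _ (2 * 2 * 2)); last by lra.
  by rewrite !ler_pM//; rewrite ?mulr_ge0//; lra.
have v1' := ltW v1.
have g1 : 1 <= v `^ gamma by rewrite -(powRr0 v) ler_powR.
have al1 : 1 <= v `^ alpha by rewrite -(powRr0 v) ler_powR.
have v2 : 1 <= v ^+ 2 by rewrite exprn_ege1.
apply: (@le_trans _ _ ((2 * v `^ gamma) * (2 * v `^ alpha) * (2 * v ^+ 2))).
  by rewrite !ler_pM//; rewrite ?mulr_ge0//; lra.
have -> : 2 * v `^ gamma * (2 * v `^ alpha) * (2 * v ^+ 2) =
    8 * v `^ (gamma + alpha + 2).
  rewrite (gt0_powRD (gamma + alpha) 2 v0) (gt0_powRD gamma alpha v0).
  by rewrite powR_mulrn ?ltW//; ring.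
apply: (@le_trans _ _ (8 * v `^ b)); last by lra.
by rewrite ler_pM2l// ler_powR//; lra.
Qed.

(** The same comparison, against the Jacobian of [v |-> v `^ alpha]. *)
Lemma weight_jacobian v alpha gamma b : 0 < v -> 0 <= alpha <= 1 -> 0 <= gamma ->
  gamma + 3 <= b ->
  (1 + v `^ gamma) * ((1 + v `^ alpha) / (1 + v `^ b)) <= 4 * v `^ (alpha - 1).
Proof.
move=> v0 /andP[a0 a1] g0 gb; have b0 : 0 <= b by lra.
have pb : 0 < 1 + v `^ b by rewrite ltr_pwDl// powR_ge0.
have pv : 0 < v `^ (1 - alpha) by rewrite powR_gt0.
have -> : alpha - 1 = - (1 - alpha) by ring.
rewrite powRN mulrA ler_pdivrMr// mulrAC ler_pdivlMr//.
have gp := powR_ge0 v gamma; have ap := powR_ge0 v alpha; have bp := powR_ge0 v b.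
have [v1|v1] := leP v 1.
  have g1 := powR_le1D v0 g0 v1; have al1 := powR_le1D v0 a0 v1.
  have v2 : v `^ (1 - alpha) <= 1 by rewrite powR_le1D//; lra.
  apply: (@le_trans _ _ (2 * 2 * 1)); last by lra.
  by rewrite !ler_pM//; rewrite ?mulr_ge0//; lra.
have v1' := ltW v1.
have g1 : 1 <= v `^ gamma by rewrite -(powRr0 v) ler_powR.
have al1 : 1 <= v `^ alpha by rewrite -(powRr0 v) ler_powR.
apply: (@le_trans _ _ ((2 * v `^ gamma) * (2 * v `^ alpha) * v `^ (1 - alpha))).
  by rewrite !ler_pM//; rewrite ?mulr_ge0//; lra.
have -> : 2 * v `^ gamma * (2 * v `^ alpha) * v `^ (1 - alpha) = 4 * v `^ (gamma + 1).
  have -> : gamma + 1 = gamma + alpha + (1 - alpha) by ring.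
  rewrite (gt0_powRD (gamma + alpha) (1 - alpha) v0) (gt0_powRD gamma alpha v0).
  by ring.
apply: (@le_trans _ _ (4 * v `^ b)); last by lra.
by rewrite ler_pM2l// ler_powR//; lra.
Qed.

End weights.

Section kernel.
Context {R : realType}.
Local Notation mu := (@lebesgue_measure R).

(** Radial majorant of the solutions in the variable z = y - v^alpha: the cubic
    term replaces the profile with exponent [m], and the second one the
    1/|z| tail.  The factor 1/(1 + |z|) makes the tail integrable at infinity at the cost of
    the factor 1 + v^alpha, since the tail only lives on |z| <= v^alpha; the shift
    by [delta] makes it bounded at 0, which is possible since it lives on |z| >= delta. *)
Definition kern (a1 a2 lam eps delta z : R) : R :=
  a1 * (lam * (2 / (1 + `|lam * z| ^+ 3)))
  + a2 * (eps / ((delta + `|z|) * (1 + `|z|))).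

Section fixed.
Variables (a1 a2 lam eps delta : R).
Hypotheses (a10 : 0 <= a1) (a20 : 0 <= a2) (lam0 : 0 < lam) (eps0 : 0 < eps)
  (delta0 : 0 < delta).
Local Notation k := (kern a1 a2 lam eps delta).

Let pos3 (z : R) : 0 < 1 + `|lam * z| ^+ 3.
Proof. by rewrite ltr_pwDl// exprn_ge0. Qed.

Let posd (z : R) : 0 < (delta + `|z|) * (1 + `|z|).
Proof. by rewrite mulr_gt0// ltr_pwDl. Qed.

Lemma kern_ge0 z : 0 <= k z.
Proof.
apply: addr_ge0; apply: mulr_ge0 => //.
  by rewrite mulr_ge0 ?divr_ge0// ltW.
by rewrite divr_ge0// ltW.
Qed.

Lemma kernN z : k (- z) = k z.
Proof. by rewrite /kern mulrN !normrN. Qed.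

Lemma kern_continuous : continuous k.
Proof.
move=> z; have cn : (fun x : R => `|x|) x @[x --> z] --> `|z|.
  exact: norm_continuous.
have cln : `|lam * x| @[x --> z] --> `|lam * z|.
  by apply: cvg_norm; apply: cvgM; [exact: cvg_cst|exact: cvg_id].
apply: cvgD; apply: cvgM; try exact: cvg_cst; apply: cvgM; try exact: cvg_cst.
  apply: cvgM; first exact: cvg_cst.
  apply: cvgV; first by rewrite gt_eqF.
  apply: cvgD; first exact: cvg_cst.
  rewrite /GRing.exp /=.
  by apply: cvgM => //; apply: cvgM.
apply: cvgV; first by rewrite gt_eqF.
by apply: cvgM; apply: cvgD => //; exact: cvg_cst.
Qed.

End fixed.

Lemma integral_even_le (f : R -> R) : measurable_fun [set: R] f ->
  (forall x, 0 <= f x) -> (forall x, f (- x) = f x) ->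
  (\int[mu]_x (f x)%:E <= 2%:E * \int[mu]_(x in `[0%R, +oo[) (f x)%:E)%E.
Proof.
move=> mf f0 fN.
have mfE : measurable_fun [set: R] (EFin \o f) by exact/measurable_EFinP.
have -> : [set: R] = `]-oo, 0%R] `|` `]0%R, +oo[ :> set R.
  apply/seteqP; split=> // x _ /=; rewrite !in_itv/= andbT.
  by case: (leP x 0); [left|right].
rewrite ge0_integral_setU//=; last 3 first.
- exact: measurable_funS mfE.
- by move=> x _; rewrite lee_fin.
- apply/disj_setPS => x [] /=; rewrite !in_itv/= andbT => h h'.
  by have := le_lt_trans h h'; rewrite ltxx.
have -> : (2%:E = 1 + 1 :> \bar R)%E by rewrite -EFinD.
rewrite ge0_muleDl// !mul1e; apply: leeD; last first.
  apply: ge0_subset_integral => //.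
  - exact: measurable_funS mfE.
  - by move=> x _; rewrite lee_fin.
  - by move=> x /=; rewrite !in_itv/= !andbT => /ltW.
rewrite (@ge0_integration_by_substitution0 R (EFin \o f))//.
by apply: le_int => x _; rewrite ?lee_fin//= fN.
Qed.

Lemma posD_sqr (x : R) : 0 < 1 + x ^+ 2.
Proof. by rewrite ltr_pwDl// sqr_ge0. Qed.

Lemma measurable_cauchy : measurable_fun [set: R] (fun x : R => (1 + x ^+ 2)^-1).
Proof.
apply: continuous_measurable_fun => x; apply: cvgV; first by rewrite gt_eqF// posD_sqr.
by apply: cvgD; [exact: cvg_cst|apply: cvgM; exact: cvg_id].
Qed.

Lemma integral_cauchy : (\int[mu]_x ((1 + x ^+ 2)^-1)%:E <= pi%:E)%E.
Proof.
apply: le_trans (integral_even_le measurable_cauchy _ _) _.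
- by move=> x; rewrite invr_ge0 ltW// posD_sqr.
- by move=> x; rewrite sqrrN.
by rewrite integral0y_oneDsqr -EFinM lee_fin mulrC divfK.
Qed.

Lemma cube_ge (u : R) : 0 <= u -> u <= 1 + u ^+ 3 /\ u ^+ 2 <= 1 + u ^+ 3.
Proof.
move=> u0; have u30 : 0 <= u ^+ 3 by rewrite exprn_ge0.
have [u1|u1] := leP u 1.
  have : u ^+ 2 <= 1 by rewrite expr_le1.
  by split; lra.
have h2 : u ^+ 2 <= u ^+ 3 by rewrite ler_eXn2l.
have h1 : u ^+ 1 <= u ^+ 3 by rewrite ler_eXn2l.
by rewrite expr1 in h1; split; lra.
Qed.

Lemma cubic_le_cauchy (u : R) : 2 / (1 + `|u| ^+ 3) <= 4 * (1 + u ^+ 2)^-1.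
Proof.
have [_ h] := cube_ge (normr_ge0 u).
have p : 0 < 1 + `|u| ^+ 3 by rewrite ltr_pwDl// exprn_ge0.
rewrite ler_pdivrMr// mulrAC ler_pdivlMr ?posD_sqr//.
have c0 : 0 <= `|u| ^+ 3 by rewrite exprn_ge0.
by rewrite real_normK ?num_real// in h; lra.
Qed.

Lemma cubic_moment_le_cauchy (u : R) :
  `|u| * (2 / (1 + `|u| ^+ 3)) <= 4 * (1 + u ^+ 2)^-1.
Proof.
have [h _] := cube_ge (normr_ge0 u).
have p : 0 < 1 + `|u| ^+ 3 by rewrite ltr_pwDl// exprn_ge0.
rewrite mulrA ler_pdivrMr// mulrAC ler_pdivlMr ?posD_sqr//.
rewrite -[u ^+ 2]real_normK ?num_real//.
have : `|u| * 2 * (1 + `|u| ^+ 2) = 2 * `|u| + 2 * `|u| ^+ 3 by ring.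
have c0 : 0 <= `|u| ^+ 3 by rewrite exprn_ge0.
by move=> ->; lra.
Qed.

(** Invariance of the mass of an approximate identity under scaling. *)
Lemma integral_scaled (lam : R) (f : R -> R) : 0 < lam ->
  measurable_fun [set: R] f -> (forall x, 0 <= f x) ->
  (\int[mu]_z (lam * f (lam * z)%R)%:E = \int[mu]_z (f z)%:E)%E.
Proof.
move=> l0 mf f0; rewrite -[RHS](@integral_affine R lam 0)//.
- by apply: eq_integral => z _; rewrite addr0 EFinM.
- exact/measurable_EFinP.
Qed.

Lemma integral_le_cauchy (f : R -> R) (c : R) : 0 <= c ->
  (forall x, 0 <= f x <= c * (1 + x ^+ 2)^-1) ->
  (\int[mu]_z (f z)%:E <= (c * pi)%:E)%E.
Proof.
move=> c0 fc; apply: (@le_trans _ _ (\int[mu]_z (c%:E * ((1 + z ^+ 2)^-1)%:E))%E).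
  by apply: le_int => z _; rewrite lee_fin; case/andP: (fc z).
rewrite ge0_integralZl//.
- by rewrite EFinM; apply: lee_wpmul2l; [rewrite lee_fin|exact: integral_cauchy].
- by apply/measurable_EFinP; exact: measurable_cauchy.
- by move=> z _; rewrite lee_fin invr_ge0 ltW// posD_sqr.
Qed.

Lemma measurable_cubic : measurable_fun [set: R] (fun u : R => 2 / (1 + `|u| ^+ 3)).
Proof.
apply: continuous_measurable_fun => z.
apply: cvgM; first exact: cvg_cst.
apply: cvgV; first by rewrite gt_eqF// ltr_pwDl// exprn_ge0.
apply: cvgD; first exact: cvg_cst.
by apply: cvgM; [|apply: cvgM]; exact: norm_continuous.
Qed.

Lemma cubic_ge0 (u : R) : 0 <= 2 / (1 + `|u| ^+ 3).
Proof. by rewrite divr_ge0// ltW// ltr_pwDl// exprn_ge0. Qed.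

Lemma cubic_integral (lam : R) : 0 < lam ->
  (\int[mu]_z (lam * (2 / (1 + `|lam * z| ^+ 3)))%:E <= (4 * pi)%:E)%E.
Proof.
move=> l0; rewrite (@integral_scaled lam (fun u => 2 / (1 + `|u| ^+ 3)))//.
- by apply: integral_le_cauchy => // x; rewrite cubic_le_cauchy cubic_ge0.
- exact: measurable_cubic.
Qed.

Lemma cubic_moment (lam : R) : 0 < lam ->
  (\int[mu]_z (`|z| * (lam * (2 / (1 + `|lam * z| ^+ 3))))%:E <= (4 * pi / lam)%:E)%E.
Proof.
move=> l0; pose f (u : R) : R := `|u| * (2 / (1 + `|u| ^+ 3)).
have mf : measurable_fun [set: R] f.
  by apply: measurable_funM; [exact: normr_measurable|exact: measurable_cubic].
have f0 u : 0 <= f u by rewrite mulr_ge0// cubic_ge0.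
rewrite [leLHS](_ : _ = (lam^-1)%:E * \int[mu]_z (lam * f (lam * z)%R)%:E)%E.
  rewrite integral_scaled// mulrC EFinM; apply: lee_wpmul2l.
    by rewrite lee_fin invr_ge0 ltW.
  by apply: integral_le_cauchy => // x; rewrite cubic_moment_le_cauchy f0.
rewrite -ge0_integralZl//; last 3 first.
- apply/measurable_EFinP; apply: measurable_funM => //.
  by apply: measurableT_comp => //; exact: measurable_funM.
- by move=> z _; rewrite lee_fin mulr_ge0// ltW.
- by rewrite lee_fin invr_ge0 ltW.
apply: eq_integral => z _; rewrite -EFinM; congr EFin.
by rewrite mulKf ?gt_eqF// /f normrM (gtr0_norm l0); ring.
Qed.

(** The only logarithmic contribution to the mass of the kernel. *)
Lemma integral_inv01 (delta : R) : 0 < delta ->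
  (\int[mu]_(z in `[0%R, 1%R]) ((delta + z)^-1)%:E = (ln ((delta + 1) / delta))%:E)%E.
Proof.
move=> d0.
have cd (x : R) : 0 <= x -> {for x, continuous (fun z => (delta + z)^-1)}.
  move=> x0; apply: cvgV; first by rewrite gt_eqF// ltr_pwDl.
  by apply: cvgD; [exact: cvg_cst|exact: cvg_id].
have dl (x : R) : 0 <= x -> is_derive x 1 (fun z => ln (delta + z)) ((delta + x)^-1).
  move=> x0; have p : 0 < delta + x by rewrite ltr_pwDl.
  have := is_derive1_ln p => h.
  have h2 : is_derive x 1 (fun z => delta + z) 1.
    by have := is_deriveD (is_derive_cst delta x 1) (is_derive_id x 1); rewrite add0r.
  have := @is_derive1_comp R (@ln R) (fun z => delta + z) x _ _ h h2.
  by rewrite mulr1.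
have cl (x : R) : 0 <= x -> {for x, continuous (fun z => ln (delta + z))}.
  move=> x0; apply: differentiable_continuous; apply/derivable1_diffP.
  by have [] := dl _ x0.
rewrite (@continuous_FTC2 R _ (fun z => ln (delta + z))) ?ltr01//.
- by rewrite addr0 -EFinB ln_div ?posrE// ltr_wpDr.
- apply: continuous_in_subspaceT => x; rewrite inE /= in_itv /= => /andP[x0 _].
  exact: cd.
- split.
  + by move=> x; rewrite in_itv/= => /andP[x0 _]; have [] := dl _ (ltW x0).
  + by apply: cvg_at_right_filter; exact: cl.
  + by apply: cvg_at_left_filter; exact: cl.
- move=> x; rewrite in_itv/= => /andP[x0 _]; rewrite derive1E.
  by have [_ ->] := dl _ (ltW x0).
Qed.

End kernel.

Section kernel_integrals.
Context {R : realType}.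
Local Notation mu := (@lebesgue_measure R).
Variables (a1 a2 lam eps delta : R).
Hypotheses (a10 : 0 <= a1) (a20 : 0 <= a2) (lam0 : 0 < lam) (eps0 : 0 < eps)
  (delta0 : 0 < delta).
Local Notation k := (kern a1 a2 lam eps delta).

Let tail (z : R) : R := ((delta + `|z|) * (1 + `|z|))^-1.

Let posd (z : R) : 0 < (delta + `|z|) * (1 + `|z|).
Proof. by rewrite mulr_gt0// ltr_pwDl. Qed.

Let tail_ge0 z : 0 <= tail z.
Proof. by rewrite invr_ge0 ltW. Qed.

Let measurable_tail : measurable_fun [set: R] tail.
Proof.
apply: continuous_measurable_fun => z; apply: cvgV; first by rewrite gt_eqF.
by apply: cvgM; apply: cvgD; try exact: cvg_cst; exact: norm_continuous.
Qed.

Let tail_le (z : R) : 0 <= z ->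
  tail z <= ((fun z : R => (delta + `|z|)^-1) \_ `[0, 1]) z + (1 + z ^+ 2)^-1.
Proof.
move=> z0; have pd : 0 < delta + z by rewrite ltr_pwDl.
have p1 : 0 < 1 + z by rewrite ltr_pwDl.
have p2 := posD_sqr z.
rewrite /tail /patch (ger0_norm z0); case: ifPn => [_|].
  rewrite -[leLHS]addr0; apply: lerD; last by rewrite invr_ge0 ltW.
  by rewrite lef_pV2 ?posrE ?mulr_gt0// ler_peMr ?lerDl// ltW.
rewrite notin_setE /= in_itv/= z0 /= => /negP; rewrite -ltNge => z1.
rewrite (_ : point = 0)// add0r lef_pV2 ?posrE ?mulr_gt0//.
have -> : (delta + z) * (1 + z) = delta * (1 + z) + z + z ^+ 2 by ring.
by have := mulr_gt0 delta0 p1; lra.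
Qed.

Let integral_tail :
  (\int[mu]_z (tail z)%:E <= (2 * ln ((delta + 1) / delta) + pi)%:E)%E.
Proof.
apply: le_trans (integral_even_le measurable_tail tail_ge0 _) _.
  by move=> z; rewrite /tail normrN.
pose g (z : R) := (delta + `|z|)^-1.
have mg : measurable_fun (`[0, +oo[%classic : set R) (g \_ `[0, 1]).
  apply/(measurable_restrict g) => //.
  have mD (D : set R) : measurable_fun D g.
    apply: measurable_funTS; apply: continuous_measurable_fun => z.
    apply: cvgV; first by rewrite gt_eqF// ltr_pwDl.
    by apply: cvgD; [exact: cvg_cst|exact: norm_continuous].
  exact: mD.
apply: (@le_trans _ _ (2%:E * \int[mu]_(z in `[0%R, +oo[)
    (((g \_ `[0, 1]) z)%:E + ((1 + z ^+ 2)^-1)%:E))%E).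
  apply: lee_wpmul2l => //; apply: le_int => z /=; rewrite in_itv/= andbT => z0.
    by rewrite lee_fin.
  by rewrite -EFinD lee_fin; exact: tail_le.
rewrite ge0_integralD//; last 4 first.
- move=> z /=; rewrite in_itv/= andbT => z0.
  by rewrite lee_fin /patch; case: ifP => // _; rewrite invr_ge0 ltW// ltr_pwDl.
- exact/measurable_EFinP.
- by move=> z _; rewrite lee_fin invr_ge0 ltW// posD_sqr.
- by apply/measurable_EFinP; apply: measurable_funTS; exact: measurable_cauchy.
rewrite integral0y_oneDsqr.
have -> : (\int[mu]_(x in `[0%R, +oo[) ((g \_ `[0%R, 1%R]) x)%:E =
   \int[mu]_(x in `[0%R, 1%R]) (g x)%:E)%E.
  rewrite [RHS](_ : _ = \int[mu]_(x in `[0%R, +oo[ `&` `[0%R, 1%R]) (g x)%:E)%E.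
    rewrite integral_mkcondr; apply: eq_integral => x _.
    by rewrite /patch; case: ifP.
  congr (integral _ _ _); apply/seteqP; split => x /=; rewrite !in_itv/= andbT.
    by move=> /andP[h1 h2]; rewrite h1.
  by case.
have -> : (\int[mu]_(x in `[0%R, 1%R]) (g x)%:E =
    \int[mu]_(x in `[0%R, 1%R]) ((delta + x)^-1)%:E)%E.
  apply: eq_integral => x; rewrite inE /= in_itv/= => /andP[x0 _].
  by rewrite /g ger0_norm.
rewrite integral_inv01// -EFinD -EFinM lee_fin; lra.
Qed.

Let f (z : R) := lam * (2 / (1 + `|lam * z| ^+ 3)).

Let f0 z : 0 <= f z.
Proof. by rewrite mulr_ge0 ?cubic_ge0// ltW. Qed.

Let mf : measurable_fun [set: R] f.
Proof.
apply: measurable_funM => //; apply: (measurableT_comp measurable_cubic).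
exact: measurable_funM.
Qed.

Let kernE z : k z = a1 * f z + a2 * eps * tail z.
Proof. by rewrite /kern -/(f z) -/(tail z) mulrA. Qed.

Let integral_split (w : R -> R) : measurable_fun [set: R] w -> (forall z, 0 <= w z) ->
  (\int[mu]_z (w z * k z)%:E = a1%:E * \int[mu]_z (w z * f z)%:E
    + (a2 * eps)%:E * \int[mu]_z (w z * tail z)%:E)%E.
Proof.
move=> mw w0.
have a20' : 0 <= a2 * eps by rewrite mulr_ge0// ltW.
have w1 z : (0 <= (w z * f z)%:E)%E by rewrite lee_fin mulr_ge0.
have w2 z : (0 <= (w z * tail z)%:E)%E by rewrite lee_fin mulr_ge0.
have m1 : measurable_fun [set: R] (fun z => (w z * f z)%:E).
  by apply/measurable_EFinP; exact: measurable_funM.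
have m2 : measurable_fun [set: R] (fun z => (w z * tail z)%:E).
  by apply/measurable_EFinP; exact: measurable_funM.
have Z1 : (\int[mu]_z (a1%:E * (w z * f z)%:E) = a1%:E * \int[mu]_z (w z * f z)%:E)%E.
  by apply: ge0_integralZl.
have Z2 : (\int[mu]_z ((a2 * eps)%:E * (w z * tail z)%:E) =
    (a2 * eps)%:E * \int[mu]_z (w z * tail z)%:E)%E.
  by apply: ge0_integralZl.
rewrite -Z1 -Z2 -ge0_integralD//.
- by apply: eq_integral => z _; rewrite kernE -!EFinM -EFinD; congr EFin; ring.
- by move=> z _; apply: mule_ge0.
- exact: emeasurable_funM.
- by move=> z _; apply: mule_ge0.
- exact: emeasurable_funM.
Qed.

Lemma kern_integral :
  (\int[mu]_z (k z)%:E <=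
    (a1 * (4 * pi) + a2 * eps * (2 * ln ((delta + 1) / delta) + pi))%:E)%E.
Proof.
have := @integral_split (cst 1) (measurable_cst _) (fun=> ler01).
have E (g : R -> R) : (\int[mu]_z (cst 1 z * g z)%:E = \int[mu]_z (g z)%:E)%E.
  by apply: eq_integral => z _; rewrite /= mul1r.
rewrite !E.
move=> ->; rewrite EFinD !EFinM; apply: leeD; apply: lee_wpmul2l.
- by rewrite lee_fin.
- exact: cubic_integral.
- by rewrite lee_fin mulr_ge0// ltW.
- exact: integral_tail.
Qed.

(** The weight min(1, |z|) gains a factor 1/[lam] on the approximate Dirac mass and
    cancels the singularity of the tail, whose logarithm disappears. *)
Lemma kern_moment :
  (\int[mu]_z (Num.min 1 `|z| * k z)%:E <=
    (a1 * (4 * pi / lam) + a2 * eps * pi)%:E)%E.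
Proof.
have mw : measurable_fun [set: R] (fun z : R => Num.min 1 `|z|).
  by apply: measurable_minr => //; exact: normr_measurable.
have w0 (z : R) : 0 <= Num.min 1 `|z| by rewrite le_min ler01 normr_ge0.
rewrite (integral_split mw w0) EFinD !EFinM; apply: leeD; apply: lee_wpmul2l.
- by rewrite lee_fin.
- apply: le_trans (cubic_moment lam0); apply: le_int => z _.
    by rewrite lee_fin mulr_ge0.
  by rewrite lee_fin ler_wpM2r// ge_min lexx orbT.
- by rewrite lee_fin mulr_ge0// ltW.
- rewrite -[pi]mul1r; apply: integral_le_cauchy => // z.
  rewrite mulr_ge0//= mul1r /tail ler_pdivrMr// ler_pdivlMl ?posD_sqr//.
  have := normr_ge0 z; rewrite -[z ^+ 2]real_normK ?num_real//.
  move: `|z| => x x0; have x2 := sqr_ge0 x.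
  have [x1|x1] := leP 1 x.
    rewrite mulr1; have : delta * (1 + x) >= 0 by rewrite mulr_ge0 ?ltW//; lra.
    by have : 1 <= x by []; lra.
  have : delta * (1 + x) >= 0 by rewrite mulr_ge0 ?ltW//; lra.
  have : 0 <= x ^+ 2 * (1 - x) by rewrite mulr_ge0//; lra.
  by lra.
Qed.

End kernel_integrals.

(** * Domination of the solutions *)

Section domination.
Context {R : realType}.
Variables (alpha b m M1 M2 A eps T : R) (H : R -> R -> R -> R).
Hypotheses (eps0 : 0 < eps) (eps1 : eps <= 1) (m3 : 3 <= m) (M10 : 0 < M1)
  (A1 : 1 <= A) (al0 : 0 < alpha).

Let delta t := threshold m M1 A eps * expR (- (t / eps)).

Let C0_gt0 : 0 < C0 m M1 A.
Proof.
by rewrite /C0 powR_gt0// mulr_gt0// (lt_le_trans ltr01 A1).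
Qed.

Lemma threshold_gt0 : 0 < threshold m M1 A eps.
Proof. by rewrite /threshold mulr_gt0 ?powR_gt0// invr_gt0. Qed.

Lemma delta_gt0 t : 0 < delta t.
Proof. by rewrite /delta mulr_gt0 ?threshold_gt0// expR_gt0. Qed.

(** A fixed exponent 3 suffices for the first moment to be finite. *)
Lemma psi_le_cubic (z : R) : psi m z <= 2 / (1 + `|z| ^+ 3).
Proof.
have h := normr_ge0 z; rewrite /psi; move: `|z| h => x x0.
have m3' := m3; have x3 : 0 <= x ^+ 3 by rewrite exprn_ge0.
have xm := powR_ge0 x m.
rewrite ler_pdivlMr ?ltr_pwDl// mulrC ler_pdivrMr ?ltr_pwDl//.
have [x1|x1] := leP x 1.
  have : x ^+ 3 <= 1 by rewrite exprn_ile1.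
  by lra.
have : x ^+ 3 <= x `^ m.
  by rewrite -powR_mulrn// ler_powR// ltW.
by lra.
Qed.

Lemma psi_ge0 (z : R) : 0 <= psi m z.
Proof. by rewrite invr_ge0 addr_ge0// powR_ge0. Qed.

(** Both regimes of the bounds fit under one kernel.  The terms with a profile go
    into the cubic part.  The middle term lives where delta <= |z| <= v^alpha:
    there |z| is comparable to delta + |z|, and 1 + |z| <= 1 + v^alpha. *)
Lemma bounds_domination t y v : boundsB alpha b m M1 M2 A eps T H ->
  0 <= t <= T -> 0 < v ->
  H y v t <= (1 + v `^ alpha) / (1 + v `^ b) *
    kern (2 * A + `|M2| * A) (4 * M1 * A ^+ 3) (expR (t / eps)) eps (delta t)
      (y - v `^ alpha).
Proof.
move=> B tT v0; have A0 : 0 < A := lt_le_trans ltr01 A1.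
have ap : 0 <= v `^ alpha by exact: powR_ge0.
have pb : 0 < 1 + v `^ b by rewrite ltr_pwDl// powR_ge0.
set lam := expR (t / eps); have lam0 : 0 < lam by exact: expR_gt0.
set z := y - v `^ alpha; have d0 := delta_gt0 t.
pose P := lam * (2 / (1 + `|lam * z| ^+ 3)).
have profP : profile alpha m eps y v t <= P.
  by rewrite /profile ler_pM2l//; exact: psi_le_cubic.
have prof0 : 0 <= profile alpha m eps y v t.
  by rewrite /profile mulr_ge0 ?psi_ge0// ltW.
pose Q := eps / ((delta t + `|z|) * (1 + `|z|)).
have Q0 : 0 <= Q by rewrite divr_ge0 ?ltW// mulr_gt0// ltr_pwDl.
have M2A : 0 <= `|M2| * A by rewrite mulr_ge0// ltW.
have a20 : 0 <= 4 * M1 * A ^+ 3 by rewrite !mulr_ge0 ?exprn_ge0// ltW.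
have goalE : (1 + v `^ alpha) / (1 + v `^ b) *
    kern (2 * A + `|M2| * A) (4 * M1 * A ^+ 3) lam eps (delta t) z =
  (1 + v `^ b)^-1 * ((1 + v `^ alpha) *
     ((2 * A + `|M2| * A) * P + 4 * M1 * A ^+ 3 * Q)).
  by rewrite /kern -/P -/Q; ring.
rewrite goalE ler_pdivlMl//.
have main X : X <= (2 * A + `|M2| * A) * P ->
  X <= (1 + v `^ alpha) * ((2 * A + `|M2| * A) * P + 4 * M1 * A ^+ 3 * Q).
  move=> /le_trans; apply; rewrite mulrDr.
  have p1 : 0 <= (2 * A + `|M2| * A) * P.
    by rewrite mulr_ge0//; [lra|exact: le_trans profP].
  have := mulr_ge0 ap p1; have : 0 <= 4 * M1 * A ^+ 3 * Q by rewrite mulr_ge0.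
  move=> q1; have := mulr_ge0 ap q1; lra.
have := B t y v tT v0; case: ifP => _ /andP[_ Hb]; last first.
  apply: main; apply: le_trans Hb _.
  have : 2 * A * profile alpha m eps y v t <= 2 * A * P by rewrite ler_wpM2l//; lra.
  by have := mulr_ge0 M2A (le_trans prof0 profP); lra.
have indic01 (X : set R) : 0 <= (\1_X y : R) <= 1.
  by rewrite indicE; case: (_ \in _); rewrite ?lexx ler01.
have E1 : (1 + v `^ b) * T1 alpha b m M1 A eps y v t <= 2 * A * P.
  rewrite /T1; set i := \1__ _; have /andP[i0 i1] : 0 <= i <= 1 := indic01 _.
  have -> : (1 + v `^ b) * (2 * A / (1 + v `^ b) * profile alpha m eps y v t * i) =
      2 * A * (profile alpha m eps y v t * i) by field; rewrite gt_eqF.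
  apply: ler_wpM2l; first by rewrite mulr_ge0// ltW.
  by apply: le_trans profP; rewrite ler_piMr.
have E3 : (1 + v `^ b) * T3 alpha b m M2 A eps y v t <= `|M2| * A * P.
  rewrite /T3; set i := \1__ _; have /andP[i0 i1] : 0 <= i <= 1 := indic01 _.
  have -> : (1 + v `^ b) * (M2 * A / (1 + v `^ b) * profile alpha m eps y v t * i) =
      M2 * A * (profile alpha m eps y v t * i) by field; rewrite gt_eqF.
  apply: (@le_trans _ _ (`|M2| * A * (profile alpha m eps y v t * i))).
    apply: ler_wpM2r; first by rewrite mulr_ge0.
    by apply: ler_wpM2r; [exact: ltW|exact: ler_norm].
  by apply: ler_wpM2l => //; apply: le_trans profP; rewrite ler_piMr.
have E2 : (1 + v `^ b) * T2 alpha b m M1 A eps y v t <=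
    (1 + v `^ alpha) * (4 * M1 * A ^+ 3 * Q).
  rewrite /T2 indicE; case: (boolP (y \in _)) => [|_]; last first.
    rewrite !mulr0; apply: mulr_ge0; first by rewrite addr_ge0.
    exact: mulr_ge0.
  rewrite inE /= in_itv /= => /andP[y1 y2].
  have zd : delta t <= - z by move: y2; rewrite /Defs.cut /z /delta; lra.
  have zn : `|z| = - z by rewrite ler0_norm//; move: d0; lra.
  have nz0 : 0 < `|z| by rewrite zn; exact: lt_le_trans zd.
  have zv : `|z| <= v `^ alpha.
    by have := powR_ge0 (v / 3) alpha; rewrite zn /z; lra.
  rewrite -/z.
  have -> : (1 + v `^ b) * (2 * M1 * A ^+ 3 * eps / ((1 + v `^ b) * `|z|) * 1) =
      (M1 * A ^+ 3 * eps) * (2 / `|z|) by field; rewrite gt_eqF//= gt_eqF.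
  have -> : (1 + v `^ alpha) * (4 * M1 * A ^+ 3 * Q) = (M1 * A ^+ 3 * eps) *
      (4 * (1 + v `^ alpha) / ((delta t + `|z|) * (1 + `|z|))).
    by rewrite /Q; ring.
  apply: ler_wpM2l; first by rewrite !mulr_ge0 ?exprn_ge0// ltW.
  rewrite ler_pdivrMr// mulrAC ler_pdivlMr ?mulr_gt0// ?ltr_pwDl//.
  have h1 : delta t + `|z| <= 2 * `|z| by move: zd; rewrite -zn; lra.
  have : (delta t + `|z|) * (1 + `|z|) <= (2 * `|z|) * (1 + v `^ alpha).
    apply: ler_pM => //; first by rewrite addr_ge0// ltW.
    by rewrite lerD2l.
  by lra.
apply: (@le_trans _ _ ((1 + v `^ b) * (T1 alpha b m M1 A eps y v t +
    T2 alpha b m M1 A eps y v t + T3 alpha b m M2 A eps y v t))).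
  by rewrite ler_wpM2l// ltW.
have AP : 0 <= (2 * A + `|M2| * A) * P.
  by rewrite mulr_ge0 ?(le_trans prof0 profP)//; lra.
by have := mulr_ge0 ap AP; lra.
Qed.

(** Since 1/delta <= C0 e^(t/eps), the logarithm is at most a constant plus t/eps:
    the factor [eps] of the tail compensates exactly the exponentially small scale. *)
Lemma log_bound t : 0 <= t <= T -> eps * ln ((delta t + 1) / delta t) <= T + C0 m M1 A.
Proof.
move=> /andP[t0 tT]; have C := C0_gt0; have d0 := delta_gt0 t.
have m1 : 0 < (m - 1)^-1 by rewrite invr_gt0; have := m3; lra.
have E0 : 0 <= t / eps by rewrite divr_ge0// ltW.
have e1 : 1 <= expR (t / eps) by rewrite -expR0 ler_expR.
have dV : (delta t)^-1 <= C0 m M1 A * expR (t / eps).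
  rewrite /delta /threshold expRN !invfM !invrK powRN invrK.
  rewrite ler_pM2r ?expR_gt0//; apply: ler_piMr; first exact: ltW.
  by rewrite -[leRHS](powRr0 eps) ger_powR ?eps0// ltW.
have -> : (delta t + 1) / delta t = 1 + (delta t)^-1.
  by rewrite mulrDl divff ?gt_eqF// mul1r.
have h : 1 + (delta t)^-1 <= expR (C0 m M1 A) * expR (t / eps).
  apply: (@le_trans _ _ ((1 + C0 m M1 A) * expR (t / eps))).
    by rewrite mulrDl mul1r lerD.
  by rewrite ler_wpM2r ?expR_ge0// expR_ge1Dx.
have p : 0 < 1 + (delta t)^-1 by rewrite ltr_pwDl// invr_ge0 ltW.
have : ln (1 + (delta t)^-1) <= C0 m M1 A + t / eps.
  by rewrite -[leRHS]expRK ler_ln ?posrE ?expR_gt0// expRD.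
move=> hl; apply: (@le_trans _ _ (eps * (C0 m M1 A + t / eps))).
  by rewrite ler_wpM2l// ltW.
rewrite mulrDr mulrCA divff ?gt_eqF// mulr1 addrC lerD//.
by rewrite ler_piMl// ltW.
Qed.

End domination.

(** * The change of variables z = w^alpha *)

Section jacobian.
Context {R : realType}.
Local Notation mu := (@lebesgue_measure R).

Lemma powR_continuous_gt0 (a x : R) : 0 < x -> {for x, continuous (fun z => z `^ a)}.
Proof.
move=> x0; apply: differentiable_continuous; apply/derivable1_diffP.
by apply: derivable_powR; rewrite in_itv /= andbT.
Qed.

Lemma powR_derive_continuous (a x : R) : 0 < x ->
  {for x, continuous (derive1 (fun z : R => z `^ a))}.
Proof.
move=> x0; have E z : 0 < z -> (derive1 (fun z : R => z `^ a)) z = a * z `^ (a - 1).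
  by move=> z0; rewrite powR_derive1// in_itv/= andbT.
suff : derive1 (fun z : R => z `^ a) z @[z --> x] --> a * x `^ (a - 1).
  by rewrite -E.
have c : a * z `^ (a - 1) @[z --> x] --> a * x `^ (a - 1).
  by apply: cvgM; [exact: cvg_cst|exact: powR_continuous_gt0].
apply: cvg_trans c; apply: near_eq_cvg; near=> z; rewrite E//.
near: z; exact: lt_nbhsr.
Unshelve. all: by end_near. Qed.

(** Integration by substitution needs a compact interval avoiding 0, where
    [powR] is not differentiable. *)
Lemma integral_powR_subst (k : R -> R) (alpha y c d : R) : 0 < alpha ->
  continuous k -> (forall z, 0 <= k z) -> 0 < c -> c <= d ->
  (\int[mu]_(w in `[c, d]) (k (y - w `^ alpha) * (alpha * w `^ (alpha - 1)))%:E
   <= \int[mu]_z (k (y - z))%:E)%E.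
Proof.
move=> a0 ck k0 c0 cd.
pose F (w : R) := w `^ alpha; pose G z := k (y - z).
have cG : continuous G.
  move=> z; apply: continuous_comp; last exact: ck.
  by apply: cvgB; [exact: cvg_cst|exact: cvg_id].
have d0 : 0 < d by exact: lt_le_trans cd.
have cF x : 0 < x -> {for x, continuous F} by exact: powR_continuous_gt0.
have cF' x : 0 < x -> {for x, continuous (derive1 F)} by exact: powR_derive_continuous.
have := @integration_by_substitution_increasing R F G c d cd.
have -> : (\int[mu]_(x in `[c, d]) (((G \o F) * derive1 F)%R x)%:E =
  \int[mu]_(w in `[c, d]) (k (y - w `^ alpha) * (alpha * w `^ (alpha - 1)))%:E)%E.
  apply: eq_integral => x; rewrite inE /= in_itv/= => /andP[cx _].
  have x0 : 0 < x by exact: lt_le_trans cx.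
  congr EFin; congr (_ * _); rewrite powR_derive1// in_itv/= andbT//.
move=> <-.
- apply: ge0_subset_integral => //.
    by apply/measurable_EFinP; exact: continuous_measurable_fun cG.
  by move=> z _; rewrite lee_fin; exact: k0.
- move=> u v; rewrite !in_itv/= => /andP[cu _] /andP[cv _] uv.
  by apply: gt0_ltr_powR => //; rewrite nnegrE ltW// (lt_le_trans c0).
- by move=> x; rewrite in_itv/= => /andP[cx _]; apply: cF'; exact: lt_trans cx.
- apply/cvg_ex; exists (derive1 F c); apply: cvg_at_right_filter; exact: cF'.
- apply/cvg_ex; exists (derive1 F d); apply: cvg_at_left_filter; exact: cF'.
- split.
  + move=> x; rewrite in_itv/= => /andP[cx _].
    by apply: derivable_powR; rewrite in_itv/= andbT (lt_trans c0).
  + by apply: cvg_at_right_filter; exact: cF.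
  + by apply: cvg_at_left_filter; exact: cF.
- exact: continuous_subspaceT.
Qed.

Lemma ge0_integral_bigcup_le d (T : measurableType d) (m : {measure set T -> \bar R})
    (F : (set T)^nat) (f : T -> \bar R) (C : \bar R) :
  {homo F : i j / (i <= j)%N >-> (i <= j)%O} -> (forall i, measurable (F i)) ->
  measurable_fun setT f -> (forall x, 0 <= f x)%E ->
  (forall i, \int[m]_(x in F i) f x <= C)%E ->
  (\int[m]_(x in \bigcup_i F i) f x <= C)%E.
Proof.
move=> ndF mF mf f0 FC.
have cv : (\int[m]_(x in F i) f x @[i --> \oo] --> \int[m]_(x in \bigcup_i F i) f x)%E.
  apply: ge0_nondecreasing_set_cvg_integral => // i; exact: measurable_funTS.
rewrite -(cvg_lim _ cv)//; apply: lime_le; first by apply/cvg_ex; eexists; exact: cv.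
by near=> i.
Unshelve. all: by end_near. Qed.

Lemma halfline_bigcup :
  @halfline R = \bigcup_n `[(n.+1%:R)^-1, n.+1%:R]%classic.
Proof.
apply/seteqP; split => x /=.
  rewrite /halfline /= in_itv/= andbT => x0.
  exists (Num.trunc (Num.max x x^-1)) => //=; rewrite in_itv/=.
  have h : Num.max x x^-1 < (Num.trunc (Num.max x x^-1)).+1%:R.
    by exact: truncnS_gt.
  rewrite -[X in _ <= X]invrK lef_pV2 ?posrE ?invr_gt0//.
  by move: h; rewrite gt_max => /andP[/ltW -> /ltW ->].
by move=> [n _ /=]; rewrite /halfline /= !in_itv/= andbT => /andP[+ _]; exact: lt_le_trans.
Qed.

(** The half-line is exhausted by compact intervals. *)
Lemma jacobian_integral (k : R -> R) (alpha y : R) : 0 < alpha ->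
  continuous k -> (forall z, 0 <= k z) -> (forall z, k (- z) = k z) ->
  (\int[mu]_(w in halfline) (k (y - w `^ alpha) * (alpha * w `^ (alpha - 1)))%:E
   <= \int[mu]_z (k z)%:E)%E.
Proof.
move=> a0 ck k0 kN.
have mk : measurable_fun [set: R] k by exact: continuous_measurable_fun.
have -> : (\int[mu]_z (k z)%:E = \int[mu]_z (k (y - z))%:E)%E.
  rewrite -[LHS](@integral_sub R y)//.
  - by apply: eq_integral => z _; rewrite -kN opprB.
  - exact/measurable_EFinP.
rewrite halfline_bigcup; apply: ge0_integral_bigcup_le.
- move=> i j ij; apply/subsetPset => x /=; rewrite !in_itv/= => /andP[h1 h2].
  have ijR : i.+1%:R <= j.+1%:R :> R by rewrite ler_nat.
  apply/andP; split; last exact: le_trans ijR.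
  by apply: le_trans h1; rewrite lef_pV2 ?posrE.
- by move=> i; exact: measurable_itv.
- apply/measurable_EFinP; apply: measurable_funM.
    apply: (measurableT_comp mk); apply: measurable_funB => //.
  exact: measurable_funM.
- by move=> x; rewrite lee_fin !mulr_ge0 ?powR_ge0// ltW.
- move=> i; apply: integral_powR_subst => //.
  by apply: (@le_trans _ _ 1); rewrite ?invf_le1 ?ler1n.
Qed.

End jacobian.

(** * Step functions *)

Section step_functions.
Context {R : realType}.

(** The pairs are a coefficient and an abscissa: integrating such a function
    against a measure on the half-line only involves its cumulative function. *)
Definition step (s : seq (R * R)) (v : R) : R :=
  \sum_(i <- s) i.1 * (v <= i.2)%R%:R.

Lemma step_cons i s v : step (i :: s) v = i.1 * (v <= i.2)%R%:R + step s v.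
Proof. by rewrite /step big_cons. Qed.

Local Lemma measurable_step_atom d (X : measurableType d) (tau : X -> R) (x : R) :
  measurable_fun setT tau -> measurable_fun setT (fun p => (tau p <= x)%R%:R : R).
Proof.
move=> mt; apply: (measurableT_comp (f := fun b : bool => (b%:R : R))) => //.
exact: measurable_fun_ler.
Qed.

Lemma bool01 (b : bool) : 0 <= (b%:R : R) <= 1.
Proof. by case: b; rewrite ?lexx ler01. Qed.

Variables (d : measure_display) (X : measurableType d)
  (nu : {measure set X -> \bar R}).
Variables (P tau phi : X -> R) (M : R).
Hypotheses (mP : measurable_fun setT P) (P0 : forall p, 0 <= P p)
  (iP : nu.-integrable setT (EFin \o P))
  (mt : measurable_fun setT tau) (mphi : measurable_fun setT phi)
  (phiM : forall p, P p != 0 -> `|phi p| <= M).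

Lemma integrable_weighted (f : X -> R) (c : R) : measurable_fun setT f ->
  (forall p, P p != 0 -> `|f p| <= c) ->
  nu.-integrable setT (EFin \o (fun p => P p * f p)).
Proof.
move=> mf fc; apply: (@le_integrable _ _ _ _ _ measurableT _ (fun p => c%:E * (EFin \o P) p)%E).
- by apply/measurable_EFinP; exact: measurable_funM.
- move=> p _ /=; rewrite lee_fin normrM (ger0_norm (P0 p)).
  have [->|Pp] := eqVneq (P p) 0; first by rewrite mul0r normr_ge0.
  rewrite mulrC; apply: le_trans (ler_norm _); exact: ler_wpM2r (fc p Pp).
- exact: integrableZl.
Qed.

Let ibound (x : R) :
  nu.-integrable setT (EFin \o (fun p => P p * (tau p <= x)%R%:R)).
Proof.
apply: (integrable_weighted (c := 1)); first exact: measurable_step_atom.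
by move=> p _; have /andP[b0 b1] := bool01 (tau p <= x); rewrite ger0_norm.
Qed.

Lemma integrable_step s : nu.-integrable setT (EFin \o (fun p => P p * step s (tau p))).
Proof.
elim: s => [|i s IH].
  rewrite (_ : _ \o _ = cst 0%E); first exact: integrable0.
  by apply/funext => p /=; rewrite /step big_nil mulr0.
rewrite (_ : _ \o _ = (fun p => (i.1%:E * (P p * (tau p <= i.2)%R%:R)%R%:E)%E) \+
    (EFin \o (fun p => (P p * step s (tau p))%R)))%E.
  by apply: integrableD => //; exact: (integrableZl measurableT i.1 (ibound i.2)).
by apply/funext => p /=; rewrite step_cons -EFinM -EFinD; congr EFin; ring.
Qed.

Lemma Rintegral_step s : \int[nu]_p (P p * step s (tau p)) =
  \sum_(i <- s) i.1 * \int[nu]_p (P p * (tau p <= i.2)%R%:R).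
Proof.
elim: s => [|i s IH].
  rewrite big_nil; under eq_Rintegral do rewrite /step big_nil mulr0.
  by rewrite Rintegral_cst// mul0r.
rewrite big_cons -IH -(@RintegralZl _ _ _ nu setT _ i.1 measurableT (ibound i.2)).
rewrite -RintegralD//; last 2 first.
- by have := integrableZl measurableT i.1 (ibound i.2).
- exact: integrable_step.
by apply: eq_Rintegral => p _; rewrite step_cons; ring.
Qed.

(** [P] is a density; the error [e] may depend on the point, which is needed where
    the test function is close to its trace only near the curve. *)
Lemma step_approximation s (e : X -> R) :
  nu.-integrable setT (EFin \o (fun p => P p * e p)) ->
  (forall p, P p != 0 -> `|phi p - step s (tau p)| <= e p) ->
  `|\int[nu]_p (P p * phi p) -
    \sum_(i <- s) i.1 * \int[nu]_p (P p * (tau p <= i.2)%R%:R)|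
    <= \int[nu]_p (P p * e p).
Proof.
move=> ie phie; rewrite -Rintegral_step.
have i1 := integrable_weighted mphi phiM; have i2 := integrable_step s.
rewrite -RintegralB//.
have i3 := integrableB measurableT i1 i2.
apply: le_trans (le_normr_Rintegral measurableT i3) _.
apply: le_Rintegral => //; first exact: integrable_norm.
move=> p _; rewrite -mulrBr normrM (ger0_norm (P0 p)).
have [->|Pp] := eqVneq (P p) 0; first by rewrite !mul0r.
exact: ler_wpM2l (phie p Pp).
Qed.

End step_functions.

(** * Estimates uniform in the time scale *)

Section uniform_estimates.
Context {R : realType}.
Local Notation mu := (@lebesgue_measure R).
Variables (K0 alpha gamma b m M1 M2 A T eps : R).
Variables (K : R -> R -> R) (H : R -> R -> R -> R).
Hypotheses (K00 : 0 < K0) (al : 0 < alpha < 1) (ga : 1 < gamma < 1 + alpha)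
  (cK : coagulation_kernel K0 gamma K) (gb : gamma + 3 < b) (m3 : 3 <= m)
  (M10 : 0 < M1) (A1 : 1 <= A) (T0 : 0 < T) (eps0 : 0 < eps) (eps1 : eps <= 1)
  (sol : mild_solution alpha eps K T H)
  (bnd : boundsB alpha b m M1 M2 A eps T H).

Let al0 : 0 < alpha. Proof. by case/andP: al. Qed.
Let al01 : 0 <= alpha <= 1. Proof. by case/andP: al => /ltW -> /ltW ->. Qed.
Let ga0 : 0 <= gamma. Proof. by case/andP: ga => g _; apply: ltW; exact: lt_trans g. Qed.
Let gb' : gamma + 3 <= b. Proof. exact: ltW. Qed.

(** The extensions by zero are measurable on the whole space, so that no
    domain has to be carried through the compositions below. *)
Definition extK (v w : R) : R := if (0 < v) && (0 < w) then K v w else 0.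
Definition extH (y v t : R) : R := if (0 < v) && (0 <= t <= T) then H y v t else 0.

Definition core_coef : R := 2 * A + `|M2| * A.
Definition tail_coef : R := 4 * M1 * A ^+ 3.
(** The factor 1 + v^alpha comes from the tail of the kernel. *)
Definition weight (v : R) : R := (1 + v `^ alpha) / (1 + v `^ b).
Definition moment (v : R) : R := 1 + v `^ gamma.
Definition mass_const : R :=
  core_coef * (4 * pi) + tail_coef * (2 * (T + C0 m M1 A) + pi).

Let delta t := threshold m M1 A eps * expR (- (t / eps)).
Let kt t := kern core_coef tail_coef (expR (t / eps)) eps (delta t).

Let core_coef_ge0 : 0 <= core_coef.
Proof.
by rewrite addr_ge0// mulr_ge0//; apply: le_trans A1.
Qed.

Let tail_coef_ge0 : 0 <= tail_coef.
Proof. by rewrite !mulr_ge0 ?exprn_ge0// ?ltW//; apply: lt_le_trans A1. Qed.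

Let delta0 t : 0 < delta t. Proof. exact: delta_gt0. Qed.

Let kt0 t z : 0 <= kt t z.
Proof. by apply: kern_ge0 => //; exact: expR_gt0. Qed.

Let ktN t z : kt t (- z) = kt t z. Proof. exact: kernN. Qed.

Let ckt t : continuous (kt t). Proof. by apply: kern_continuous => //; exact: expR_gt0. Qed.

Let mkt t : measurable_fun [set: R] (kt t).
Proof. exact: continuous_measurable_fun. Qed.

Let int_kt t : 0 <= t <= T -> (\int[mu]_z (kt t z)%:E <= mass_const%:E)%E.
Proof.
move=> tT; apply: le_trans (kern_integral core_coef_ge0 tail_coef_ge0 (expR_gt0 _) eps0 (delta0 t)) _.
rewrite lee_fin lerD2l -mulrA; apply: ler_wpM2l => //.
have := log_bound (M1 := M1) (A := A) eps0 eps1 m3 M10 A1 tT; rewrite -/(delta t).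
have : eps * pi <= pi by rewrite ler_piMl// pi_ge0.
move=> h1 h2; rewrite mulrDr mulrCA; lra.
Qed.

Lemma mass_const_ge0 : 0 <= mass_const.
Proof.
rewrite -lee_fin; apply: le_trans (int_kt (t := 0) _).
  by apply: integral_ge0 => z _; rewrite lee_fin.
by rewrite lexx ltW.
Qed.

Let mc0 : 0 <= mass_const. Proof. exact: mass_const_ge0. Qed.

Let weight0 v : 0 <= weight v.
Proof. by rewrite divr_ge0// addr_ge0// powR_ge0. Qed.

Let moment_ge1 v : 1 <= moment v.
Proof. by rewrite lerDl powR_ge0. Qed.

Let extH_dom y v t : 0 < v -> 0 <= t <= T ->
  extH y v t <= weight v * kt t (y - v `^ alpha).
Proof.
move=> v0 tT; rewrite /extH v0 tT /=; by apply: bounds_domination bnd _ _.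
Qed.

Lemma extH_ge0 y v t : 0 <= extH y v t.
Proof.
rewrite /extH; case: ifP => // /andP[v0 tT].
by case: sol => _ h _; exact: h.
Qed.

Lemma extK_ge0 v w : 0 <= extK v w.
Proof.
rewrite /extK; case: ifP => // /andP[v0 w0].
by case: cK => _ h _; have [] := h v w v0 w0.
Qed.

Lemma measurable_extK : measurable_fun [set: R * R] (fun p : R * R => extK p.1 p.2).
Proof.
have [mK _ _] := cK.
have mD : measurable (@halfline R `*` @halfline R).
  by apply: measurableX; exact: measurable_itv.
have := (measurable_restrict (fun p : R * R => K p.1 p.2) mD measurableT).1.
rewrite setTI => /(_ mK); apply: eq_measurable_fun => -[v w] _.
rewrite /patch /extK /=; case: ifPn.
  by rewrite inE => -[/=]; rewrite /halfline /= !in_itv/= !andbT => -> ->.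
rewrite notin_setE => h; case: ifP => // /andP[v0 w0]; exfalso; apply: h.
by split; rewrite /halfline /= in_itv/= andbT.
Qed.

Lemma measurable_extH :
  measurable_fun [set: R * R * R] (fun q : R * R * R => extH q.1.1 q.1.2 q.2).
Proof.
have [[mH _ _] _ _] := sol.
have mD : measurable (@halfplane R `*` (`[0, T]%classic : set R)).
  apply: measurableX; last exact: measurable_itv.
  by apply: measurableX => //; exact: measurable_itv.
have := (measurable_restrict (fun q : R * R * R => H q.1.1 q.1.2 q.2) mD measurableT).1.
rewrite setTI => /(_ mH); apply: eq_measurable_fun => -[[y v] t] _.
rewrite /patch /extH /=; case: ifPn.
  rewrite inE => -[/= [_]]; rewrite /halfline /= !in_itv/= !andbT => -> /= ->.
  by [].
rewrite notin_setE => h; case: ifP => // /andP[v0 tT]; exfalso; apply: h.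
by split; [split=> //; rewrite /halfline|] ; rewrite /= in_itv/= ?andbT.
Qed.

Lemma measurable_section d (X : measurableType d) (f g h : X -> R) :
  measurable_fun setT f -> measurable_fun setT g -> measurable_fun setT h ->
  measurable_fun setT (fun x => extH (f x) (g x) (h x)).
Proof. by move=> mf mg mh; exact: (measurable_compH measurable_extH mf mg mh). Qed.

Lemma extH_out y v t : v <= 0 -> extH y v t = 0.
Proof. by move=> v0; rewrite /extH ltNge v0. Qed.

Lemma extH_out_time y v t : ~~ (0 <= t <= T) -> extH y v t = 0.
Proof. by move=> tT; rewrite /extH (negbTE tT) andbF. Qed.

Lemma slice_weighted (g : R -> R) v t (c : R) : measurable_fun [set: R] g ->
  (forall z, 0 <= g z) -> 0 <= c ->
  (0 <= t <= T -> (\int[mu]_z (g z * kt t z)%:E <= c%:E)%E) ->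
  0 < v ->
  (\int[mu]_y (g (y - v `^ alpha) * extH y v t)%:E <= (weight v * c)%:E)%E.
Proof.
move=> mg g0 c0 gc v0.
have [tT|tT] := boolP (0 <= t <= T); last first.
  rewrite integral0_eq; first by rewrite lee_fin; exact: mulr_ge0.
  by move=> y _; rewrite extH_out_time// mulr0.
have mgk : measurable_fun [set: R] (fun z => (g z * kt t z)%:E).
  by apply/measurable_EFinP; exact: measurable_funM.
apply: (@le_trans _ _ (\int[mu]_y ((weight v)%:E *
    (g (y - v `^ alpha) * kt t (y - v `^ alpha))%:E))%E).
  apply: le_int => y _; first by rewrite lee_fin mulr_ge0// extH_ge0.
  by rewrite -EFinM lee_fin mulrCA ler_wpM2l// extH_dom.
rewrite ge0_integralZl//.
- rewrite (@integral_sub R (v `^ alpha) (fun z => (g z * kt t z)%:E))//.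
    by rewrite [leRHS]EFinM; apply: lee_wpmul2l; [rewrite lee_fin|exact: gc].
  by move=> z; rewrite lee_fin mulr_ge0.
- apply: (measurableT_comp mgk); exact: measurable_funB.
- by move=> y _; rewrite lee_fin mulr_ge0.
- by rewrite lee_fin.
Qed.

Lemma moment_integral (h : R -> \bar R) (c : R) : 0 <= c ->
  (forall v, 0 <= h v)%E -> (forall v, 0 < v -> (h v <= (weight v * c)%:E)%E) ->
  (forall v, v <= 0 -> h v = 0%E) ->
  (\int[mu]_v ((moment v)%:E * h v) <= (8 * pi * c)%:E)%E.
Proof.
move=> c0 h0 hw hout.
have pos v : 0 <= 8 * c * (1 + v ^+ 2)^-1.
  by rewrite !mulr_ge0// invr_ge0 ltW// posD_sqr.
apply: (@le_trans _ _ (\int[mu]_v (8 * c * (1 + v ^+ 2)^-1)%:E)%E).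
  apply: le_int => v _.
    by rewrite mule_ge0// lee_fin (le_trans ler01).
  have [v0|v0] := leP v 0; first by rewrite hout// mule0 lee_fin.
  apply: (@le_trans _ _ ((moment v)%:E * (weight v * c)%:E)%E).
    by apply: lee_wpmul2l; [rewrite lee_fin (le_trans ler01)|exact: hw].
  rewrite -EFinM lee_fin mulrA [8 * c * _]mulrAC.
  by rewrite ler_wpM2r//; exact: weight_moment.
rewrite mulrAC; apply: integral_le_cauchy; first by rewrite mulr_ge0.
by move=> x; rewrite pos lexx.
Qed.

(** Mass of the solution at size [v]. *)
Definition slice v t : \bar R := (\int[mu]_y (extH y v t)%:E)%E.

Lemma slice_ge0 v t : (0 <= slice v t)%E.
Proof. by apply: integral_ge0 => y _; rewrite lee_fin extH_ge0. Qed.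

Lemma slice_out v t : v <= 0 -> slice v t = 0%E.
Proof. by move=> v0; apply: integral0_eq => y _; rewrite extH_out. Qed.

Lemma slice_le_weight v t : 0 < v -> (slice v t <= (weight v * mass_const)%:E)%E.
Proof.
move=> v0; have := @slice_weighted (cst 1) v t mass_const (measurable_cst _)
  (fun=> ler01) mass_const_ge0 _ v0.
have E (g : R -> R) : (\int[mu]_z (cst 1 z * g z)%:E = \int[mu]_z (g z)%:E)%E.
  by apply: eq_integral => z _; rewrite /= mul1r.
rewrite E; have -> : (\int[mu]_y (cst 1 (y - v `^ alpha) * extH y v t)%:E = slice v t)%E.
  by apply: eq_integral => y _; rewrite /= mul1r.
by apply=> tT; exact: int_kt.
Qed.

Lemma slice_moment t :
  (\int[mu]_v ((moment v)%:E * slice v t) <= (8 * pi * mass_const)%:E)%E.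
Proof.
apply: moment_integral => //.
- by move=> v; exact: slice_ge0.
- by move=> v v0; exact: slice_le_weight.
- by move=> v v0; exact: slice_out.
Qed.

Lemma measurable_slice_mass t : measurable_fun [set: R] (slice ^~ t).
Proof.
apply: (@measurable_slice R _ R setT (fun p => (extH p.2 p.1 t)%:E)) => //.
  by apply/measurable_EFinP; exact: measurable_section.
by move=> p; rewrite lee_fin extH_ge0.
Qed.

(** The truncated first moment of the kernel, integrated in the size variable. *)
Lemma concentration t : 0 <= t <= T ->
  (\int[mu]_v \int[mu]_y (Num.min 1 `|y - v `^ alpha| * extH y v t)%:E <=
    (8 * pi * (core_coef * (4 * pi / expR (t / eps)) + tail_coef * eps * pi))%:E)%E.
Proof.
move=> tT; set c := core_coef * _ + _.
have c0 : 0 <= c.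
  apply: addr_ge0; apply: mulr_ge0; rewrite ?pi_ge0//.
    by rewrite !mulr_ge0 ?pi_ge0 ?invr_ge0 ?expR_ge0.
  by apply: mulr_ge0 => //; exact: ltW.
have w0 (z : R) : 0 <= Num.min 1 `|z| by rewrite le_min ler01 normr_ge0.
pose h v := (\int[mu]_y (Num.min 1 `|y - v `^ alpha| * extH y v t)%:E)%E.
have h0 v : (0 <= h v)%E.
  by apply: integral_ge0 => y _; rewrite lee_fin mulr_ge0// extH_ge0.
apply: le_trans (moment_integral (h := h) c0 _ _ _) => //.
- apply: le_int => v _; first exact: h0.
  by rewrite -[leLHS]mul1e; apply: lee_wpmul2r; [exact: h0|rewrite lee_fin].
- move=> v v0; apply: (@slice_weighted (fun z => Num.min 1 `|z|)) => //.
    by apply: measurable_minr => //; exact: normr_measurable.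
  move=> _; exact: (kern_moment core_coef_ge0 tail_coef_ge0 (expR_gt0 _) eps0 (delta0 t)).
- move=> v v0; apply: integral0_eq => y _; by rewrite extH_out// mulr0.
Qed.

Definition loss_const : R := K0 * (4 / alpha * mass_const).

Lemma loss_const_ge0 : 0 <= loss_const.
Proof. by rewrite !mulr_ge0 ?invr_ge0// ltW. Qed.

(** At fixed [y], the majorant of the integrand is a function of y - w^alpha times
    the Jacobian w^(alpha - 1), so the change of variables bounds the integral by
    the mass of the kernel, independently of [y]. *)
Lemma loss_rate_le y v t : (loss_rate extK extH y v t <= (loss_const * moment v)%:E)%E.
Proof.
have L0 := loss_const_ge0; have m0 : 0 <= moment v by exact: le_trans ler01 _.
have [tT|tT] := boolP (0 <= t <= T); last first.
  rewrite /loss_rate integral0_eq; first by rewrite lee_fin; exact: mulr_ge0.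
  by move=> w _; rewrite extH_out_time// mulr0.
have [v0|v0] := leP v 0.
  rewrite /loss_rate integral0_eq; first by rewrite lee_fin; exact: mulr_ge0.
  by move=> w _; rewrite /extK ltNge v0 mul0r.
have mK0 : 0 <= K0 * moment v * (4 / alpha) by rewrite !mulr_ge0 ?invr_ge0// ltW.
apply: (@le_trans _ _ (\int[mu]_(w in halfline) ((K0 * moment v * (4 / alpha))%:E *
   (kt t (y - w `^ alpha) * (alpha * w `^ (alpha - 1)))%:E))%E).
  apply: le_int => w; first by move=> _; rewrite lee_fin mulr_ge0 ?extK_ge0 ?extH_ge0.
  rewrite /halfline /= in_itv/= andbT => w0; rewrite -EFinM lee_fin.
  have Kle : extK v w <= K0 * moment v * moment w.
    rewrite /extK v0 w0 /=; case: cK => _ h _; have [_ [_ hK]] := h v w v0 w0.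
    apply: le_trans hK _; rewrite -mulrA ler_pM2l// /moment.
    have := powR_ge0 v gamma; have := powR_ge0 w gamma => p q.
    by have := mulr_ge0 p q; lra.
  apply: (@le_trans _ _ (K0 * moment v * moment w * (weight w * kt t (y - w `^ alpha)))).
    by apply: ler_pM; rewrite ?extK_ge0 ?extH_ge0// extH_dom.
  have wj : moment w * weight w <= 4 * w `^ (alpha - 1) by exact: weight_jacobian.
  have -> : K0 * moment v * moment w * (weight w * kt t (y - w `^ alpha)) =
    K0 * moment v * kt t (y - w `^ alpha) * (moment w * weight w) by ring.
  have -> : K0 * moment v * (4 / alpha) * (kt t (y - w `^ alpha) * (alpha * w `^ (alpha - 1)))
    = K0 * moment v * kt t (y - w `^ alpha) * (4 * w `^ (alpha - 1)).
    by field; rewrite gt_eqF.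
  by apply: ler_wpM2l => //; rewrite !mulr_ge0// ltW.
rewrite ge0_integralZl//.
- have -> : loss_const * moment v = K0 * moment v * (4 / alpha) * mass_const.
    by rewrite /loss_const; ring.
  rewrite [leRHS]EFinM; apply: lee_wpmul2l; first by rewrite lee_fin.
  apply: le_trans (int_kt tT); exact: jacobian_integral.
- exact: measurable_itv.
- apply/measurable_EFinP; apply: measurable_funTS; apply: measurable_funM.
    by apply: (measurableT_comp (mkt t)); exact: measurable_funB.
  exact: measurable_funM.
- by move=> w _; rewrite lee_fin !mulr_ge0 ?powR_ge0// ltW.
Qed.

Let extHE y v t : 0 < v -> 0 <= t <= T -> extH y v t = H y v t.
Proof. by move=> v0 tT; rewrite /extH v0 tT. Qed.

Let extKE v w : 0 < v -> 0 < w -> extK v w = K v w.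
Proof. by move=> v0 w0; rewrite /extK v0 w0. Qed.

Let ext_loss y v t : 0 < v -> 0 <= t <= T ->
  loss_rate extK extH y v t = loss_rate K H y v t.
Proof.
move=> v0 tT; apply: eq_integral => w.
rewrite inE /halfline /= in_itv/= andbT => w0.
by rewrite extHE// extKE.
Qed.

Let ext_damping y v s t : 0 < v -> 0 <= s -> t <= T ->
  damping alpha eps extK extH y v s t = damping alpha eps K H y v s t.
Proof.
move=> v0 s0 tT; rewrite /damping; congr (expeR (- _))%E.
apply: eq_integral => tau; rewrite inE /= in_itv/= => /andP[h1 h2].
by apply: ext_loss => //; rewrite (le_trans s0)// (le_trans h2).
Qed.

Lemma ext_mild t v y : 0 <= t <= T -> 0 < v ->
  ((extH y v t)%:E
     - (semigroup alpha eps t (fun y' v' => extH y' v' 0) y v)%:E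
       * damping alpha eps extK extH y v 0 t
   = (2^-1)%:E *
     \int[mu]_(s in `[0%R, t])
       \int[mu]_(w in `]0%R, v[)
         (damping alpha eps extK extH y v s t *
          (semigroup alpha eps (t - s)
            (fun y' v' => (extK (v' - w) w * extH y' (v' - w) s * extH y' w s)%R)
            y v)%:E))%E.
Proof.
move=> tT v0; have [_ _ /(_ t v y tT v0)] := sol.
have /andP[t0 tT'] := tT.
have T00 : 0 <= (0 : R) <= T by rewrite lexx ltW.
have E1 := extHE y v0 tT.
have E2 : semigroup alpha eps t (fun y' v' => extH y' v' 0) y v =
    semigroup alpha eps t (fun y' v' => H y' v' 0) y v.
  by congr (_ * _); exact: extHE.
have E3 := ext_damping y v0 (lexx (0 : R)) tT'.
rewrite E1 E2 E3 => ->; apply: (congr1 (fun I => (2^-1)%:E * I)%E).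
apply: eq_integral => s; rewrite inE /= in_itv/= => /andP[s0 st].
apply: eq_integral => w; rewrite inE /= in_itv/= => /andP[w0 wv].
have sT : 0 <= s <= T by rewrite s0 (le_trans st).
have vw0 : 0 < v - w by rewrite subr_gt0.
rewrite (ext_damping y v0 s0 tT'); congr (_ * _%:E)%E.
congr (_ * _); congr (_ * _); last exact/esym/extHE.
by congr (_ * _); [exact/esym/extKE|exact/esym/extHE].
Qed.

Definition cumul x t : \bar R := (\int[mu]_(v in `]0%R, x]) slice v t)%E.

Lemma cumul_time (t1 t2 x : R) : 0 <= t1 -> t1 <= t2 -> t2 <= T ->
  (cumul x t1 <= cumul x t2 + (loss_const * (8 * pi * mass_const) * (t2 - t1))%:E)%E /\
  (cumul x t2 <= cumul x t1 + (loss_const * (8 * pi * mass_const) * (t2 - t1))%:E)%E.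
Proof.
apply: (@cumulative_time_lipschitz R alpha eps T loss_const (8 * pi * mass_const)
  extK extH moment).
- exact: loss_const_ge0.
- exact: measurable_extK.
- exact: extK_ge0.
- move=> v w; rewrite /extK andbC; case: ifP => // /andP[w0 v0].
  by case: cK => _ h _; have [_ [-> _]] := h v w v0 w0.
- by move=> v w v0; rewrite /extK ltNge v0.
- exact: measurable_extH.
- exact: extH_ge0.
- by apply: measurable_funD => //; exact: measurable_powR.
- by move=> v; exact: le_trans ler01 _.
- exact: loss_rate_le.
- exact: slice_moment.
- by move=> t v y; exact: ext_mild.
Qed.

Lemma weight_le8 v : 0 < v -> weight v <= 8.
Proof.
move=> v0; apply: (@le_trans _ _ (moment v * weight v)).
  by rewrite ler_peMl.
apply: le_trans (weight_moment v0 al01 ga0 gb') _.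
by rewrite ler_pdivrMr ?posD_sqr// ler_peMr// lerDl sqr_ge0.
Qed.

Lemma slice_le v t : (slice v t <= (8 * mass_const)%:E)%E.
Proof.
have [v0|v0] := leP v 0; first by rewrite slice_out// lee_fin mulr_ge0.
apply: le_trans (slice_le_weight t v0) _; rewrite lee_fin.
by apply: ler_wpM2r => //; exact: weight_le8.
Qed.

Lemma slice_mass t : (\int[mu]_v slice v t <= (8 * pi * mass_const)%:E)%E.
Proof.
apply: le_trans (slice_moment t); apply: le_int => v _; first exact: slice_ge0.
by rewrite -[leLHS]mul1e; apply: lee_wpmul2r; [exact: slice_ge0|rewrite lee_fin].
Qed.

Lemma cumul_ge0 x t : (0 <= cumul x t)%E.
Proof. by apply: integral_ge0 => v _; exact: slice_ge0. Qed.

Lemma cumul_le x t : (cumul x t <= (8 * pi * mass_const)%:E)%E.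
Proof.
apply: le_trans (slice_mass t); apply: ge0_subset_integral => //.
- exact: measurable_slice_mass.
- by move=> v _; exact: slice_ge0.
Qed.

Lemma cumul_out x t : x <= 0 -> cumul x t = 0%E.
Proof.
by move=> x0; rewrite /cumul set_itv_ge ?integral_set0// bnd_simp -leNgt.
Qed.

Lemma cumul_space x x' t : x <= x' ->
  (cumul x t <= cumul x' t)%E /\
  (cumul x' t <= cumul x t + (8 * mass_const * (x' - x))%:E)%E.
Proof.
move=> xx'; split.
  apply: ge0_subset_integral => //.
  - exact: measurable_funTS (measurable_slice_mass t).
  - by move=> v _; exact: slice_ge0.
  - by move=> v /=; rewrite !in_itv/= => /andP[-> /le_trans]; exact.
apply: (@le_trans _ _ (\int[mu]_(v in `]0%R, x] `|` `]x, x']) slice v t)%E).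
  apply: ge0_subset_integral => //.
  - by apply: measurableU; exact: measurable_itv.
  - exact: measurable_funTS (measurable_slice_mass t).
  - by move=> v _; exact: slice_ge0.
  - move=> v /=; rewrite !in_itv/= => /andP[-> ->] /=.
    by case: (leP v x); [left|right].
rewrite ge0_integral_setU//=; last 3 first.
- exact: measurable_funTS (measurable_slice_mass t).
- by move=> v _; exact: slice_ge0.
- apply/disj_setPS => v [] /=; rewrite !in_itv/= => /andP[_ h] /andP[h' _].
  by have := le_lt_trans h h'; rewrite ltxx.
apply: leeD => //.
apply: (@le_trans _ _ (\int[mu]_(v in `]x, x']) (cst (8 * mass_const)%:E) v)%E).
  by apply: le_int => v _; [exact: slice_ge0|exact: slice_le].
rewrite integral_cst//= lebesgue_measure_itv /= lte_fin.
case: ifPn => [_|]; first by rewrite -EFinB -EFinM.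
by rewrite mule0 lee_fin !mulr_ge0// subr_ge0.
Qed.

End uniform_estimates.

(** * Integrals against a density concentrated near the curve *)

Section density_approximation.
Context {R : realType}.
Local Notation mu := (@lebesgue_measure R).
Local Notation mu2 := ((@lebesgue_measure R) \x (@lebesgue_measure R))%E.
Variables (alpha : R) (f : R -> R -> R) (L c : R).
Hypotheses (mf : measurable_fun [set: R * R] (fun p : R * R => f p.1 p.2))
  (f0 : forall y v, 0 <= f y v) (fout : forall y v, v <= 0 -> f y v = 0)
  (fL : (\int[mu]_v \int[mu]_y (f y v)%:E <= L%:E)%E)
  (fc : (\int[mu]_v \int[mu]_y (Num.min 1 `|y - v `^ alpha| * f y v)%:E <= c%:E)%E).

Let P (p : measurableTypeR R * measurableTypeR R) : R := f p.1 p.2.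

Let mP : measurable_fun setT P. Proof. exact: mf. Qed.

Let int_prod (g : R -> R -> R) : measurable_fun [set: R * R] (fun p : R * R => g p.1 p.2) ->
  (forall y v, 0 <= g y v) ->
  (\int[mu2]_p (g p.1 p.2)%:E = \int[mu]_v \int[mu]_y (g y v)%:E)%E.
Proof.
move=> mg g0.
have mg' : measurable_fun [set: measurableTypeR R * measurableTypeR R]
    (fun p : measurableTypeR R * measurableTypeR R => (g p.1 p.2)%:E).
  by apply/measurable_EFinP; exact: mg.
by rewrite (fubini_tonelli2 (m1 := mu) (m2 := mu) _ mg')// => p; rewrite lee_fin.
Qed.

Let iP : mu2.-integrable setT (EFin \o P).
Proof.
apply/integrableP; split; first exact/measurable_EFinP.
rewrite [ltLHS](_ : _ = \int[mu]_v \int[mu]_y (f y v)%:E)%E.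
  exact: le_lt_trans fL (ltry _).
rewrite -int_prod//; apply: eq_integral => p _.
by rewrite /= ger0_norm//; exact: f0.
Qed.

Let dist (p : measurableTypeR R * measurableTypeR R) : R :=
  Num.min 1 `|p.1 - p.2 `^ alpha|.

Let dist01 p : 0 <= dist p <= 1.
Proof. by rewrite le_min ler01 normr_ge0 ge_min lexx. Qed.

Let mdist : measurable_fun setT dist.
Proof.
apply: measurable_minr => //; apply: measurableT_comp => //.
apply: measurable_funB => //.
exact: (measurableT_comp (measurable_powR alpha)).
Qed.

(** Integrals against a density that is close to the curve [y = v `^ alpha], in the
    sense of [fc], only see the cumulative mass in [v]. *)
Lemma density_approximation (phi : R * R -> R) (M delta C : R) (s : seq (R * R)) :
  measurable_fun halfplane phi -> (forall p, halfplane p -> `|phi p| <= M) ->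
  0 <= delta -> 0 <= C ->
  (forall y v, 0 < v -> `|phi (y, v) - step s v| <= delta + C * Num.min 1 `|y - v `^ alpha|) ->
  exists r : R, (\int[mu]_y \int[mu]_(v in halfline) (f y v * phi (y, v))%:E = r%:E)%E
    /\ `|r - \sum_(i <- s) i.1 * fine (\int[mu]_(v in `]0%R, i.2]) \int[mu]_y (f y v)%:E)%E|
      <= delta * L + C * c.
Proof.
move=> mphi phiM d0 C0 phis.
pose phi0 : measurableTypeR R * measurableTypeR R -> R := phi \_ halfplane.
have mhp : measurable (@halfplane R).
  by apply: measurableX => //; exact: measurable_itv.
have mphi0 : measurable_fun setT phi0.
  by apply/(measurable_restrict phi mhp measurableT); rewrite setTI.
have hpE (y v : R) : 0 < v -> (y, v) \in halfplane.
  by move=> v0; rewrite inE; split => //; rewrite /halfline /= in_itv/= andbT.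
have Ppos p : P p != 0 -> 0 < p.2.
  by move=> Pp; rewrite ltNge; apply: contra Pp => /fout h; apply/eqP; exact: h.
have phi0M p : P p != 0 -> `|phi0 p| <= M.
  move=> /Ppos p0; rewrite /phi0 /patch; case: p p0 => y v /= v0.
  by rewrite hpE//; apply: phiM; exact/set_mem/hpE.
have i1 := integrable_weighted mP (fun p => f0 p.1 p.2) iP mphi0 phi0M.
exists (\int[mu2]_p (P p * phi0 p)); split.
  rewrite [RHS]fineK; last exact: (integrable_fin_num measurableT i1).
  rewrite -(integral12_prod_meas1 i1); apply: eq_integral => y _.
  rewrite /fubini_F [LHS]integral_mkcond; apply: eq_integral => v _.
  rewrite /patch /=; case: ifPn.
    rewrite inE /halfline /= in_itv/= andbT => v0.
    by rewrite /P /phi0 /patch /= hpE.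
  rewrite notin_setE /halfline /= in_itv/= andbT => /negP; rewrite -leNgt => v0.
  by rewrite /P fout// mul0r.
have sE i : \int[mu2]_p (P p * (p.2 <= i)%R%:R) =
    fine (\int[mu]_(v in `]0%R, i]) \int[mu]_y (f y v)%:E)%E.
  congr fine.
  have mb : measurable_fun setT (fun p : R * R => (p.2 <= i)%R%:R : R).
    apply: (measurableT_comp (f := fun b : bool => (b%:R : R))) => //.
    exact: measurable_fun_ler.
  rewrite (@int_prod (fun y v => f y v * (v <= i)%R%:R)); last 2 first.
  - exact: measurable_funM.
  - by move=> y v; rewrite mulr_ge0//; have /andP[] := @bool01 R (v <= i).
  rewrite [RHS]integral_mkcond; apply: eq_integral => v _.
  rewrite /patch; case: ifPn.
    rewrite inE /= in_itv/= => /andP[_ ->].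
    by apply: eq_integral => y _; rewrite mulr1.
  rewrite notin_setE /= in_itv/= => /negP; rewrite negb_and => /orP[|/negbTE ->].
    by rewrite -leNgt => v0; apply: integral0_eq => y _; rewrite fout// mul0r.
  by apply: integral0_eq => y _; rewrite mulr0.
under eq_bigr do rewrite -sE.
pose e p := delta + C * dist p.
have me : measurable_fun setT e by apply: measurable_funD => //; exact: measurable_funM.
have e0 p : 0 <= e p by have /andP[h _] := dist01 p; rewrite addr_ge0// mulr_ge0.
have eM p : P p != 0 -> `|e p| <= delta + C.
  by move=> _; have /andP[h1 h2] := dist01 p; rewrite ger0_norm// lerD2l ler_piMr.
have ie := integrable_weighted mP (fun p => f0 p.1 p.2) iP me eM.
have mt2 : measurable_fun setT (snd : measurableTypeR R * measurableTypeR R -> measurableTypeR R).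
  exact: measurable_snd.
apply: le_trans (@step_approximation R _ _ mu2 P snd phi0 M mP (fun p => f0 p.1 p.2)
   iP mt2 mphi0 phi0M s e ie _) _.
  move=> [y v] /Ppos /= v0; rewrite /phi0 /patch hpE//; exact: phis.
have ied : mu2.-integrable setT (EFin \o (fun p => P p * dist p)).
  have d1 p : P p != 0 -> `|dist p| <= 1.
    by move=> _; have /andP[h1 h2] := dist01 p; rewrite ger0_norm.
  exact: (integrable_weighted mP (fun p => f0 p.1 p.2) iP mdist d1).
rewrite [leLHS](_ : _ = delta * \int[mu2]_p P p + C * \int[mu2]_p (P p * dist p)); last first.
  rewrite -RintegralZl// -RintegralZl// -RintegralD//.
  - by apply: eq_Rintegral => p _; rewrite /e; ring.
  - exact: (integrableZl measurableT delta iP).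
  - exact: (integrableZl measurableT C ied).
apply: lerD; apply: ler_wpM2l => //; rewrite -lee_fin fineK.
- by rewrite int_prod.
- exact: (integrable_fin_num measurableT iP).
- rewrite (@int_prod (fun y v => f y v * Num.min 1 `|y - v `^ alpha|)).
  + apply: le_trans fc; apply: le_int => v _.
      by apply: integral_ge0 => y _; rewrite lee_fin mulr_ge0// le_min ler01 normr_ge0.
    apply: le_int => y _; last by rewrite mulrC.
    by rewrite lee_fin mulr_ge0// le_min ler01 normr_ge0.
  + exact: measurable_funM.
  + by move=> y v; rewrite mulr_ge0// le_min ler01 normr_ge0.
- exact: (integrable_fin_num measurableT ied).
Qed.

End density_approximation.

(** * Functions vanishing at infinity *)

Section vanishing_functions.
Context {R : realType}.

Section uniform.
Context {T : pseudoMetricType R}.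
Variables (X : set T) (phi : T -> R).
Hypothesis vphi : vanishing X phi.

Lemma vanishing_bounded : exists M, forall x, X x -> `|phi x| <= M.
Proof.
have [cphi /(_ 1 ltr01)[C [cC CX small]]] := vphi.
have /compact_near_coveringP nC := cC.
have : \forall M \near +oo, C `<=` [set x | X x -> `|phi x| <= M].
  apply: nC => x Cx.
  have cx := (subspace_continuousP _ _).1 cphi x (CX x Cx).
  have : \forall y \near within X (nbhs x), `|phi x - phi y| < 1.
    by move/cvgrPdist_lt : cx; exact.
  rewrite near_withinE => nx.
  exists ([set y | X y -> `|phi x - phi y| < 1], [set M | `|phi x| + 1 <= M]).
    split => //=; exists (`|phi x| + 1); split; first exact: num_real.
    by move=> M /ltW.
  move=> [y M] /= [h hM] Xy.
  have := h Xy; rewrite distrC => h1.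
  have := ler_normD (phi y - phi x) (phi x); rewrite subrK => h2; lra.
move=> [M0 [_ hM]]; exists (Num.max 1 (M0 + 1)) => x Xx; rewrite le_max.
have [Cx|Cx] := pselect (C x); last by rewrite (ltW (small x Xx Cx)).
by apply/orP; right; apply: (hM (M0 + 1)) => //; rewrite ltrDl.
Qed.

(** Compactness gives a modulus valid near the compact set outside of which the
    function is small; outside, the two values are small. *)
Lemma vanishing_uniform (d : R) : 0 < d -> exists2 e : R, 0 < e &
  forall x y, X x -> X y -> ball x e y -> `|phi x - phi y| < d.
Proof.
move=> d0; have d20 : 0 < d / 2 by rewrite divr_gt0.
have [cphi /(_ _ d20)[C [cC CX small]]] := vphi.
have /compact_near_coveringP nC := cC.
have : \forall e \near 0^'+, C `<=` [set x | forall y, X x -> X y ->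
    ball x e y -> `|phi x - phi y| < d].
  apply: nC => x Cx.
  have cx := (subspace_continuousP _ _).1 cphi x (CX x Cx).
  have : \forall y \near within X (nbhs x), `|phi x - phi y| < d / 2.
    by move/cvgrPdist_lt : cx; exact.
  rewrite near_withinE => /nbhs_ballP[r /= r0 xr].
  exists (ball x (r / 2), [set e | e < r / 2]).
    split; first by apply: nbhsx_ballx; rewrite divr_gt0.
    by apply: nbhs_right_lt; rewrite divr_gt0.
  move=> [x' e] /= [bx' er] y Xx' Xy bxy.
  have h1 : `|phi x - phi x'| < d / 2.
    by apply: xr => //; apply: le_ball bx'; rewrite ler_pdivrMr// ler_pMr// ler1n.
  have h2 : `|phi x - phi y| < d / 2.
    apply: xr => //; rewrite [r]splitr; apply: ball_triangle bx' _.
    by apply: le_ball bxy; exact: ltW.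
  have := ler_normD (phi x' - phi x) (phi x - phi y).
  by rewrite addrA subrK (distrC (phi x') (phi x)) => h; lra.
move=> nE; near (0 : R)^'+ => e; exists e => // x y Xx Xy bxy.
have CE : C `<=` [set x | forall y, X x -> X y -> ball x e y -> `|phi x - phi y| < d].
  by near: e.
have [Cx|Cx] := pselect (C x); first exact: CE.
have [Cy|Cy] := pselect (C y).
  by rewrite distrC; apply: (CE y Cy) => //; exact: ball_sym.
have := ler_normB (phi x) (phi y); have := small x Xx Cx; have := small y Xy Cy.
lra.
Unshelve. all: by end_near. Qed.

End uniform.

(** Steps narrower than the modulus of uniform continuity, on an interval of the
    half-line outside of which the function is small. *)
Lemma vanishing_step (g : R -> R) (d : R) : vanishing halfline g -> 0 < d ->
  exists s, forall v, 0 < v -> `|g v - step s v| <= d.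
Proof.
move=> vg d0; have [e e0 ge] := vanishing_uniform vg d0.
have [_ /(_ _ d0)[C [cC CX small]]] := vg.
have hl v : halfline v = (0 < v) :> Prop by rewrite /halfline /= in_itv/= andbT.
have /compact_near_coveringP nC := cC.
have [a a0 Ca] : exists2 a : R, 0 < a & forall x, C x -> a < x.
  have nE : \forall a \near 0^'+, C `<=` [set x | a < x].
    apply: nC => x /CX; rewrite hl => x0.
    exists ([set y | x / 2 < y], [set a | a < x / 2]).
      split; first by apply: lt_nbhsr; rewrite ltr_pdivrMr// ltr_pMr// ltr1n.
      by apply: nbhs_right_lt; rewrite divr_gt0.
    by move=> [y a] /= [h1 h2]; exact: lt_trans h1.
  near (0 : R)^'+ => a; exists a => //.
  have aE : C `<=` [set x | a < x] by near: a.
  exact: aE.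
have [B CB] : exists B : R, forall x, C x -> x < B.
  have nE : \forall B \near +oo, C `<=` [set x | x < B].
    apply: nC => x _.
    exists ([set y | y < x + 1], [set B | x + 1 <= B]).
      split; first by apply: lt_nbhsl; rewrite ltrDl.
      by exists (x + 1); split; [exact: num_real|move=> M /ltW].
    by move=> [y b] /= [h1 h2]; exact: lt_le_trans h2.
  near +oo_R => B; exists B.
  have aE : C `<=` [set x | x < B] by near: B.
  exact: aE.
have goff v : 0 < v -> v <= a \/ B <= v -> `|g v| < d.
  move=> v0 vaB; apply: small; first by rewrite hl.
  by move=> Cv; have := Ca v Cv; have := CB v Cv; case: vaB; lra.
pose x n : R := a + n%:R * (e / 2).
have e20 : 0 < e / 2 by rewrite divr_gt0.
have xS n : x n.+1 = x n + e / 2 by rewrite /x -natr1; ring.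
have steps : forall n, exists s, forall v, 0 < v ->
    (v <= x n -> `|g v - step s v| <= d) /\ (x n < v -> step s v = 0).
  elim=> [|n [s IH]].
    exists [::] => v v0; rewrite /step big_nil subr0 /x mul0r addr0; split=> // va.
    by apply/ltW/goff => //; left.
  exists ((g (x n.+1), x n.+1) :: (- g (x n.+1), x n) :: s) => v v0.
  have [IH1 IH2] := IH v v0; rewrite !step_cons /=.
  have xx : x n < x n.+1 by rewrite xS ltrDl.
  split=> [vx|xv]; last first.
    by rewrite leNgt xv leNgt (lt_trans xx xv) /= IH2 ?(lt_trans xx)//; ring.
  rewrite vx mulr1; have [vn|vn] := leP v (x n).
    by rewrite mulr1 addrA subrr add0r IH1.
  rewrite mulr0 add0r IH2// addr0 ltW// ge ?hl//.
    exact: lt_le_trans vx.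
  rewrite /ball /= /ball_ /= distrC ger0_norm ?subr_ge0//.
  by move: vn; rewrite xS; lra.
pose n := (Num.trunc ((B - a) / (e / 2))).+1.
have Bn : B <= x n.
  have : (B - a) / (e / 2) < n%:R by exact: truncnS_gt.
  by rewrite ltr_pdivrMr// /x; lra.
have [s hs] := steps n; exists s => v v0; have [h1 h2] := hs v v0.
have [vn|vn] := leP v (x n); first exact: h1.
by rewrite h2// subr0 ltW//; apply: goff => //; right; apply: ltW; exact: le_lt_trans vn.
Unshelve. all: by end_near. Qed.

(** Uniform continuity handles the points near the curve; away from it, twice the
    bound of [phi] is absorbed by the second term. *)
Lemma vanishing_modulus (phi : R * R -> R) (alpha d : R) :
  vanishing halfplane phi -> 0 < d ->
  exists2 C : R, 0 <= C & forall y v, 0 < v ->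
    `|phi (y, v) - phi (v `^ alpha, v)| <= d + C * Num.min 1 `|y - v `^ alpha|.
Proof.
move=> vphi d0; have [e e0 phie] := vanishing_uniform vphi d0.
have [M hM] := vanishing_bounded vphi.
have hp (y v : R) : 0 < v -> halfplane (y, v).
  by move=> v0; split => //; rewrite /halfline /= in_itv/= andbT.
have M0 : 0 <= M by apply: le_trans (hM (0, 1) (hp _ _ ltr01)).
pose r := Num.min 1 e; have r0 : 0 < r by rewrite lt_min ltr01.
exists (2 * M / r); first by rewrite divr_ge0 ?mulr_ge0// ltW.
move=> y v v0; set z := `|y - v `^ alpha|.
have z0 : 0 <= Num.min 1 z by rewrite le_min ler01 normr_ge0.
have [ze|ze] := ltP z e.
  apply: (@le_trans _ _ d); last by rewrite lerDl mulr_ge0// divr_ge0 ?mulr_ge0// ltW.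
  apply/ltW/phie; [exact: hp|exact: hp|split => /=; last exact: ballxx].
  by rewrite /ball /= /ball_ /=.
have rz : r <= Num.min 1 z by rewrite le_min /r !ge_min lexx ze orbT.
apply: (@le_trans _ _ (2 * M)).
  apply: le_trans (ler_normB _ _) _.
  by have := hM _ (hp y v v0); have := hM _ (hp (v `^ alpha) v v0); lra.
apply: (@le_trans _ _ (2 * M / r * Num.min 1 z)); last by rewrite lerDr ltW.
by rewrite -mulrA ler_peMr ?mulr_ge0// mulrC ler_pdivlMr// mul1r.
Qed.

(** The projection on the second axis of a compact set of the half-plane is a
    compact set of the half-line. *)
Lemma vanishing_trace (phi : R * R -> R) (alpha : R) :
  vanishing halfplane phi -> vanishing halfline (fun v => phi (v `^ alpha, v)).
Proof.
move=> [cphi small].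
have hl v : halfline v = (0 < v) :> Prop by rewrite /halfline /= in_itv/= andbT.
split.
  apply/subspace_continuousP => v hv.
  have hpv : halfplane (v `^ alpha, v) by split.
  have cp := (subspace_continuousP _ _).1 cphi _ hpv.
  apply: (cvg_comp _ phi _ cp) => A /=; rewrite /within /=.
  have cv : (fun v : R => (v `^ alpha, v)) x @[x --> v] --> (v `^ alpha, v).
    have v0 : 0 < v by rewrite -hl.
    have c1 : x `^ alpha @[x --> v] --> v `^ alpha by exact: powR_continuous_gt0.
    have c2 : x @[x --> v] --> v by exact: cvg_id.
    exact: (cvg_pair c1 c2).
  move=> hA; have := cv _ hA; rewrite /= !nbhs_simpl /=.
  by apply: filterS => x hx hlx; apply: hx; split.
move=> d d0; have [C [cC CX Cs]] := small d d0.
exists (snd @` C); split.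
- apply: continuous_compact => //; apply: continuous_subspaceT => p.
  exact: cvg_snd.
- by move=> _ [p /CX[_ h] <-].
- move=> v hv nC; apply: Cs; first by split.
  by move=> Cv; apply: nC; exists (v `^ alpha, v).
Qed.

(** The measurable structure of the plane is the product one, so an open set has to be
    written as a countable union of boxes. *)
Lemma open_measurable_plane (U : set (R * R)) : open U -> measurable U.
Proof.
move=> oU.
pose box (q : rat * rat * rat) : set (R * R) :=
  ball (ratr q.1.1 : R) (ratr q.2) `*` ball (ratr q.1.2 : R) (ratr q.2).
pose F q := if pselect (box q `<=` U) then box q else set0.
have -> : U = \bigcup_q F q.
  apply/seteqP; split=> [[x y] Uxy|p [q _]]; last first.
    by rewrite /F; case: pselect => // qU /qU.
  have /nbhs_ballP[e /= e0 eU] := open_nbhs_nbhs (conj oU Uxy).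
  have e20 : 0 < e / 2 by rewrite divr_gt0.
  have [r] := rat_in_itvoo e20; rewrite in_itv/= => /andP[r0 re].
  have rx (z : R) : exists q : rat, ball (ratr q : R) (ratr r) z.
    have : z - ratr r < z + ratr r by rewrite ltrD2l; lra.
    move=> /rat_in_itvoo[q]; rewrite in_itv/= => /andP[h1 h2]; exists q.
    by rewrite /ball /= /ball_ /= ltr_norml; apply/andP; split; lra.
  have [[q1 h1] [q2 h2]] := (rx x, rx y).
  exists (q1, q2, r) => //; rewrite /F.
  case: (pselect (box (q1, q2, r) `<=` U)) => [qU|]; first by split.
  case=> -[a b] [/= ha hb]; apply: eU; rewrite [e]splitr.
  by split => /=; [apply: ball_triangle (ball_sym _) _|apply: ball_triangle (ball_sym _) _];
    [apply: le_ball h1|apply: le_ball ha|apply: le_ball h2|apply: le_ball hb]; exact: ltW.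
apply: countable_bigcupT_measurable; first exact: countableP.
move=> q; rewrite /F; case: (pselect (box q `<=` U)) => [qU|qU] /=.
  by apply: measurableX; exact: measurable_ball.
exact: measurable0.
Qed.

Lemma vanishing_measurable (phi : R * R -> R) :
  vanishing halfplane phi -> measurable_fun (@halfplane R) phi.
Proof.
move=> [cphi _].
apply: (measurability _ (RGenOInfty.measurableE R)) => _ [_ [a ->] <-].
apply: open_measurable_plane.
have oh : open (@halfplane R).
  rewrite (_ : halfplane = snd @^-1` (@halfline R)).
    by apply: open_comp; [move=> p _; exact: cvg_snd|exact: interval_open].
  by apply/seteqP; split => [p []|p hp]; [|split].
rewrite openE => p [hp /=]; rewrite in_itv/= andbT => ap.
have cp := (subspace_continuousP _ _).1 cphi p hp.
have : \forall q \near within halfplane (nbhs p), a < phi q.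
  exact: (cvgr_gt _ cp).
rewrite near_withinE => n1; have n2 := open_nbhs_nbhs (conj oh hp).
rewrite /interior; apply: filterS2 n1 n2 => q h hq; split => //=.
by rewrite in_itv/= andbT; exact: h.
Qed.

Lemma vanishing_measurable_halfline (g : R -> R) :
  vanishing halfline g -> measurable_fun (@halfline R) g.
Proof.
by move=> [cg _]; apply: subspace_continuous_measurable_fun => //; exact: measurable_itv.
Qed.

End vanishing_functions.

(** * Measures with a Lipschitz cumulative function *)

Section stieltjes.
Context {R : realType}.
Local Notation leb := (@lebesgue_measure R).

Lemma measure_bigcup_le (mu : {measure set R -> \bar R}) (I : (set R)^nat) (c : \bar R) :
  (forall n, measurable (I n)) -> (forall m n, (m <= n)%N -> I m `<=` I n) ->
  (forall n, mu (I n) <= c)%E -> (mu (\bigcup_n I n) <= c)%E.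
Proof.
move=> mI ndI Ic.
have cv : mu (I n) @[n --> \oo] --> mu (\bigcup_n I n).
  apply: nondecreasing_cvg_mu => //; first exact: bigcupT_measurable.
  by move=> m n mn; apply/subsetPset; exact: ndI.
rewrite -(cvg_lim _ cv)//; apply: lime_le; first by apply/cvg_ex; eexists; exact: cv.
by near=> n.
Unshelve. all: by end_near. Qed.

(** The Lipschitz bound compares, interval by interval, the covers that define both
    outer measures, whence the domination by the Lebesgue measure, from which
    regularity will be inherited. *)
Lemma stieltjes_measure (f : R -> R) (L B : R) : 0 < L ->
  (forall x y, x <= y -> f x <= f y <= f x + L * (y - x)) ->
  (forall x, x <= 0 -> f x = 0) -> (forall x, f x <= B) ->
  exists mu : {measure set R -> \bar R},
    [/\ mu (~` halfline) = 0%E, forall x, mu `]0, x]%classic = (f x)%:E,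
      (mu halfline <= B%:E)%E &
      forall A, measurable A -> (mu A <= L%:E * leb A)%E].
Proof.
move=> L0 flip f0 fB.
have ndf : nondecreasing f by move=> x y /flip /andP[].
have rcf : forall x, f @ at_right x --> f x.
  move=> x; apply/cvgrPdist_lt => e e0; near=> y.
  have xy : x < y by near: y; exact: nbhs_right_gt.
  have /andP[h1 h2] := flip x y (ltW xy).
  rewrite distrC ger0_norm ?subr_ge0//.
  have : y < x + e / L by near: y; apply: nbhs_right_lt; rewrite ltrDl divr_gt0.
  by rewrite -ltrBlDl ltr_pdivlMr// mulrC; lra.
pose F : cumulative R R := HB.pack f (isCumulative.Build R _ R f ndf rcf).
pose mu0 := lebesgue_stieltjes_measure F.
have mid : measurable_fun setT (idfun : measurableTypeR R -> R).
  exact: measurable_id.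
(* The image under the identity lives on the canonical Borel structure of [R]. *)
pose mu : {measure set R -> \bar R} := image_measure mu0 mid.
have muE A : mu A = mu0 A by [].
have muI a b : a <= b -> mu `]a, b]%classic = (f b - f a)%:E.
  move=> ab; apply: etrans (measurable_mu_extE (wlength F) (is_ocitv a b)) _.
  exact: wlength_itv_bnd.
have mh : measurable (@halfline R) by exact: measurable_itv.
exists mu; split.
- have E : ~` (@halfline R) = \bigcup_n `](- n%:R), 0]%classic.
    apply/seteqP; split => x /=; rewrite /halfline /= in_itv/= andbT.
      move/negP; rewrite -leNgt => x0; exists (Num.trunc (- x)).+1 => //=.
      by rewrite in_itv/= x0 andbT ltrNl truncnS_gt.
    by move=> [n _ /=]; rewrite in_itv/= => /andP[_ h]; apply/negP; rewrite -leNgt.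
  rewrite E; apply/eqP; rewrite eq_le measure_ge0 andbT.
  have mI n : measurable (`](- n%:R), 0]%classic : set R) by exact: measurable_itv.
  apply: measure_bigcup_le => // [m n mn x|n].
    rewrite /= !in_itv/= => /andP[+ ->]; rewrite andbT; apply: le_lt_trans.
    by rewrite lerN2 ler_nat.
  by rewrite muI ?oppr_le0// !f0 ?oppr_le0// subrr.
- move=> x; have [x0|x0] := leP 0 x; first by rewrite muI// (f0 0)// subr0.
  rewrite f0 ?ltW//; rewrite set_itv_ge ?measure0// bnd_simp -leNgt; exact: ltW.
- have E : @halfline R = \bigcup_n `]0, n%:R]%classic.
    apply/seteqP; split => x /=; rewrite /halfline /= in_itv/= andbT.
      move=> x0; exists (Num.trunc x).+1 => //=.
      by rewrite in_itv/= x0 ltW// truncnS_gt.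
    by move=> [n _ /=]; rewrite in_itv/= => /andP[].
  have mI n : measurable (`]0, n%:R]%classic : set R) by exact: measurable_itv.
  rewrite E; apply: measure_bigcup_le => // [m n mn x|n].
    by rewrite /= !in_itv/= => /andP[-> /le_trans]; apply; rewrite ler_nat.
  by rewrite muI// lee_fin (f0 0)// subr0.
- move=> A mA; rewrite -lee_pdivrMl//.
  rewrite muE; apply/le_ereal_inf_tmp => _ [C [mC AC] <-].
  rewrite lee_pdivrMl// -nneseriesZl; last by move=> i _; exact: wlength_ge0.
  apply: (@le_trans _ _ (\sum_(k <oo) wlength f (C k))%E).
    by apply: ereal_inf_lbound; exists C.
  apply: lee_nneseries => [k _ _|k _]; first exact: (wlength_ge0 F).
  have [[a b] _ <-] := mC k; have [ab|ab] := leP a b.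
    have w1 := wlength_itv_bnd f false false ab.
    have w2 := wlength_itv_bnd idfun false false ab.
    rewrite [leLHS]w1 [X in (_ * X)%E]w2 -EFinM lee_fin /=.
    by have /andP[_] := flip a b ab; lra.
  rewrite /= (_ : `]a, b]%classic = set0) ?wlength0 ?mule0//.
  by rewrite set_itv_ge// bnd_simp -leNgt ltW.
Unshelve. all: by end_near. Qed.

(** Domination transfers the inner regularity of the Lebesgue measure: a compact
    subset that misses little Lebesgue measure misses little mass. *)
Lemma finite_radon_dominated (mu : {measure set R -> \bar R}) (L B : R) : 0 < L ->
  mu (~` halfline) = 0%E -> (mu halfline <= B%:E)%E ->
  (forall A, measurable A -> (mu A <= L%:E * leb A)%E) ->
  finite_radon (@compact R) halfline mu.
Proof.
move=> L0 mu0 muB dom; split=> //; first exact: le_lt_trans muB (ltry _).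
move=> D mD _; apply/eqP; rewrite eq_le; apply/andP; split; last first.
  apply: ge_ereal_sup => _ [C [cC CD] <-].
  by apply: le_measure => //; rewrite inE//; exact: compact_measurable.
set S := ereal_sup _.
pose I n : set R := `[(- n%:R), n%:R]%classic.
have ndI m n : (m <= n)%N -> I m `<=` I n.
  move=> mn x; rewrite /I /= !in_itv/= => /andP[h1 h2].
  have mnR : m%:R <= n%:R :> R by rewrite ler_nat.
  by apply/andP; split; [apply: le_trans h1; rewrite lerN2|exact: le_trans mnR].
have mI n : measurable (I n) by exact: measurable_itv.
have mDI n : measurable (D `&` I n) by exact: measurableI.
have E : D = \bigcup_n (D `&` I n).
  rewrite -setI_bigcupr; apply/seteqP; split => x; last by case.
  move=> Dx; split=> //; exists (Num.trunc `|x|).+1 => //=.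
  by rewrite /I /= in_itv/= -ler_norml ltW// truncnS_gt.
rewrite [in leLHS]E; apply: measure_bigcup_le => // [m n mn|n].
  by apply: setIS; exact: ndI.
apply/lee_addgt0Pr => e e0.
have fin : (leb (D `&` I n) < +oo)%E.
  apply: (@le_lt_trans _ _ (leb (I n))).
    apply: le_measure; [by rewrite inE; exact: mDI|by rewrite inE; exact: mI|].
    exact: subIsetr.
  rewrite /I /= lebesgue_measure_itv/=; by case: ifP => _; rewrite ?ltry.
have eL0 : 0 < e / L by rewrite divr_gt0.
have [C [cC CD small]] := lebesgue_regularity_inner (mDI n) fin eL0.
have mC : measurable C by exact: compact_measurable.
have -> : mu (D `&` I n) = (mu C + mu ((D `&` I n) `\` C))%E.
  rewrite -measureU//; first by rewrite setDUK.
    exact: measurableD.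
  by rewrite setDE setICA setICr setI0.
apply: leeD.
  by apply: ereal_sup_ubound; exists C => //; split=> // x /CD[].
apply: le_trans (dom _ _) _; first exact: measurableD.
rewrite -lee_pdivlMl// -EFinM mulrC; exact: ltW.
Qed.

End stieltjes.

(** * Extraction of a sequence *)

Section extraction.
Context {R : realType}.

Definition rational_point (n : nat) : R * R :=
  if (unpickle n : option (rat * rat)) is Some q then (ratr q.1, ratr q.2) else (0, 0).

Lemma rational_point_dense (x t d : R) : 0 < d ->
  exists n, `|x - (rational_point n).1| < d /\ `|t - (rational_point n).2| < d.
Proof.
move=> d0; have near_rat (z : R) : exists q : rat, `|z - ratr q| < d.
  have /rat_in_itvoo[q] : z - d < z + d by rewrite ltrD2l; lra.
  by rewrite in_itv/= => /andP[h1 h2]; exists q; rewrite ltr_norml; apply/andP; split; lra.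
have [[a ha] [b hb]] := (near_rat x, near_rat t).
by exists (pickle (a, b)); rewrite /rational_point pickleK.
Qed.

Lemma ultra_fmap (X Y : Type) (f : X -> Y) (U : set_system X) :
  UltraFilter U -> UltraFilter (f @ U).
Proof.
move=> UU; split=> [|G FG UG]; first exact: fmap_proper_filter; apply/seteqP; split=> [A GA|]; last exact: UG.
have [//|UnA] := in_ultra_setVsetC (f @^-1` A) UU.
have : G (A `&` ~` A) by apply: filterI => //; exact: UG.
by rewrite setICr => /filter_not_empty.
Qed.

(** An ultrafilter of parameters tending to 0 gives the limit [p] at every point
    at once; only then is a sequence chosen, the n-th term being close to [p] at
    the first n points of a dense sequence. *)
Lemma lipschitz_extraction (Phi : R -> R -> R -> R) (e0 L : R) : 0 < e0 ->
  (forall e x t, 0 < e <= e0 -> `|Phi e x t| <= L) ->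
  (forall e x t x' t', 0 < e <= e0 ->
    `|Phi e x t - Phi e x' t'| <= L * (`|x - x'| + `|t - t'|)) ->
  exists (e : nat -> R) (p : R -> R -> R), [/\ forall n, 0 < e n <= e0,
    e n @[n --> \oo] --> (0 : R) &
    forall x t, Phi (e n) x t @[n --> \oo] --> p x t].
Proof.
move=> e00 bound lip.
have L0 : 0 <= L by apply: le_trans (bound e0 0 0 _); rewrite ?normr_ge0// e00 lexx.
have [U [UU U0]] := @ultraFilterLemma R (0^'+) _.
have Unear d : 0 < d -> U [set e | 0 < e < d].
  move=> d0; apply: U0; near=> e; apply/andP; split.
    by near: e; exact: nbhs_right_gt.
  by near: e; exact: nbhs_right_lt.
have Ue0 : U [set e | 0 < e <= e0].
  by apply: filterS (Unear _ e00) => e /= /andP[-> /ltW].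
have cvgU x t : exists p : R, Phi e x t @[e --> U] --> p.
  have := @segment_compact R (- L) L; rewrite compact_ultra /=.
  move=> /(_ (Phi e x t @[e --> U]) _) H.
  have UI : (Phi e x t @[e --> U]) `[- L, L]%classic.
    apply: (@filterS _ U _ [set e | 0 < e <= e0]) => // e he.
    by rewrite /= in_itv/= -ler_norml; exact: (bound e x t he).
  by have [p [_ hp]] := H (ultra_fmap _ UU) UI; exists p.
have [p hp] : exists p : R * R -> R, forall q, Phi e q.1 q.2 @[e --> U] --> p q.
  exists (fun q => sval (cid (cvgU q.1 q.2))) => q.
  exact: svalP (cid (cvgU q.1 q.2)).
have Uq d q : 0 < d -> U [set e | `|Phi e q.1 q.2 - p q| < d].
  move=> d0; have := hp q => /cvgrPdist_lt /(_ d d0).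
  by apply: filterS => e /=; rewrite distrC.
have Uqs d n : 0 < d ->
    U [set e | forall i, (i < n)%N ->
      `|Phi e (rational_point i).1 (rational_point i).2 - p (rational_point i)| < d].
  move=> d0; elim: n => [|n IH]; first by apply: filterS Ue0.
  apply: filterS2 IH (Uq d (rational_point n) d0) => e h1 h2 i.
  by rewrite ltnS leq_eqVlt => /orP[/eqP ->|]; [exact: h2|exact: h1].
pose d n : R := n.+1%:R^-1.
have d0 n : 0 < d n by rewrite invr_gt0.
have pick n : exists e, [/\ 0 < e <= e0, e < d n & forall i, (i < n)%N ->
    `|Phi e (rational_point i).1 (rational_point i).2 - p (rational_point i)| < d n].
  have [e [[h1 h2] /andP[_ h3]]] :=
    filter_ex (filterI (filterI Ue0 (Uqs (d n) n (d0 n))) (Unear (d n) (d0 n))).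
  by exists e.
have [e he] := choice pick.
have dto0 : d n @[n --> \oo] --> (0 : R) by exact: cvg_harmonic.
have plip q q' : `|p q - p q'| <= L * (`|q.1 - q'.1| + `|q.2 - q'.2|).
  apply/ler_addgt0Pr => c c0; have c20 : 0 < c / 2 by rewrite divr_gt0.
  have [a [[ha h1] h2]] := filter_ex (filterI (filterI Ue0 (Uq _ q c20)) (Uq _ q' c20)).
  have := lip a q.1 q.2 q'.1 q'.2 ha.
  move: h1 h2 => /=; set X := Phi a q.1 q.2; set Y := Phi a q'.1 q'.2 => h1 h2 h3.
  have -> : p q - p q' = - (X - p q) + (X - Y) + (Y - p q') by ring.
  have := ler_normD (- (X - p q) + (X - Y)) (Y - p q').
  have := ler_normD (- (X - p q)) (X - Y); rewrite normrN; lra.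
exists e, (fun x t => p (x, t)); split.
- by move=> n; have [] := he n.
- apply: (@squeeze_cvgr _ _ _ _ (cst 0) d) => //; last exact: cvg_cst.
  by near=> n; have [/andP[h _] h2 _] := he n; rewrite !ltW.
move=> x t; apply/cvgrPdist_lt => c c0.
pose r := c / 4 / (2 * L + 1).
have r0 : 0 < r by rewrite divr_gt0 ?divr_gt0//; lra.
have [i [h1 h2]] := rational_point_dense x t r0.
set q := rational_point i in h1 h2.
have rL : L * (`|x - q.1| + `|t - q.2|) <= c / 4.
  have : `|x - q.1| + `|t - q.2| <= 2 * r by lra.
  move=> /(ler_wpM2l L0) /le_trans; apply.
  have -> : c / 4 = r * (2 * L + 1) by rewrite /r divfK//; lra.
  by have := ltW r0; nra.
near=> n.
have [en _ hn] := he n.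
have ni : (i < n)%N by near: n; exact: nbhs_infty_gt.
have dn : d n < c / 4.
  near: n; have c4 : 0 < c / 4 by rewrite divr_gt0.
  have := dto0 => /cvgrPdist_lt /(_ _ c4); apply: filterS => n.
  by rewrite sub0r normrN; exact: le_lt_trans (ler_norm _).
have h3 := hn i ni; have h4 := lip (e n) x t q.1 q.2 en; have h5 := plip (x, t) q.
move: h3 h4 h5; rewrite -/q /=; set X := Phi (e n) x t; set Y := Phi (e n) q.1 q.2.
move=> h3 h4 h5.
have -> : p (x, t) - X = (p (x, t) - p q) - (X - Y) - (Y - p q) by ring.
have := ler_normB (p (x, t) - p q - (X - Y)) (Y - p q).
have := ler_normB (p (x, t) - p q) (X - Y); lra.
Unshelve. all: by end_near. Qed.

End extraction.

(** * Limit measures *)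

Section limit_measures.
Context {R : realType}.
Variables (f : R -> R) (B : R) (mu : {measure set R -> \bar R}).
Hypotheses (mu_cumul : forall x, mu `]0, x]%classic = (f x)%:E)
  (mu_le : (mu halfline <= B%:E)%E).

Let halflineE (v : R) : halfline v = (0 < v) :> Prop.
Proof. by rewrite /halfline /= in_itv/= andbT. Qed.

Let mhl : measurable (@halfline R). Proof. exact: measurable_itv. Qed.

(** The mass of the half-line controls the error, and the integral of a step
    function is a combination of values of the cumulative function. *)
Lemma measure_step_approximation (g : R -> R) (d : R) (s : seq (R * R)) :
  vanishing halfline g -> (forall v, 0 < v -> `|g v - step s v| <= d) ->
  exists r : R, (\int[mu]_(v in halfline) (g v)%:E = r%:E)%E /\
    `|r - \sum_(i <- s) i.1 * f i.2| <= d * B.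
Proof.
move=> vg gs; have mg := vanishing_measurable_halfline vg.
have [M gM] := vanishing_bounded vg.
have d0 : 0 <= d by exact: le_trans (gs 1 ltr01).
pose P : R -> R := \1_halfline.
pose g0 : R -> R := g \_ halfline.
have PE v : P v = (v \in halfline)%:R by rewrite /P indicE.
have Pin v : P v != 0 -> halfline v.
  by rewrite PE; have [/set_mem//|] := boolP (v \in halfline); rewrite eqxx.
have P0 v : 0 <= P v by rewrite PE ler0n.
have mP : measurable_fun setT P by exact: measurable_indic.
have iP : mu.-integrable setT (EFin \o P).
  apply/integrableP; split; first exact/measurable_EFinP.
  rewrite (eq_integral (fun v => (\1_halfline v)%:E)) => [|v _]; last first.
    by rewrite /= ger0_norm ?P0.
  by rewrite integral_indic// setIT; exact: le_lt_trans mu_le (ltry _).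
have mg0 : measurable_fun setT g0.
  by apply/(measurable_restrict g mhl measurableT); rewrite setTI.
have g0M v : P v != 0 -> `|g0 v| <= M.
  by move=> /Pin hv; rewrite /g0 patchE mem_set//; exact: gM.
have iPd : mu.-integrable setT (EFin \o (fun p => P p * d)).
  apply: (integrable_weighted mP P0 iP (f := cst d) (c := d)) => //.
  by move=> v _; rewrite ger0_norm.
have approx := @step_approximation R _ _ mu P id g0 M mP P0 iP
  (@measurable_id _ _ _) mg0 g0M s (cst d) iPd _.
have iPg := integrable_weighted mP P0 iP mg0 g0M.
exists (\int[mu]_p (P p * g0 p)); split.
  rewrite /Rintegral fineK; last exact: integrable_fin_num.
  rewrite [LHS]integral_mkcond; apply: eq_integral => v _.
  rewrite patchE /g0 PE patchE; case: ifP => _; last by rewrite mul0r.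
  by rewrite mul1r.
have muh : \int[mu]_p P p = fine (mu halfline) by rewrite /Rintegral integral_indic// setIT.
have bound : \int[mu]_p (P p * cst d p) <= d * B.
  rewrite (RintegralZr d measurableT iP) muh mulrC ler_wpM2l// -lee_fin fineK//.
  by rewrite ge0_fin_numE//; exact: le_lt_trans mu_le (ltry _).
have low x : \int[mu]_p (P p * (id p <= x)%R%:R) = f x.
  rewrite -[RHS]/(fine (f x)%:E) -mu_cumul /Rintegral; congr fine.
  have := @integral_indic _ _ _ mu setT measurableT `]0, x]%classic (measurable_itv _).
  rewrite setIT => <-.
  apply: eq_integral => v _; congr EFin; rewrite PE indicE.
  have -> : (v \in halfline) = (0 < v).
    by apply/idP/idP; rewrite inE halflineE.
  have -> : (v \in `]0, x]%classic) = (0 < v) && (v <= x).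
    by apply/idP/idP; rewrite inE /= in_itv.
  by rewrite -natrM mulnb.
have := @step_approximation R _ _ mu P id g0 M mP P0 iP
  (@measurable_id _ _ _) mg0 g0M s (cst d) iPd _.
under eq_bigr do rewrite low.
move=> H; apply: le_trans bound; apply: H => v /Pin hv.
by rewrite /g0 patchE mem_set//; apply: gs; rewrite -halflineE.
Qed.

End limit_measures.

Section moving_measures.
Context {R : realType}.

Lemma sum_step_lipschitz (p : R -> R -> R) (L : R) (s : seq (R * R)) t t' :
  (forall x, `|p x t - p x t'| <= L * `|t - t'|) ->
  `|\sum_(i <- s) i.1 * p i.2 t - \sum_(i <- s) i.1 * p i.2 t'| <=
    (\sum_(i <- s) `|i.1|) * L * `|t - t'|.
Proof.
move=> pL; rewrite -sumrB -mulrA mulr_suml; apply: le_trans (ler_norm_sum _ _ _) _.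
by apply: ler_sum => i _; rewrite -mulrBr normrM ler_wpM2l.
Qed.

(** A uniform limit of functions that are continuous, being combinations of the
    [p x]. *)
Lemma approximated_continuous (I : set R) (F : R -> \bar R) (p : R -> R -> R) (L : R) :
  (forall x t t', `|p x t - p x t'| <= L * `|t - t'|) ->
  (forall d, 0 < d -> exists s : seq (R * R), forall t, I t ->
    exists r : R, F t = r%:E /\ `|r - \sum_(i <- s) i.1 * p i.2 t| <= d) ->
  {within I, continuous F}.
Proof.
move=> pL approx; have L0 : 0 <= L.
  by have := le_trans (normr_ge0 _) (pL 0 1 0); rewrite subr0 normr1 mulr1.
have FI t : I t -> F t = (fine (F t))%:E.
  by move=> It; have [s /(_ t It)[r [-> _]]] := approx 1 ltr01.
apply/subspace_continuousP => t It.
rewrite [X in _ --> X](FI t It); apply/fine_cvgP; split.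
  by rewrite near_withinE; apply: nearW => t' It'; rewrite /from_subspace (FI t' It').
change ((fun t' => fine (F t')) @ within I (nbhs t) --> fine (F t)).
apply/cvgrPdist_lt => e e0; have e40 : 0 < e / 4 by rewrite divr_gt0.
have [s hs] := approx _ e40.
set c := (\sum_(i <- s) `|i.1|) * L.
have c0 : 0 <= c by rewrite mulr_ge0// sumr_ge0.
have d0 : 0 < e / 4 / (c + 1) by rewrite divr_gt0//; lra.
rewrite near_withinE; near=> t' => It' /=.
have [r [Fr hr]] := hs t It; have [r' [Fr' hr']] := hs t' It'.
rewrite Fr Fr' /=.
have := @sum_step_lipschitz p L s t t' (fun x => pL x t t'); rewrite -/c.
move: hr hr'; set S := \sum_(i <- s) _; set S' := \sum_(i <- s) _ => hr hr' hS.
have tt : `|t - t'| <= e / 4 / (c + 1).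
  by near: t'; apply/nbhs_ballP; exists (e / 4 / (c + 1)) => // z /= /ltW.
have ct : c * `|t - t'| <= e / 4.
  have := ler_wpM2l c0 tt => /le_trans; apply.
  by rewrite mulrA ler_pdivrMr; [have := ltW e40; nra|lra].
have -> : r - r' = (r - S) + (S - S') - (r' - S') by ring.
have := ler_normB (r - S + (S - S')) (r' - S').
have := ler_normD (r - S) (S - S'); lra.
Unshelve. all: by end_near. Qed.

End moving_measures.

Section graph_measures.
Context {R : realType}.
Variables (alpha : R).

Definition graph (v : R) : R * R := (v `^ alpha, v).

Lemma measurable_graph : measurable_fun [set: R] graph.
Proof. by apply: measurable_fun_pair => //; exact: measurable_powR. Qed.

Lemma graph_halfplane : graph @^-1` halfplane = halfline.
Proof. by apply/seteqP; split=> [v []|v hv] //; split. Qed.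

(** Inner regularity is transported because the graph map, continuous on the
    half-line, maps compact subsets to compact subsets. *)
Lemma finite_radon_graph (mu : {measure set R -> \bar R}) :
  finite_radon (@compact R) halfline mu ->
  finite_radon (@compact (R * R)%type) halfplane (image_measure mu measurable_graph).
Proof.
move=> [mu0 mufin reg].
have E D : image_measure mu measurable_graph D = mu (graph @^-1` D) by [].
split.
- by rewrite E -preimage_setC graph_halfplane.
- by rewrite E graph_halfplane.
move=> D mD DX; apply/eqP; rewrite eq_le; apply/andP; split; last first.
  apply: ge_ereal_sup => _ [C [cC CD] <-].
  have mC : measurable C.
    by rewrite -(setCK C); apply: measurableC; apply: open_measurable_plane;
      rewrite openC; exact: compact_closed.
  by apply: le_measure; rewrite ?inE.
rewrite E reg; last 2 first.
- by rewrite -[X in measurable X]setTI; exact: measurable_graph.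
- by rewrite -graph_halfplane; exact: preimage_subset.
apply: ge_ereal_sup => _ [C [cC CD] <-].
have cgC : compact (graph @` C).
  apply: continuous_compact => //.
  apply: continuous_subspaceW (_ : C `<=` halfline) _.
    by move=> v /CD /DX; rewrite -graph_halfplane.
  apply/subspace_continuousP => v; rewrite /halfline /= in_itv/= andbT => v0.
  apply: cvg_within_filter; have c1 := @powR_continuous_gt0 _ alpha v v0.
  exact: (cvg_pair c1 (@cvg_id _ (nbhs v))).
apply: (@le_trans _ _ (image_measure mu measurable_graph (graph @` C))); last first.
  by apply: ereal_sup_ubound; exists (graph @` C) => //; split=> // _ [v /CD hv <-].
have mgC : measurable (graph @` C).
  rewrite -(setCK (graph @` C)); apply: measurableC; apply: open_measurable_plane.
  by rewrite openC; exact: compact_closed.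
rewrite E; apply: le_measure; rewrite ?inE.
- exact: compact_measurable.
- by rewrite -[X in measurable X]setTI; exact: measurable_graph.
- by move=> v Cv; exists v.
Qed.

Lemma integral_graph (mu : {measure set R -> \bar R}) (phi : R * R -> R) :
  (mu halfline < +oo)%E -> vanishing halfplane phi ->
  (\int[image_measure mu measurable_graph]_(p in halfplane) (phi p)%:E =
   \int[mu]_(v in halfline) (phi (graph v))%:E)%E.
Proof.
move=> mufin vphi; have [M phiM] := vanishing_bounded vphi.
have mhl : measurable (@halfline R) by exact: measurable_itv.
have mhp : measurable (@halfplane R) by exact: measurableX.
pose phi0 : R * R -> R := phi \_ halfplane.
have mphi0 : measurable_fun setT phi0.
  apply/(measurable_restrict phi mhp measurableT); rewrite setTI.
  exact: vanishing_measurable.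
have M0 : 0 <= M.
  apply: le_trans (phiM (0, 1) _); rewrite ?normr_ge0//; split => //.
  by rewrite /halfline /= in_itv/= ltr01.
have phi0E v : halfline v -> phi0 (graph v) = phi (graph v).
  by move=> hv; rewrite /phi0 patchE mem_set//; split.
have iphi : mu.-integrable halfline (EFin \o (phi0 \o graph)).
  apply: (@le_integrable _ _ _ _ _ mhl _ (cst M%:E)).
  - apply/measurable_EFinP; apply: measurable_funTS.
    exact: measurableT_comp mphi0 measurable_graph.
  - move=> v hv; rewrite /= phi0E// lee_fin (ger0_norm M0); apply: phiM; split => //.
  - apply/integrableP; split; first exact: measurable_cst.
    by rewrite /= integral_cst//= lte_mul_pinfty// fin_num_abs.
transitivity (\int[image_measure mu measurable_graph]_(p in halfplane) (EFin \o phi0) p)%E.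
  by apply: eq_integral => p hp; rewrite /= /phi0 patchE hp.
rewrite (@integral_pushforward _ _ _ _ _ _ measurable_graph mu halfplane (EFin \o phi0))//.
- by rewrite graph_halfplane; apply: eq_integral => v /set_mem hv /=; rewrite phi0E.
- exact/measurable_EFinP.
- by rewrite graph_halfplane.
Qed.

End graph_measures.

(** * Cumulative mass of a solution *)

Section cumulative_mass.
Context {R : realType}.
Local Notation mu := (@lebesgue_measure R).
Variables (K0 alpha gamma b m M1 M2 A T eps : R).
Variables (K : R -> R -> R) (H : R -> R -> R -> R).

Definition total_const : R := 8 * pi * mass_const m M1 M2 A T.

(** One constant for the bound and for both variables; the summand 1 makes it
    positive. *)
Definition lipschitz_const : R :=
  total_const + 8 * mass_const m M1 M2 A T +
  loss_const K0 alpha m M1 M2 A T * total_const + 1.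

Definition concentration_const (sigma : R) : R :=
  8 * pi * (core_coef M2 A * (4 * pi / sigma) + tail_coef M1 A * pi).

Definition cumulative x t : R := fine (cumul T H x t).

Hypotheses (K00 : 0 < K0) (al : 0 < alpha < 1) (ga : 1 < gamma < 1 + alpha)
  (cK : coagulation_kernel K0 gamma K) (gb : gamma + 3 < b) (m3 : 3 <= m)
  (M10 : 0 < M1) (A1 : 1 <= A) (T0 : 0 < T) (eps0 : 0 < eps) (eps1 : eps <= 1)
  (sol : mild_solution alpha eps K T H)
  (bnd : boundsB alpha b m M1 M2 A eps T H).

Let mc0 : 0 <= mass_const m M1 M2 A T.
Proof. exact: (mass_const_ge0 M2 m3 M10 A1 T0 eps0 eps1). Qed.

Let lc0 : 0 <= loss_const K0 alpha m M1 M2 A T.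
Proof. exact: (loss_const_ge0 M2 K00 al m3 M10 A1 T0 eps0 eps1). Qed.

Lemma total_const_ge0 : 0 <= total_const.
Proof. by rewrite !mulr_ge0// pi_ge0. Qed.

Lemma total_const_lt : total_const < lipschitz_const.
Proof.
have := mulr_ge0 lc0 total_const_ge0; rewrite /lipschitz_const; have := mc0; lra.
Qed.

Lemma cumulativeE x t : cumul T H x t = (cumulative x t)%:E.
Proof.
rewrite /cumulative fineK// ge0_fin_numE; last exact: (cumul_ge0 sol).
by apply: le_lt_trans (cumul_le al ga gb m3 M10 A1 T0 eps0 eps1 sol bnd x t) _; rewrite ltry.
Qed.

Lemma cumulative_bounds x t : 0 <= cumulative x t <= total_const.
Proof.
rewrite -!lee_fin -cumulativeE; apply/andP; split; first exact: (cumul_ge0 sol).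
exact: (cumul_le al ga gb m3 M10 A1 T0 eps0 eps1 sol bnd x t).
Qed.

Lemma cumulative_out x t : x <= 0 -> cumulative x t = 0.
Proof. by move=> x0; rewrite /cumulative cumul_out. Qed.

Lemma cumulative_space x x' t : x <= x' ->
  cumulative x t <= cumulative x' t <= cumulative x t + lipschitz_const * (x' - x).
Proof.
move=> xx'; have := @cumul_space _ _ _ _ _ _ _ _ _ _ _ _ al ga gb m3 M10 A1 T0 eps0 eps1 sol bnd x x' t xx'.
rewrite !cumulativeE -EFinD !lee_fin => -[h1 h2]; apply/andP; split => //.
apply: le_trans h2 _; rewrite lerD2l ler_wpM2r ?subr_ge0//.
have := mulr_ge0 lc0 total_const_ge0; have := total_const_ge0.
rewrite /lipschitz_const; lra.
Qed.

Lemma cumulative_time x t t' : 0 <= t <= T -> 0 <= t' <= T ->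
  `|cumulative x t - cumulative x t'| <= lipschitz_const * `|t - t'|.
Proof.
have key s s' : 0 <= s -> s <= s' -> s' <= T ->
    `|cumulative x s - cumulative x s'| <= lipschitz_const * `|s - s'|.
  move=> s0 ss sT; have := cumul_time K00 al ga cK gb m3 M10 A1 T0 eps0 eps1 sol bnd x s0 ss sT.
  rewrite !cumulativeE -!EFinD !lee_fin -/total_const distrC [`|s - s'|]distrC => -[h1 h2].
  rewrite [`|s' - s|]ger0_norm ?subr_ge0//.
  have : loss_const K0 alpha m M1 M2 A T * total_const * (s' - s) <= lipschitz_const * (s' - s).
    rewrite ler_wpM2r ?subr_ge0// /lipschitz_const; have := total_const_ge0; have := mc0; lra.
  by move=> h3; rewrite ler_norml; apply/andP; split; lra.
move=> /andP[h1 h2] /andP[h3 h4]; have [tt|/ltW tt] := leP t t'; first exact: key.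
by rewrite distrC [`|t - t'|]distrC; exact: key.
Qed.

Lemma cumulative_lipschitz x x' t t' : 0 <= t <= T -> 0 <= t' <= T ->
  `|cumulative x t - cumulative x' t'| <= lipschitz_const * (`|x - x'| + `|t - t'|).
Proof.
move=> tT tT'.
have key z z' : z <= z' -> `|cumulative z t - cumulative z' t| <= lipschitz_const * `|z - z'|.
  move=> zz; have /andP[h1 h2] := cumulative_space t zz.
  rewrite distrC [`|z - z'|]distrC !ger0_norm ?subr_ge0//; lra.
have h : `|cumulative x t - cumulative x' t| <= lipschitz_const * `|x - x'|.
  have [xx|/ltW xx] := leP x x'; first exact: key.
  by rewrite distrC [`|x - x'|]distrC; exact: key.
have -> : cumulative x t - cumulative x' t' = (cumulative x t - cumulative x' t) +
  (cumulative x' t - cumulative x' t') by ring.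
apply: le_trans (ler_normD _ _) _; rewrite mulrDr; apply: lerD => //.
exact: cumulative_time.
Qed.

Lemma concentration_const_ge0 sigma : 0 < sigma -> 0 <= concentration_const sigma.
Proof.
have pi0 := pi_ge0 R; have A0 : 0 <= A by apply: le_trans A1.
move=> s0; rewrite mulr_ge0 ?mulr_ge0// addr_ge0// mulr_ge0//.
- by rewrite addr_ge0// mulr_ge0.
- by rewrite divr_ge0 ?mulr_ge0// ltW.
- by rewrite !mulr_ge0 ?exprn_ge0// ltW.
Qed.

(** From time [sigma] on, e^(-t/eps) <= eps/[sigma]. *)
Lemma concentration_rate sigma t : 0 < sigma -> sigma <= t <= T ->
  (\int[mu]_v \int[mu]_y (Num.min 1 `|y - v `^ alpha| * extH T H y v t)%:E <=
    (concentration_const sigma * eps)%:E)%E.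
Proof.
move=> s0 /andP[st tT]; have t0 : 0 < t by exact: lt_le_trans st.
apply: le_trans (concentration al ga gb m3 M10 A1 eps0 sol bnd _) _.
  by rewrite ltW.
have pi0 := pi_ge0 R; have A0 : 0 <= A by apply: le_trans A1.
rewrite lee_fin /concentration_const -[leRHS]mulrA; apply: ler_wpM2l; first exact: mulr_ge0.
have rate : (expR (t / eps))^-1 <= eps / sigma.
  rewrite -[leRHS]invf_div lef_pV2 ?posrE ?expR_gt0 ?divr_gt0//.
  apply: (@le_trans _ _ (t / eps)); first by rewrite ler_pM2r ?invr_gt0.
  by apply: le_trans (expR_ge1Dx _); rewrite lerDr.
have c10 : 0 <= core_coef M2 A * (4 * pi) by rewrite mulr_ge0 ?addr_ge0// mulr_ge0.
have := ler_wpM2l c10 rate; rewrite !mulrA; lra.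
Qed.

(** The solution seen as a density concentrated near the curve. *)
Lemma solution_step_approximation (phi : R * R -> R) (delta C sigma t : R)
    (s : seq (R * R)) :
  0 < sigma -> sigma <= t <= T -> vanishing halfplane phi -> 0 <= delta -> 0 <= C ->
  (forall y v, 0 < v -> `|phi (y, v) - step s v| <= delta + C * Num.min 1 `|y - v `^ alpha|) ->
  exists r : R, (\int[mu]_y \int[mu]_(v in halfline) (H y v t * phi (y, v))%:E = r%:E)%E
    /\ `|r - \sum_(i <- s) i.1 * cumulative i.2 t|
      <= delta * total_const + C * (concentration_const sigma * eps).
Proof.
move=> s0 sT vphi d0 C0 phis; have /andP[st tT] := sT.
have t0 : 0 <= t <= T by rewrite tT andbT; exact: le_trans (ltW s0) st.
have [M phiM] := vanishing_bounded vphi.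
have mf : measurable_fun [set: R * R] (fun p : R * R => extH T H p.1 p.2 t).
  exact: (measurable_section sol measurable_fst measurable_snd (measurable_cst t)).
have [r [Er hr]] := density_approximation mf (fun y v => extH_ge0 sol y v t)
  (fun y v => @extH_out _ T H y v t)
  (slice_mass al ga gb m3 M10 A1 T0 eps0 eps1 sol bnd t) (concentration_rate s0 sT)
  (vanishing_measurable vphi) phiM d0 C0 phis.
exists r; split=> //; rewrite -Er; apply: eq_integral => y _; apply: eq_integral => v.
by rewrite inE /halfline /= in_itv/= andbT /extH t0 => ->.
Qed.

End cumulative_mass.

(** * Passage to the limit *)

Section clamping.
Context {R : realType}.
Variable T : R.
Hypothesis T0 : 0 <= T.

(** Projection onto [[0, T]], which extends the cumulative mass to all times with
    the same Lipschitz constant. *)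
Definition clamp (t : R) : R := Num.max 0 (Num.min t T).

Lemma clamp_itv t : 0 <= clamp t <= T.
Proof. by rewrite /clamp le_max lexx/= ge_max T0/= ge_min lexx orbT. Qed.

Lemma clamp_id t : 0 <= t <= T -> clamp t = t.
Proof. by move=> /andP[t0 tT]; rewrite /clamp min_l// max_r. Qed.

Lemma clamp_lipschitz t t' : `|clamp t - clamp t'| <= `|t - t'|.
Proof.
have h1 := ler_norm (t - t'); have h2 := ler_norm (t' - t); have h := T0.
rewrite distrC in h2; rewrite /clamp ler_norml; apply/andP.
by case: (leP t T) => ?; case: (leP t' T) => ?; case: (leP 0 t) => ?;
  case: (leP 0 t') => ?; case: (leP 0 T) => ?; split; lra.
Qed.

End clamping.

Lemma limit_le {R : realType} (u v : nat -> R) (a c : R) :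
  u n @[n --> \oo] --> a -> v n @[n --> \oo] --> c -> (forall n, u n <= v n) -> a <= c.
Proof.
move=> ua vc uv; rewrite -(cvg_lim _ ua)// -(cvg_lim _ vc)//.
apply: ler_lim; [by apply/cvg_ex; eexists; exact: ua|by apply/cvg_ex; eexists; exact: vc|].
exact: nearW.
Qed.

Section limit_function.
Context {R : realType}.
Variables (F : nat -> R -> R -> R) (p : R -> R -> R) (L B : R).
Hypothesis Fp : forall x t, F n x t @[n --> \oo] --> p x t.

Lemma limit_space : (forall n x x' t, x <= x' -> F n x t <= F n x' t <= F n x t + L * (x' - x)) ->
  forall x x' t, x <= x' -> p x t <= p x' t <= p x t + L * (x' - x).
Proof.
move=> FL x x' t xx'; apply/andP; split.
  by apply: (limit_le (@Fp x t) (@Fp x' t)) => n; have /andP[] := FL n x x' t xx'.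
apply: (limit_le (@Fp x' t) (cvgD (@Fp x t) (cvg_cst (L * (x' - x))))) => n.
by have /andP[] := FL n x x' t xx'.
Qed.

Lemma limit_out : (forall n x t, x <= 0 -> F n x t = 0) -> forall x t, x <= 0 -> p x t = 0.
Proof.
move=> F0 x t x0; apply/eqP; rewrite eq_le; apply/andP; split.
  by apply: (limit_le (@Fp x t) (cvg_cst (0 : R))) => n; rewrite F0.
by apply: (limit_le (cvg_cst (0 : R)) (@Fp x t)) => n; rewrite F0.
Qed.

Lemma limit_bound : (forall n x t, F n x t <= B) -> forall x t, p x t <= B.
Proof. by move=> FB x t; apply: (limit_le (@Fp x t) (cvg_cst B)) => n. Qed.

Lemma limit_time : (forall n x t t', `|F n x t - F n x t'| <= L * `|t - t'|) ->
  forall x t t', `|p x t - p x t'| <= L * `|t - t'|.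
Proof.
move=> FL x t t'; have cv := cvg_norm (cvgB (@Fp x t) (@Fp x t')).
by apply: (limit_le (cv _ _) (cvg_cst (L * `|t - t'|))) => n; exact: FL.
Qed.

Lemma limit_steps (s : seq (R * R)) t :
  \sum_(i <- s) i.1 * F n i.2 t @[n --> \oo] --> \sum_(i <- s) i.1 * p i.2 t.
Proof.
elim: s => [|i s IH].
  by under eq_fun do rewrite big_nil; rewrite big_nil; exact: cvg_cst.
under eq_fun do rewrite big_cons; rewrite big_cons; apply: cvgD => //.
by apply: cvgM; [exact: cvg_cst|exact: @Fp].
Qed.

End limit_function.

(** The approximating sequence and the constant [C] depend on the precision [d],
    while [e] tends to 0 on its own: first [d] is chosen, then [n]. *)
Lemma approximated_limit {R : realType} (u e : nat -> R) (l : R)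
  (ul : forall d, 0 < d -> exists (S : nat -> R) (l' C : R), [/\ 0 <= C,
     S n @[n --> \oo] --> l', `|l - l'| <= d & forall n, `|u n - S n| <= d + C * e n]) :
  (forall n, 0 <= e n) -> e n @[n --> \oo] --> (0 : R) -> u n @[n --> \oo] --> l.
Proof.
move=> epos e0; apply/cvgrPdist_lt => c c0; have c60 : 0 < c / 6 by rewrite divr_gt0.
have [S' [l' [C [C0 Sl ll uS]]]] := ul _ c60.
have d0 : 0 < c / 6 / (C + 1) by rewrite divr_gt0//; lra.
have /cvgrPdist_lt /(_ _ c60) S1 := Sl.
have /cvgrPdist_lt /(_ _ d0) e1 := e0.
near=> n.
have h1 : `|l' - S' n| < c / 6 by near: n; exact: S1.
have h2 : `|0 - e n| < c / 6 / (C + 1) by near: n; exact: e1.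
have h3 := uS n.
have h4 : C * e n <= c / 6.
  move: h2; rewrite sub0r normrN (ger0_norm (epos n)) ltr_pdivlMr; last lra.
  have := epos n; lra.
have -> : l - u n = (l - l') + (l' - S' n) - (u n - S' n) by ring.
have := ler_normB (l - l' + (l' - S' n)) (u n - S' n).
have := ler_normD (l - l') (l' - S' n); lra.
Unshelve. all: by end_near. Qed.

(** * Convergence *)

Theorem theorem2p12 (R : realType) (K0 alpha gamma : R) (K : R -> R -> R)
    (b m M1 M2 A T epsbar : R)
    (Hin : R -> R -> R -> R) (Heps : R -> R -> R -> R -> R) (sigma : R) :
  0 < K0 ->
  0 < alpha < 1 -> 1 < gamma < 1 + alpha ->
  coagulation_kernel K0 gamma K ->
  Num.max (bbar gamma alpha) (2 * gamma + 1) <= b ->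
  Num.max (2 * (gamma + 1) / alpha) (b / alpha + 1) < m ->
  gamma + 3 < b ->
  0 < M1 ->
  1 <= A -> 0 < T -> 0 < epsbar < 1 ->
  (forall eps, 0 < eps <= epsbar ->
    [/\ C1_on halfplane (fun p => Hin eps p.1 p.2),
        forall y v, 0 < v -> 0 <= Hin eps y v &
        forall y v, 0 < v ->
          (1 + v `^ b) * Hin eps y v <= A / (1 + `|y - v `^ alpha| `^ m)]) ->
  (forall eps, 0 < eps <= epsbar ->
    [/\ mild_solution alpha eps K T (Heps eps),
        forall y v, 0 < v -> Heps eps y v 0 = Hin eps y v,
        mass_conserving T (Heps eps) &
        boundsB alpha b m M1 M2 A eps T (Heps eps)]) ->
  0 < sigma <= T ->
  exists (e : nat -> R) (H : R -> {measure set (R * R) -> \bar R}),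
    [/\ (forall n, 0 < e n <= epsbar),
        e n @[n --> \oo] --> (0 : R),
        C_Mplus_halfplane `[sigma, T] H,
        (forall t phi, sigma <= t <= T -> vanishing halfplane phi ->
          (\int[lebesgue_measure]_y \int[lebesgue_measure]_(v in halfline)
              (Heps (e n) y v t * phi (y, v))%:E)%E @[n --> \oo]
            --> (\int[H t]_(p in halfplane) (phi p)%:E)%E)
      & exists Hbar : R -> {measure set R -> \bar R},
          C_Mplus_halfline `[sigma, T] Hbar /\
          forall t phi, sigma <= t <= T -> vanishing halfplane phi ->
            (\int[H t]_(p in halfplane) (phi p)%:E
             = \int[Hbar t]_(v in halfline) (phi (v `^ alpha, v))%:E)%E].
Proof.
move=> K00 al ga cK _ mbig gb M10 A1 T0 /andP[eb0 eb1] _ solutions /andP[s0 sT].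
have m3 : 3 <= m.
  (* 2 (gamma + 1) / alpha > 4 *)
  have [/andP[a0 a1] /andP[g1 _]] := (al, ga).
  apply: (@le_trans _ _ (2 * (gamma + 1) / alpha)).
    by rewrite ler_pdivlMr//; nra.
  by apply: ltW; apply: le_lt_trans mbig; rewrite le_max lexx.
have sol eps : 0 < eps <= epsbar -> [/\ 0 < eps, eps <= 1,
    mild_solution alpha eps K T (Heps eps) & boundsB alpha b m M1 M2 A eps T (Heps eps)].
  move=> /[dup] /solutions[h1 _ _ h2] /andP[h3 h4]; split=> //.
  exact: le_trans h4 (ltW eb1).
set B := total_const m M1 M2 A T.
set L := lipschitz_const K0 alpha m M1 M2 A T.
have T0' : 0 <= T by exact: ltW.
have eb : 0 < epsbar <= epsbar by rewrite eb0 lexx.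
have B0 : 0 <= B.
  by have [h1 h2 _ _] := sol _ eb; exact: (total_const_ge0 M2 m3 M10 A1 T0 h1 h2).
have BL : B < L.
  by have [h1 h2 _ _] := sol _ eb; exact: (total_const_lt M2 K00 al m3 M10 A1 T0 h1 h2).
have L0 : 0 < L by exact: le_lt_trans BL.
(* Clamping the time makes the cumulative mass Lipschitz on the whole plane. *)
pose Phi eps x t := cumulative T (Heps eps) x (clamp T t).
have Phi_bounds eps x t : 0 < eps <= epsbar -> 0 <= Phi eps x t <= B.
  move=> /sol[h1 h2 h3 h4].
  exact: (cumulative_bounds al ga gb m3 M10 A1 T0 h1 h2 h3 h4).
have Phi_lip eps x t x' t' : 0 < eps <= epsbar ->
    `|Phi eps x t - Phi eps x' t'| <= L * (`|x - x'| + `|t - t'|).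
  move=> /sol[h1 h2 h3 h4].
  apply: (@le_trans _ _ (L * (`|x - x'| + `|clamp T t - clamp T t'|))).
    by apply: (cumulative_lipschitz K00 al ga cK gb m3 M10 A1 T0 h1 h2 h3 h4);
      exact: clamp_itv.
  by apply: ler_wpM2l; [exact: ltW|rewrite lerD2l clamp_lipschitz].
have [eps [p [epsP eps_to0 Phi_p]]] : exists (e : nat -> R) (p : R -> R -> R),
    [/\ forall n, 0 < e n <= epsbar, e n @[n --> \oo] --> (0 : R) &
    forall x t, Phi (e n) x t @[n --> \oo] --> p x t].
  apply: (@lipschitz_extraction _ Phi epsbar L eb0) => // e x t /Phi_bounds h.
  by have /andP[h1 h2] := h x t; rewrite ger0_norm// (le_trans h2)// ltW.
pose F n := Phi (eps n).
have pF x t : F n x t @[n --> \oo] --> p x t by exact: Phi_p.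
have p_space : forall x x' t, x <= x' -> p x t <= p x' t <= p x t + L * (x' - x).
  apply: (limit_space pF) => n x x' t xx'; have [h1 h2 h3 h4] := sol _ (epsP n).
  exact: (cumulative_space K00 al ga gb m3 M10 A1 T0 h1 h2 h3 h4).
have p_out : forall x t, x <= 0 -> p x t = 0.
  by apply: (limit_out pF) => n x t; exact: cumulative_out.
have p_le : forall x t, p x t <= B.
  by apply: (limit_bound pF) => n x t; have /andP[] := Phi_bounds (eps n) x t (epsP n).
have p_time : forall x t t', `|p x t - p x t'| <= L * `|t - t'|.
  apply: (limit_time pF) => n x t t'; apply: le_trans (Phi_lip _ _ _ _ _ (epsP n)) _.
  by rewrite subrr normr0 add0r.
have [Hbar HbarP] := choice (fun t => stieltjes_measure L0
  (fun x y => @p_space x y t) (fun x => @p_out x t) (fun x => p_le x t)).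
have Hbar_radon t : finite_radon (@compact R) halfline (Hbar t).
  by have [h1 _ h2 h3] := HbarP t; exact: finite_radon_dominated L0 h1 h2 h3.
pose H t := image_measure (Hbar t) (measurable_graph alpha).
have HE phi t : vanishing halfplane phi -> (\int[H t]_(q in halfplane) (phi q)%:E =
    \int[Hbar t]_(v in halfline) (phi (v `^ alpha, v))%:E)%E.
  by move=> vphi; apply: integral_graph => //; have [] := Hbar_radon t.
(* One step function serves all times: this gives the continuity in time. *)
have steps g d : vanishing halfline g -> 0 < d -> exists s : seq (R * R),
    (forall v, 0 < v -> `|g v - step s v| <= d) /\
    forall t, exists r : R, (\int[Hbar t]_(v in halfline) (g v)%:E = r%:E)%E /\
      `|r - \sum_(i <- s) i.1 * p i.2 t| <= d * B.
  move=> vg d0; have [s hs] := vanishing_step vg d0; exists s; split=> // t.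
  have [_ h2 h3 _] := HbarP t.
  exact: (@measure_step_approximation _ (fun x => p x t) B (Hbar t) h2 h3 g d s vg hs).
have Hbar_cont : weakstar_continuous (vanishing halfline) halfline `[sigma, T] Hbar.
  move=> g vg; apply: (@approximated_continuous _ _ _ p L p_time) => d d0.
  have d'0 : 0 < d / (B + 1) by rewrite divr_gt0//; lra.
  have [s [_ hs]] := steps g _ vg d'0; exists s => t _.
  have [r [-> hr]] := hs t; exists r; split=> //; apply: le_trans hr _.
  rewrite mulrAC ler_pdivrMr; last lra.
  by rewrite ler_wpM2l ?ltW//; lra.
exists eps, H; split=> //.
- split=> [t _|phi vphi]; first exact: finite_radon_graph.
  rewrite (_ : (fun t => _) =
      fun t => (\int[Hbar t]_(v in halfline) (phi (v `^ alpha, v))%:E)%E).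
    exact: Hbar_cont (vanishing_trace alpha vphi).
  by apply/funext => t; exact: HE.
- move=> t phi /andP[st tT] vphi; rewrite HE//.
  have vg := vanishing_trace alpha vphi.
  have tT0 : 0 <= t <= T by rewrite tT (le_trans (ltW s0)).
  pose u n : \bar R := (\int[lebesgue_measure]_y \int[lebesgue_measure]_(v in halfline)
    (Heps (eps n) y v t * phi (y, v))%:E)%E.
  pose cc := concentration_const M1 M2 A sigma.
  have cc0 : 0 <= cc by exact: (concentration_const_ge0 M2 M10 A1 s0).
  have approx d : 0 < d -> exists (s : seq (R * R)) (C : R), [/\ 0 <= C,
      exists r : R, (\int[Hbar t]_(v in halfline) (phi (v `^ alpha, v))%:E = r%:E)%E /\
        `|r - \sum_(i <- s) i.1 * p i.2 t| <= d &
      forall n, exists r : R, u n = r%:E /\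
        `|r - \sum_(i <- s) i.1 * F n i.2 t| <= d + C * eps n].
    (* [phi] is within [d'] of its trace near the curve, and the trace within [d']
       of the step function, whence the error [2 * d'] times the mass bound [B]. *)
    move=> d0; have d'0 : 0 < d / (2 * B + 1) by rewrite divr_gt0//; lra.
    have dB : d / (2 * B + 1) * (2 * B) <= d.
      by rewrite mulrAC ler_pdivrMr; [rewrite ler_wpM2l ?ltW//; lra|lra].
    set d' := d / (2 * B + 1) in d'0 dB.
    have [s [hs hr]] := steps _ d' vg d'0.
    have [C C0 hC] := vanishing_modulus alpha vphi d'0.
    exists s, (C * cc); split; first exact: mulr_ge0.
      have [r [-> h]] := hr t; exists r; split=> //; apply: le_trans h _.
      have := mulr_ge0 (ltW d'0) B0; lra.
    move=> n; have [h1 h2 h3 h4] := sol _ (epsP n).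
    have stT : sigma <= t <= T by rewrite st.
    have d'2 : 0 <= 2 * d' by lra.
    have phis y v : 0 < v ->
        `|phi (y, v) - step s v| <= 2 * d' + C * Num.min 1 `|y - v `^ alpha|.
      move=> v0; have := hC y v v0; have := hs v v0.
      have := ler_normD (phi (y, v) - phi (v `^ alpha, v)) (phi (v `^ alpha, v) - step s v).
      rewrite addrA subrK; lra.
    have [r [Er hr']] := solution_step_approximation al ga gb m3 M10 A1 T0 h1 h2 h3 h4
      s0 stT vphi d'2 C0 phis.
    exists r; split; first exact: Er.
    have -> : \sum_(i <- s) i.1 * F n i.2 t = \sum_(i <- s) i.1 * cumulative T (Heps (eps n)) i.2 t.
      by apply: eq_bigr => i _; rewrite /F /Phi clamp_id.
    apply: le_trans hr' _; rewrite -/B -/cc; have := dB; lra.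
  have uE n : u n = (fine (u n))%:E.
    by have [s [C [_ _ /(_ n)[r [-> _]]]]] := approx 1 ltr01.
  have lE : (\int[Hbar t]_(v in halfline) (phi (v `^ alpha, v))%:E =
      (fine (\int[Hbar t]_(v in halfline) (phi (v `^ alpha, v))%:E))%:E)%E.
    by have [s [C [_ [r [-> _]] _]]] := approx 1 ltr01.
  rewrite lE; apply/fine_cvgP; split.
    by apply: nearW => n; rewrite -/(u n) uE.
  apply: (@approximated_limit _ _ eps) => //; last first.
    by move=> n; have /andP[/ltW] := epsP n.
  move=> d d0; have [s [C [C0 [r [Er hr]] hu]]] := approx d d0.
  exists (fun n => \sum_(i <- s) i.1 * F n i.2 t), (\sum_(i <- s) i.1 * p i.2 t), C; split=> //.
  + exact: limit_steps.
  + by rewrite Er.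
  + by move=> n; have [r' [Er' hr']] := hu n; rewrite /= -/(u n) Er'.
exists Hbar; split; last by move=> t phi _; exact: HE.
by split=> // t _; exact: Hbar_radon.
Qed.
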